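(* Let $p_c$ be the critical probability of i.i.d. Bernoulli site percolation on the square grid, and let $h_0>0$ satisfy $\frac{e^{h_0}}{e^{h_0}+e^{-h_0}}=p_c$. Consider a high-temperature XOR Ising model with couplings $J_h\ge0$ on horizontal edges and $J_v\ge0$ on vertical edges, where $e^{-2J_h}+e^{-2J_v}+e^{-2J_h-2J_v}>1$. If $2(J_h+J_v)<h_0$, then almost surely (I) there are no infinite ``$+$''-clusters and no infinite ``$-$''-clusters, and (II) there exists exactly one infinite contour. Moreover, let $J_h'>0$, $J_v'>0$ satisfy $e^{-2J_h}+e^{-2J_v'}+e^{-2J_h-2J_v'}=1$ and $e^{-2J_h'}+e^{-2J_v}+e^{-2J_h'-2J_v}=1$. Then the XOR Ising model with coupling $J_h'$ on horizontal edges and $J_v'$ on vertical edges is a low-temperature XOR Ising model (i.e. $e^{-2J_h'}+e^{-2J_v'}+e^{-2J_h'-2J_v'}<1$), and in it almost surely the total number of infinite ``$+$''-clusters and infinite ``$-$''-clusters is exactly one.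
   Context: For couplings $J_h,J_v\ge0$, the Ising model on $\mathbb{Z}^2$ (nearest-neighbour edges) with coupling $J_h$ on horizontal and $J_v$ on vertical edges and no external field is taken with the infinite-volume law obtained as the weak limit, as $n\to\infty$, of Ising measures on $n\times n$ tori (periodic boundary conditions). The XOR Ising model is $\sigma_{XOR}(v)=\sigma_1(v)\sigma_2(v)$, where $\sigma_1,\sigma_2$ are independent copies of this Ising model with the same couplings. A ``$+$''-cluster (resp. ``$-$''-cluster) is a maximal nearest-neighbour-connected set of vertices on which $\sigma_{XOR}=+1$ (resp. $-1$). The contour configuration is the set of edges of the dual lattice $(\mathbb{Z}+\tfrac12)^2$ crossing an edge of $\mathbb{Z}^2$ whose endpoints have different values of $\sigma_{XOR}$; a contour is a connected component of this set, infinite if it has infinitely many edges. *)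

(* Defs.v *)
From HB Require Import structures.
From mathcomp Require Import all_boot all_order all_algebra.
From mathcomp Require Import all_classical all_reals all_analysis.
Unset Strict Implicit. Unset Printing Implicit Defensive.
Import Order.TTheory GRing.Theory Num.Theory.
Import numFieldNormedType.Exports.
Local Open Scope classical_set_scope.
Local Open Scope ring_scope.

Definition Site := (int * int)%type.
(* Spin configurations on Z^2: true = +1, false = -1. *)
Definition Config := Site -> bool.

Definition adjb (a b : Site) : bool := `|a.1 - b.1| + `|a.2 - b.2| == 1.

Definition conn_in (A : pred Site) (v w : Site) : Prop :=
  exists s : seq Site, [&& path adjb v s, last v s == w & all A (v :: s)].

Definition cluster (sg : Config) (v : Site) : set Site :=
  [set w | conn_in (fun u => sg u == sg v) v w].

Definition no_inf_cluster_of_sign (sg : Config) (b : bool) : Prop :=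
  forall v, sg v = b -> finite_set (cluster sg v).

Definition unique_inf_cluster (sg : Config) : Prop :=
  exists v, ~ finite_set (cluster sg v) /\
    forall w, ~ finite_set (cluster sg w) -> cluster sg w = cluster sg v.

(* Edges of Z^2: (v, true) = {v, v+(1,0)}, (v, false) = {v, v+(0,1)}.
   Each is in bijection with the dual edge crossing it. *)
Definition PEdge := (Site * bool)%type.
Definition other_end (e : PEdge) : Site :=
  if e.2 then (e.1.1 + 1, e.1.2) else (e.1.1, e.1.2 + 1).
(* Endpoints of the dual edge crossing e; the dual vertex (i,j) stands for
   (i+1/2, j+1/2) in (Z+1/2)^2. *)
Definition dual_ends (e : PEdge) : seq Site :=
  if e.2 then [:: (e.1.1, e.1.2 - 1); e.1]
  else [:: (e.1.1 - 1, e.1.2); e.1].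
Definition dadj (e f : PEdge) : bool :=
  (e != f) && has (fun a => a \in dual_ends f) (dual_ends e).

Definition contour_set (sg : Config) : pred PEdge :=
  fun e => sg e.1 != sg (other_end e).

Definition contour_of (sg : Config) (e : PEdge) : set PEdge :=
  [set f | exists s : seq PEdge,
      [&& path dadj e s, last e s == f & all (contour_set sg) (e :: s)]].

Definition unique_inf_contour (sg : Config) : Prop :=
  exists e, contour_set sg e /\ ~ finite_set (contour_of sg e) /\
    forall f, contour_set sg f -> ~ finite_set (contour_of sg f) ->
      contour_of sg f = contour_of sg e.

Section Torus.
Variable R : realType.

Definition spin (b : bool) : R := if b then 1 else -1.

Definition TSite (n : nat) := ('I_n.+1 * 'I_n.+1)%type.

Definition torus_weight (Jh Jv : R) (n : nat) (t : {ffun TSite n -> bool}) : R :=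
  expR (\sum_(v : TSite n)
          (Jh * spin (t v) * spin (t (ordS v.1, v.2))
           + Jv * spin (t v) * spin (t (v.1, ordS v.2)))).

Definition torus_Z (Jh Jv : R) (n : nat) : R :=
  \sum_(t : {ffun TSite n -> bool}) torus_weight Jh Jv n t.

Definition to_torus (n : nat) (s : Site) : TSite n :=
  (inord (absz (s.1 %% (n.+1)%:Z)%Z), inord (absz (s.2 %% (n.+1)%:Z)%Z)).

Definition torus_cyl (Jh Jv : R) (n : nat) (W : seq Site) (xi : Config) : R :=
  (\sum_(t : {ffun TSite n -> bool} | all (fun s => t (to_torus n s) == xi s) W)
      torus_weight Jh Jv n t) / torus_Z Jh Jv n.

(* (sig1, sig2) on (Omega, P) are random configurations (coordinates measurable)
   whose joint law is the weak limit, as n -> oo, of the product of two torus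
   Ising measures with couplings Jh, Jv (weak convergence on the compact space
   {-1,1}^{Z^2} x {-1,1}^{Z^2}, expressed on cylinder events). *)
Definition ising_pair_law (Jh Jv : R) d (Omega : measurableType d)
    (P : probability Omega R) (sig1 sig2 : Omega -> Config) : Prop :=
  (forall v, measurable [set w | sig1 w v]) /\
  (forall v, measurable [set w | sig2 w v]) /\
  (forall (W : seq Site) (xi1 xi2 : Config),
     torus_cyl Jh Jv n W xi1 * torus_cyl Jh Jv n W xi2 @[n --> \oo] -->
       (fine (P [set w | all (fun s => (sig1 w s == xi1 s) && (sig2 w s == xi2 s)) W]) : R)).

(* XOR configuration: sigma1 * sigma2 = +1 iff sigma1 = sigma2 *)
Definition xor_conf (s1 s2 : Config) : Config := fun v => s1 v == s2 v.

Definition bcoord (N : nat) (i : 'I_(N.*2.+1)) : int := i%:Z - N%:Z.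

Definition box_ext (N : nat) (om : {ffun ('I_(N.*2.+1) * 'I_(N.*2.+1)) -> bool})
  : Config :=
  fun s => [exists ij : 'I_(N.*2.+1) * 'I_(N.*2.+1),
              [&& bcoord N ij.1 == s.1, bcoord N ij.2 == s.2 & om ij]].

Definition perc_box (p : R) (N : nat) : R :=
  \sum_(om : {ffun ('I_(N.*2.+1) * 'I_(N.*2.+1)) -> bool} |
        `[< exists w : Site, (`|w.1| == N%:Z \/ `|w.2| == N%:Z) /\
                             conn_in (box_ext N om) (0, 0) w >])
     p ^+ #|[set ij | om ij]| * (1 - p) ^+ #|[set ij | ~~ om ij]|.

(* theta(p) = P_p(|C_0| = oo) = lim_N P_p(0 <-> boundary of box N) is zero *)
Definition theta_zero (p : R) : Prop := perc_box p n @[n --> \oo] --> 0.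

Definition p_c : R := sup [set p : R | 0 <= p <= 1 /\ theta_zero p].

End Torus.

(* Main.v *)
(** High temperature. Given sigma1 and the other spins of sigma2, a site has a
    given XOR sign with probability at most p = e^h / (e^h + e^-h), where
    h = 2 (J_h + J_v) < h_0; hence the clusters of either sign are dominated by
    Bernoulli percolation with p < p_c. This excludes infinite clusters, and two
    infinite contours would be separated by an infinite cluster. If there were
    no infinite contour, some site would be enclosed by infinitely many
    clusters, among them some meeting a horizontal ray at an arbitrary distance
    k and of diameter at least k; this is excluded by Borel-Cantelli, because
    sum_k P_p(0 <-> distance k) is finite by sharpness of the phase transition
    (argument of Duminil-Copin and Tassion).

    Low temperature. Expanding in spin monomials, the edges of a set A all lie
    in the contour of one Ising copy with probability at most
    prod_A e^(-2 J'), so they all lie in the XOR contour with probability at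
    most prod_A 2 e^(-2 J'). By duality e^(-2 J'_v) = tanh J_h and
    e^(-2 J'_h) = tanh J_v, and a Peierls argument for site percolation gives
    p_c <= 10/13, hence h_0 < 2/3. Then the weighted number of
    non-backtracking dual walks decays exponentially, so that all contours are
    finite and those enclosing a given site are finitely many. *)

Require Import Defs.
From HB Require Import structures.
From mathcomp Require Import all_boot all_order all_algebra.
From mathcomp Require Import all_classical all_reals all_analysis.
From mathcomp Require Import zify ring lra.
Import Order.TTheory GRing.Theory Num.Theory.
Import numFieldNormedType.Exports.
Local Open Scope classical_set_scope.
Local Open Scope ring_scope.
Set Implicit Arguments. Unset Strict Implicit. Unset Printing Implicit Defensive.

(** * Contours and clusters in the square lattice *)

(** The planar topology rests on one fact in place of the Jordan curve theorem: a set of dual edges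
    with even degree at every dual vertex is the boundary of a set of sites, found by counting
    parities along rays. A finite contour thus bounds a finite set. The infinite-volume law is given
    as a limit on cylinders, so each probabilistic input is an upper bound for a local event, proved
    on all large tori with one constant and used through Borel-Cantelli. The numbers fit as follows.
    A dual walk has three continuations; if both weights [2 * expR (-2 * J')] equal x, the threshold
    is 3 x = 1, and in general it suffices that their sum is below 2/3. Duality and tanh J <= J
    bound the sum by [2 * (Jh + Jv)], so h_0 <= 2/3 is enough, that is a critical probability of at
    most e^(4/3) / (1 + e^(4/3)), about 0.79. The Peierls argument must therefore count closed king
    walks with growth rate below about 4.79: excluding reversals alone leaves 7, while excluding
    shortcuts gives 2 + sqrt 5, about 4.24. *)

Definition bnd_in (M : nat) (s : Site) : bool := (`|s.1| <= M%:Z) && (`|s.2| <= M%:Z).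

Definition irange (M : nat) : seq int := [seq (i%:Z - M%:Z) | i <- iota 0 (M.*2.+1)].

Lemma mem_irange M (x : int) : (x \in irange M) = (`|x| <= M%:Z).
Proof.
apply/mapP/idP => [[i]|h].
  by rewrite mem_iota => ? ->; lia.
exists (absz (x + M%:Z)); last by lia.
by rewrite mem_iota; lia.
Qed.

Definition box (M : nat) : seq Site := [seq (i, j) | i <- irange M, j <- irange M].

Lemma mem_box M s : (s \in box M) = bnd_in M s.
Proof.
case: s => x y; apply/allpairsP/andP => [[[i j] /= [hi hj [-> ->]]]|[h1 h2]].
  by rewrite -!mem_irange.
by exists (x, y); rewrite !mem_irange.
Qed.

Lemma finite_bounded (A : set Site) : finite_set A <-> exists M, forall s, A s -> bnd_in M s.
Proof.
split=> [/finite_seqP[s ->]|[M h]].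
  elim: s => [|x s [M ih]]; first by exists 0%N => s; rewrite /= in_nil.
  exists (maxn M (maxn (absz x.1) (absz x.2))) => y /=.
  rewrite inE => /orP[/eqP ->|/ih] {ih}; rewrite /bnd_in; lia.
apply: (@sub_finite_set _ _ [set` box M]); last exact: finite_seq.
by move=> s /h hs /=; rewrite mem_box.
Qed.

Lemma finite_bounded_edges (A : set PEdge) :
  finite_set A <-> exists M, forall e, A e -> bnd_in M e.1.
Proof.
split=> [/finite_seqP[s ->]|[M h]].
  elim: s => [|x s [M ih]]; first by exists 0%N => s; rewrite /= in_nil.
  case: x => -[a b] c; exists (maxn M (maxn (absz a) (absz b))) => y /=.
  rewrite inE => /orP[/eqP ->|/ih] {ih}; rewrite /bnd_in /=; first by lia.
  by case: y => -[z t] ? /=; lia.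
apply: (@sub_finite_set _ _ [set` [seq (s, b) | s <- box M, b <- [:: true; false]]]);
  last exact: finite_seq.
move=> [s b] /h hs.
have : (s, b) \in [seq (s, b) | s <- box M, b <- [:: true; false]].
  apply/allpairsP; exists (s, b); split => //=; first by rewrite mem_box.
  by case: (b).
by [].
Qed.

Lemma path_all_connect {T : eqType} (r : rel T) (A : pred T) (Q : T -> Prop) x s :
  path r x s -> all A (x :: s) -> Q x ->
  (forall a b, r a b -> A a -> A b -> Q a -> Q b) -> Q (last x s).
Proof.
elim: s x => [|y s ih] x //= /andP[rxy ps] /and3P[Ax Ay As] Qx h.
by apply: (ih y) => //=; [rewrite Ay | exact: (h x y)].
Qed.

Lemma path_cat_conn {T : eqType} (r : rel T) (A : pred T) x y z :
  (exists s, [&& path r x s, last x s == y & all A (x :: s)]) ->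
  (exists s, [&& path r y s, last y s == z & all A (y :: s)]) ->
  exists s, [&& path r x s, last x s == z & all A (x :: s)].
Proof.
move=> [s /and3P[p1 /eqP l1 a1]] [t /and3P[p2 /eqP l2 /= /andP[_ a2]]].
exists (s ++ t); rewrite cat_path p1 last_cat l1 l2 eqxx p2 /= all_cat.
by move: a1 => /= /andP[-> ->].
Qed.

Lemma path_rev_conn {T : eqType} (r : rel T) (A : pred T) x y : symmetric r ->
  (exists s, [&& path r x s, last x s == y & all A (x :: s)]) ->
  (exists s, [&& path r y s, last y s == x & all A (y :: s)]).
Proof.
move=> sr [s /and3P[p1 /eqP l1 a1]]; exists (rev (belast x s)).
have e : rev (x :: s) = y :: rev (belast x s) by rewrite lastI l1 rev_rcons.
have -> : path r y (rev (belast x s)).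
  by rewrite -l1 rev_path; under eq_path do rewrite sr.
rewrite -e all_rev a1 andbT /=; case: s {p1 a1 e} l1 => [/= ->|z s _] //=.
by rewrite rev_cons last_rcons.
Qed.

Lemma adjb_sym : symmetric adjb.
Proof. by move=> [a b] [c d]; rewrite /adjb /=; lia. Qed.

Lemma dadj_sym : symmetric dadj.
Proof.
move=> e f; rewrite /dadj eq_sym; congr (_ && _).
by apply/hasP/hasP => -[a h1 h2]; exists a.
Qed.

Lemma adjbP (a b : Site) : adjb a b ->
  [\/ b = (a.1+1,a.2), b = (a.1-1,a.2), b = (a.1,a.2+1) | b = (a.1,a.2-1)].
Proof.
case: a b => [x y] [z t]; rewrite /adjb /= => h.
have [[-> ->]|[[-> ->]|[[-> ->]|[-> ->]]]] :
  (z = x+1 /\ t=y) \/ (z = x-1 /\ t=y) \/ (z=x /\ t = y+1) \/ (z=x /\ t=y-1) by lia.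
- exact: Or41.
- exact: Or42.
- exact: Or43.
- exact: Or44.
Qed.

Lemma adjb_other_end e : adjb e.1 (other_end e).
Proof. by case: e => [[x y] []]; rewrite /adjb /other_end /=; lia. Qed.

Lemma adjb_edge a b : adjb a b ->
  exists e : PEdge, (e.1 = a /\ other_end e = b) \/ (e.1 = b /\ other_end e = a).
Proof.
case: a => x y /adjbP[] -> /=.
- by exists ((x, y), true); left.
- by exists ((x - 1, y), true); right; rewrite /other_end /= subrK.
- by exists ((x, y), false); left.
- by exists ((x, y - 1), false); right; rewrite /other_end /= subrK.
Qed.

Lemma conn_refl (A : pred Site) v : A v -> conn_in A v v.
Proof. by move=> Av; exists [::]; rewrite /= eqxx Av. Qed.

Lemma conn_trans (A : pred Site) u v w : conn_in A u v -> conn_in A v w -> conn_in A u w.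
Proof. exact: path_cat_conn. Qed.

Lemma conn_sym (A : pred Site) u v : conn_in A u v -> conn_in A v u.
Proof. exact/path_rev_conn/adjb_sym. Qed.

Lemma conn1 (A : pred Site) u v : A u -> A v -> adjb u v -> conn_in A u v.
Proof. by move=> Au Av h; exists [:: v]; rewrite /= h Au Av eqxx. Qed.

Lemma conn_ends (A : pred Site) u v : conn_in A u v -> A u /\ A v.
Proof.
move=> [s /and3P[_ /eqP <- /allP h]]; split; apply: h; first exact: mem_head.
exact: mem_last.
Qed.

Lemma conn_mono (A B : pred Site) u v : (forall x, A x -> B x) -> conn_in A u v -> conn_in B u v.
Proof.
move=> h [s /and3P[p l a]]; exists s; rewrite p l /=.
exact: (sub_all h a).
Qed.

Lemma conn_ind (A : pred Site) (Q : Site -> Prop) u v : conn_in A u v -> Q u ->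
  (forall a b, adjb a b -> A a -> A b -> Q a -> Q b) -> Q v.
Proof. by move=> [s /and3P[p /eqP <- a]] Qu h; apply: path_all_connect p a Qu h. Qed.

Lemma conn_inside (A : pred Site) u v : conn_in A u v ->
  conn_in (fun w => `[<conn_in A u w>]) u v.
Proof.
move=> h; have [Au _] := conn_ends h; apply: (conn_ind h).
  by apply: conn_refl; apply/asboolP/conn_refl.
move=> a b ab Aa Ab ha; apply: (conn_trans ha).
have [_ /asboolP ua] := conn_ends ha.
apply: conn1 => //; apply/asboolP => //.
exact: conn_trans ua (conn1 Aa Ab ab).
Qed.

Definition dconn (E : pred PEdge) (e f : PEdge) : Prop :=
  exists s : seq PEdge, [&& path dadj e s, last e s == f & all E (e :: s)].

Lemma dconn_refl (A : pred PEdge) v : A v -> dconn A v v.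
Proof. by move=> Av; exists [::]; rewrite /= eqxx Av. Qed.

Lemma dconn_trans (A : pred PEdge) u v w : dconn A u v -> dconn A v w -> dconn A u w.
Proof. exact: path_cat_conn. Qed.

Lemma dconn_sym (A : pred PEdge) u v : dconn A u v -> dconn A v u.
Proof. exact/path_rev_conn/dadj_sym. Qed.

Lemma dconn1 (A : pred PEdge) u v : A u -> A v -> dadj u v -> dconn A u v.
Proof. by move=> Au Av h; exists [:: v]; rewrite /= h Au Av eqxx. Qed.

Lemma dconn_ends (A : pred PEdge) u v : dconn A u v -> A u /\ A v.
Proof.
move=> [s /and3P[_ /eqP <- /allP h]]; split; apply: h; first exact: mem_head.
exact: mem_last.
Qed.

Lemma dconn_mono (A B : pred PEdge) u v : (forall x, A x -> B x) -> dconn A u v -> dconn B u v.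
Proof.
move=> h [s /and3P[p l a]]; exists s; rewrite p l /=.
exact: (sub_all h a).
Qed.

Lemma contour_of_eq sg e f : dconn (contour_set sg) e f -> contour_of sg e = contour_of sg f.
Proof.
move=> h; apply/seteqP; split=> g hg; first exact: dconn_trans (dconn_sym h) hg.
exact: dconn_trans h hg.
Qed.

(* The four sides of the unit square whose lower left corner is [a], i.e. the
   dual edges incident to the dual vertex [a]. *)
Definition sq_edges (a : Site) : seq PEdge :=
  [:: (a, true); ((a.1, a.2 + 1), true); (a, false); ((a.1 + 1, a.2), false)].

Lemma mem_dual_ends a e : (a \in dual_ends e) = (e \in sq_edges a).
Proof.
case: a e => [x y] [[z t] []]; rewrite /dual_ends /sq_edges /= !inE !xpair_eqE /=.
  by apply/idP/idP; lia.
by apply/idP/idP; lia.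
Qed.

Lemma dadjP e f : reflect (e <> f /\ exists a, e \in sq_edges a /\ f \in sq_edges a) (dadj e f).
Proof.
apply: (iffP andP) => [[/eqP n /hasP[a h1 h2]]|[/eqP n [a [h1 h2]]]]; split => //.
  by exists a; rewrite -!mem_dual_ends.
by apply/hasP; exists a; rewrite mem_dual_ends.
Qed.

(** Even degree at each dual vertex, equivalently a closed mod 2 cochain on the lattice edges: its
    sum around every unit square vanishes. *)
Definition even_on_squares (K : pred PEdge) : Prop := forall a : Site,
  K (a, true) (+) K ((a.1, a.2 + 1), true) (+) K (a, false) (+) K ((a.1 + 1, a.2), false) = false.

Lemma even_contour_set sg : even_on_squares (contour_set sg).
Proof.
move=> [x y]; rewrite /contour_set /other_end /=.
by case: (sg (x, y)); case: (sg (x + 1, y)); case: (sg (x, y + 1)); case: (sg (x + 1, y + 1)).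
Qed.

(* The sides of a square are pairwise dual-adjacent, so [K] contains all or none
   of those that belong to [E]. *)
Lemma even_component (E K : pred PEdge) : even_on_squares E -> (forall e, K e -> E e) ->
  (forall e f, K e -> E f -> dadj e f -> K f) -> even_on_squares K.
Proof.
move=> hE sub cl a; have := hE a.
have key e f : e \in sq_edges a -> f \in sq_edges a -> K e -> E f -> K f.
  move=> he hf Ke Ef; case: (eqVneq e f) => [<- //|n].
  by apply: (cl e) => //; apply/dadjP; split; [apply/eqP | exists a].
have [n|/existsNP[e /not_implyP[he /contrapT Ke]]] :=
  pselect (forall e, e \in sq_edges a -> ~ K e).
  have kF e : e \in sq_edges a -> K e = false by move=> /n/negP/negbTE.
  by rewrite !kF // !inE eqxx ?orbT.
have kE f : f \in sq_edges a -> K f = E f.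
  by move=> hf; apply/idP/idP => [/sub|/(key e f)]; auto.
by rewrite !kE // !inE eqxx ?orbT.
Qed.

(** * Even edge sets are boundaries: a discrete Poincare lemma mod 2 *)

Section Poincare.
Variables (K : pred PEdge) (M : nat).
Hypothesis hK : even_on_squares K.
Hypothesis bK : forall e, K e -> bnd_in M e.1.

Let N : int := M%:Z + 1.

(** Parity of the [K]-edges met on the way left from [(N, y)] to [(N - n, y)]; as [N = M + 1], no
    edge of [K] starts in the column [x = N]. *)
Fixpoint ray_parity (n : nat) (y : int) : bool :=
  if n is n'.+1 then ray_parity n' y (+) K ((N - n%:Z, y), true) else false.

Definition integral (s : Site) : bool :=
  if s.1 <= N then ray_parity (absz (N - s.1)) s.2 else false.

Let K_out s b : ~~ bnd_in M s -> K (s, b) = false.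
Proof. by move=> h; apply/negP => /bK /=; apply/negP. Qed.

(** Summing the square relations over the strip between the rows [y] and [y + 1] cancels all
    vertical edges but the leftmost one. *)
Let vert n y : ray_parity n y (+) ray_parity n (y + 1) = K ((N - n%:Z, y), false).
Proof.
elim: n => [|n ih] /=; first by rewrite K_out // /bnd_in /N /=; lia.
have := hK (N - n.+1%:Z, y) => /=.
have -> : N - n.+1%:Z + 1 = N - n%:Z by lia.
rewrite -ih.
by case: (ray_parity n y); case: (ray_parity n (y + 1)); case: (K (_, false));
  case: (K (_, true)); case: (K (_, true)).
Qed.

Lemma contour_integral : contour_set integral =1 K.
Proof.
move=> [[x y] b]; rewrite /contour_set /integral /other_end /=; case: b => /=.
  case: (leP (x + 1) N) => h.
    have -> : x <= N by lia.
    have -> : absz (N - x)%R = (absz (N - (x + 1))%R).+1 by lia.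
    rewrite /= (_ : N - (absz (N - (x + 1))%R).+1%:Z = x); last by lia.
    by case: (ray_parity _ _); case: (K _).
  rewrite K_out; last by rewrite /bnd_in /=; rewrite /N in h; lia.
  case: (leP x N) => // h2; have -> : absz (N - x)%R = 0%N by lia.
  by [].
case: (leP x N) => h; last by rewrite K_out // /bnd_in /=; rewrite /N in h; lia.
have := vert (absz (N - x)) y.
rewrite (_ : N - (absz (N - x))%:Z = x); last by lia.
by move=> <-; case: (ray_parity _ _); case: (ray_parity _ _).
Qed.

Lemma integral_bounded s : integral s -> bnd_in M.+1 s.
Proof.
have outy n y : `|y| > M%:Z -> ray_parity n y = false.
  by move=> h; elim: n => //= n ->; rewrite K_out // /bnd_in /=; lia.
case: s => x y; rewrite /integral /=; case: leP => // h hp.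
case: (leP `|y| M%:Z) => hy; last by rewrite outy in hp.
rewrite /bnd_in /= -/N; apply/andP; split; last by lia.
case: (leP (- M%:Z) x) => hx; first by rewrite /N in h; lia.
(* Left of the box the parity is not zero by definition; it stays the same along a column without
   [K]-edges, and it vanishes at large height. *)
have shift k : ray_parity (absz (N - x)) (y + k%:Z).
  elim: k => [|k ih]; first by rewrite addr0.
  have := vert (absz (N - x)) (y + k%:Z); rewrite ih.
  rewrite K_out; last by rewrite /bnd_in /=; rewrite /N in h *; lia.
  by rewrite (_ : y + k.+1%:Z = y + k%:Z + 1); [case: (ray_parity _ _) | lia].
by have := shift (2 * M).+1; rewrite outy //; lia.
Qed.

End Poincare.

Definition escapes (C : pred Site) (z : Site) : Prop :=
  forall M : nat, exists w, ~~ bnd_in M w /\ conn_in (predC C) z w.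

(* [C] together with the bounded components of its complement. *)
Definition fill (C : pred Site) : pred Site := fun z => ~~ `[<escapes C z>].

Section Fill.
Variables (C : pred Site) (M : nat).
Hypothesis bC : forall s, C s -> bnd_in M s.

Lemma fill_subset s : C s -> fill C s.
Proof.
move=> Cs; apply/asboolPn => /(_ 0%N)[w [_ /conn_ends[]]] /=.
by rewrite Cs.
Qed.

Lemma escapes_conn z w : conn_in (predC C) z w -> escapes C w -> escapes C z.
Proof.
by move=> h e L; have [u [hu c]] := e L; exists u; split => //; apply: conn_trans c.
Qed.

Lemma escapes_outside z : ~~ bnd_in M z -> escapes C z.
Proof.
case: z => x y hz L.
have ray (dx dy : int) : (forall k : nat, ~~ bnd_in M (x + k%:Z * dx, y + k%:Z * dy)) ->
    `|dx| + `|dy| = 1 -> forall k : nat, conn_in (predC C) (x, y) (x + k%:Z * dx, y + k%:Z * dy).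
  move=> hk d1; have hC k : ~~ C (x + k%:Z * dx, y + k%:Z * dy).
    by apply/negP => /bC; apply/negP.
  elim=> [|k ih]; first by rewrite !mul0r !addr0; apply: conn_refl; have := hC 0%N;
    rewrite !mul0r !addr0.
  apply: (conn_trans ih); apply: conn1; [exact: hC|exact: hC|].
  by rewrite /adjb /=; nia.
move: hz; rewrite /bnd_in /= negb_and -!ltNge => hz.
pose k := (L + M + absz x + absz y).+1.
have [h|[h|[h|h]]] : M%:Z < x \/ x < - M%:Z \/ M%:Z < y \/ y < - M%:Z by lia.
- exists (x + k%:Z * 1, y + k%:Z * 0); split; first by rewrite /bnd_in /=; lia.
  by apply: ray => // k'; rewrite /bnd_in /=; lia.
- exists (x + k%:Z * -1, y + k%:Z * 0); split; first by rewrite /bnd_in /=; lia.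
  by apply: ray => // k'; rewrite /bnd_in /=; lia.
- exists (x + k%:Z * 0, y + k%:Z * 1); split; first by rewrite /bnd_in /=; lia.
  by apply: ray => // k'; rewrite /bnd_in /=; lia.
- exists (x + k%:Z * 0, y + k%:Z * -1); split; first by rewrite /bnd_in /=; lia.
  by apply: ray => // k'; rewrite /bnd_in /=; lia.
Qed.

Lemma fill_bounded s : fill C s -> bnd_in M s.
Proof. by move=> /asboolPn h; apply: contrapT => /negP /escapes_outside. Qed.

Lemma fill_boundary u w : adjb u w -> fill C u -> ~~ fill C w -> C u /\ ~~ C w.
Proof.
move=> ad /asboolPn fu fw; have Cw : ~~ C w by apply: contra fw => /fill_subset.
split => //; apply: contrapT => /negP nu; apply: fu.
move: fw; rewrite negbK => /asboolP; apply: escapes_conn.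
exact: conn1.
Qed.

Lemma fill_edgeP e : contour_set (fill C) e ->
  exists u w, [/\ (e.1 = u /\ other_end e = w) \/ (e.1 = w /\ other_end e = u),
    C u, fill C u, ~~ C w & ~~ fill C w].
Proof.
rewrite /contour_set => h; have ad := adjb_other_end e.
case: (boolP (fill C e.1)) (boolP (fill C (other_end e))) h => [f1|f1] [f2|f2] //= _.
  by have [] := fill_boundary ad f1 f2; exists e.1, (other_end e); split => //; left.
rewrite adjb_sym in ad.
by have [] := fill_boundary ad f2 f1; exists (other_end e), e.1; split => //; right.
Qed.

Lemma fill_edge_contour e : contour_set (fill C) e -> contour_set C e.
Proof. by move=> /fill_edgeP[u [w [[[<- <-]|[<- <-]] cu _ cw _]]];
  rewrite /contour_set cu ?(negbTE cw). Qed.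

End Fill.

Lemma contour_edge (D : Config) a b e : (e.1 = a /\ other_end e = b) \/ (e.1 = b /\ other_end e =
  a) ->
  contour_set D e = (D a != D b).
Proof. by move=> [[<- <-]|[<- <-]]; rewrite /contour_set // eq_sym. Qed.

Lemma bounded_contour (D : Config) M e : (forall s, D s -> bnd_in M s) -> contour_set D e ->
  bnd_in M.+1 e.1.
Proof.
move=> b; rewrite /contour_set; case: (boolP (D e.1)) => [/b h _|_].
  by move: h; rewrite /bnd_in; case: e => -[x y] c /=; lia.
case: (boolP (D _)) => // /b h _; move: h; rewrite /bnd_in /other_end.
by case: e => -[x y] [] /=; lia.
Qed.

(** Stands in for the Jordan curve theorem: a component of an even edge set is again even, and a
    bounded one integrates to a bounded set of sites. *)
Lemma component_boundary (E : pred PEdge) e M : even_on_squares E -> E e ->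
  (forall f, dconn E e f -> bnd_in M f.1) ->
  exists D : Config, (forall s, D s -> bnd_in M.+1 s) /\
    forall f, contour_set D f <-> dconn E e f.
Proof.
move=> hE Ee hb; pose K : pred PEdge := fun f => `[<dconn E e f>].
have hK : even_on_squares K.
  apply: (even_component hE).
    by move=> f /asboolP /dconn_ends[].
  move=> f g /asboolP ef Eg fg; apply/asboolP/(dconn_trans ef)/dconn1 => //.
  by have [] := dconn_ends ef.
have bK f : K f -> bnd_in M f.1 by move=> /asboolP /hb.
exists (integral K M); split=> [s|f]; first exact: integral_bounded.
by rewrite contour_integral //; split => [/asboolP|h] //; apply/asboolP.
Qed.

(* The dual component of [e] is the boundary of a bounded set [D]. As [D] is
   constant on [C] and empty on the outside of [fill C], every boundary edge of
   [fill C] is a boundary edge of [D]. *)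
Lemma fill_boundary_connected (C : pred Site) M e f : (forall s, C s -> bnd_in M s) ->
  (forall u v, C u -> C v -> conn_in C u v) ->
  contour_set (fill C) e -> contour_set (fill C) f -> dconn (contour_set (fill C)) e f.
Proof.
move=> bC cC he hf; pose E := contour_set (fill C).
have [|D [bD hD]] := @component_boundary E e M.+1 (@even_contour_set _) he.
  by move=> g /dconn_ends[_]; apply: bounded_contour => s; apply: fill_bounded.
apply/hD.
have notE a b : adjb a b -> ~~ (D a == D b) -> fill C a != fill C b.
  move=> /adjb_edge[g hg] n; rewrite -(contour_edge _ hg).
  have /hD/dconn_ends[] // : contour_set D g by rewrite (contour_edge _ hg).
have Dout z : escapes C z -> D z = false.
  move=> /(_ M.+2)[w [hw c]].
  apply: (conn_ind (Q := fun z => D z = false) (conn_sym c)).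
    by apply/negP => /bD; move: hw; rewrite /bnd_in; lia.
  move=> a b ab Ca Cb Da; apply/negP => Db.
  have := notE _ _ ab; rewrite Da Db => /(_ isT).
  move: (ab); rewrite adjb_sym => ba.
  case: (boolP (fill C a)) (boolP (fill C b)) => [fa|fa] [fb|fb] // _.
    by have [] := fill_boundary ab fa fb; rewrite (negbTE Ca).
  by have [] := fill_boundary ba fb fa; rewrite (negbTE Cb).
have Dconst u v : C u -> C v -> D u -> D v.
  move=> Cu Cv Du; apply: (conn_ind (Q := fun v => D v) (cC _ _ Cu Cv)) => //.
  move=> a b ab Ca Cb Da; apply: contrapT => /negP Db.
  by have := notE _ _ ab; rewrite Da (negbTE Db) !fill_subset // => /(_ isT).
have [u [w [ew Cu _ _ nw]]] := fill_edgeP he.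
have [u' [w' [ew' Cu' _ _ nw']]] := fill_edgeP hf.
have De : contour_set D e by apply/hD/dconn_refl.
have Dout' z : ~~ fill C z -> D z = false by rewrite negbK => /asboolP /Dout.
move: De; rewrite (contour_edge _ ew) (contour_edge _ ew') (Dout' w) // (Dout' w') // !eqbF_neg
  !negbK.
exact: Dconst.
Qed.

(** * Fillings of finite clusters and the infinite contour *)

Section Clusters.
Variable sg : Config.

Definition cl (v : Site) : pred Site := fun w => `[<Defs.cluster sg v w>].

Lemma clP v w : reflect (Defs.cluster sg v w) (cl v w).
Proof. exact: asboolP. Qed.

Lemma cl_self v : cl v v.
Proof. by apply/clP/conn_refl/eqxx. Qed.

Lemma cluster_spin v w : Defs.cluster sg v w -> sg w = sg v.
Proof. by move=> /conn_ends[_ /eqP]. Qed.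

Lemma cluster_eq v w : Defs.cluster sg v w -> Defs.cluster sg w = Defs.cluster sg v.
Proof.
move=> h; have e := cluster_spin h; apply/seteqP; split=> x; rewrite /Defs.cluster /= ?e => hx.
  exact: conn_trans h hx.
exact: conn_trans (conn_sym h) hx.
Qed.

Lemma cl_eq v w : cl v w -> cl w = cl v.
Proof. by move=> /clP /cluster_eq h; apply/funext => x; rewrite /cl h. Qed.

Lemma cluster_step v a b : Defs.cluster sg v a -> adjb a b -> sg a = sg b -> Defs.cluster sg v b.
Proof.
move=> h ab e; apply: (conn_trans h); have s := cluster_spin h.
by apply: conn1 => //=; rewrite -?e s.
Qed.

Lemma cl_connected v a b : cl v a -> cl v b -> conn_in (cl v) a b.
Proof.
move=> /clP ha /clP hb; have hin x (hx : Defs.cluster sg v x) : conn_in (cl v) v x :=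
  conn_inside hx.
exact: conn_trans (conn_sym (hin _ ha)) (hin _ hb).
Qed.

Lemma contour_cl v e : contour_set (cl v) e -> contour_set sg e.
Proof.
rewrite /contour_set => h; apply: contra h => /eqP s.
have ad := adjb_other_end e; apply/eqP; apply/idP/idP => /clP h; apply/clP.
  exact: cluster_step h ad s.
by apply: (cluster_step h) => //; rewrite adjb_sym.
Qed.

Lemma contour_fill_cl v e : contour_set (fill (cl v)) e -> contour_set sg e.
Proof. by move=> /fill_edge_contour /contour_cl. Qed.

Lemma cl_disjoint v w : ~~ cl v w -> forall x, cl w x -> ~~ cl v x.
Proof.
move=> h x wx; apply: contra h => vx; apply/clP.
by have /clP := cl_self w; rewrite -(cluster_eq (clP _ _ vx)) (cluster_eq (clP _ _ wx)).
Qed.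

(** [C'] is connected, avoids [C] and has a point that cannot escape, so it lies in [fill C]. A path
    along which [z] escapes from [C] therefore never meets [C']. *)
Lemma fill_subset_fill (C C' : pred Site) : (forall u v, C' u -> C' v -> conn_in C' u v) ->
  (forall x, C' x -> ~~ C x) -> forall u, C' u -> fill C u ->
  forall z, fill C' z -> fill C z.
Proof.
move=> cn dj u C'u fu z; apply: contra => /asboolP ez; apply/asboolP => L.
have [w [hw c]] := ez L; exists w; split => //.
have sub x : C' x -> fill C x.
  move=> C'x; apply/asboolPn => ex; move/asboolPn: fu; apply.
  apply: escapes_conn ex; exact: conn_mono (cn _ _ C'u C'x).
apply: conn_mono (conn_inside c) => x /= /asboolP cx.
apply/negP => /sub /asboolPn; apply.
by apply: escapes_conn ez; apply: conn_sym.
Qed.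

Hypothesis fin : forall v, finite_set (Defs.cluster sg v).

Lemma cl_bounded v : exists M, forall s, cl v s -> bnd_in M s.
Proof. by have /finite_bounded[M hM] := fin v; exists M => s /clP /hM. Qed.

Lemma fill_cl_connected v e f : contour_set (fill (cl v)) e -> contour_set (fill (cl v)) f ->
  dconn (contour_set (fill (cl v))) e f.
Proof.
have [M bM] := cl_bounded v; apply: (fill_boundary_connected bM).
exact: cl_connected.
Qed.

Lemma fill_cl_contour v e f : contour_set (fill (cl v)) e -> contour_set (fill (cl v)) f ->
  dconn (contour_set sg) e f.
Proof. by move=> he hf; apply: dconn_mono (fill_cl_connected he hf); apply: contour_fill_cl. Qed.

Lemma fill_nest v w u : ~~ cl v w -> cl w u -> fill (cl v) u ->
  forall z, fill (cl w) z -> fill (cl v) z.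
Proof.
by move=> h wu fu; apply: (@fill_subset_fill _ _ _ _ u) => //;
  [apply: cl_connected | apply: cl_disjoint].
Qed.

Lemma exit_right (D : pred Site) M v : (forall s, D s -> bnd_in M s) -> D v ->
  exists k : nat, contour_set D ((v.1 + k%:Z, v.2), true) /\ D (v.1 + k%:Z, v.2).
Proof.
case: v => x y bD Dv; pose n := (absz x + M).+1.
have : ~~ D (x + n%:Z, y) by apply/negP => /bD; rewrite /bnd_in /n /=; lia.
elim: n => [|n ih]; first by rewrite addr0 Dv.
case: (boolP (D (x + n%:Z, y))) => [d h|d _]; last exact: ih.
exists n; split => //; rewrite /contour_set /other_end /= d.
by rewrite (_ : x + n%:Z + 1 = x + n.+1%:Z) ?(negbTE h) //; lia.
Qed.

Lemma exit_left (D : pred Site) M v : (forall s, D s -> bnd_in M s) -> D v ->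
  exists k : nat, contour_set D ((v.1 - k.+1%:Z, v.2), true) /\ D (v.1 - k%:Z, v.2).
Proof.
case: v => x y bD Dv; pose n := (absz x + M).+1.
have : ~~ D (x - n%:Z, y) by apply/negP => /bD; rewrite /bnd_in /n /=; lia.
elim: n => [|n ih]; first by rewrite (_ : x - 0%:Z = x) ?Dv //; lia.
case: (boolP (D (x - n%:Z, y))) => [d h|d _]; last exact: ih.
exists n; split => //; rewrite /contour_set /other_end /=.
by rewrite (_ : x - n.+1%:Z + 1 = x - n%:Z) ?(negbTE h) ?d //; lia.
Qed.

Lemma fill_boundary_cl v u w : adjb u w -> fill (cl v) u -> ~~ fill (cl v) w -> cl v u.
Proof. by move=> a b c; have [] := fill_boundary a b c. Qed.

Lemma site_ind (Q : Site -> Prop) u : Q u -> (forall a b, adjb a b -> Q a -> Q b) ->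
  forall v, Q v.
Proof.
move=> Qu st; have h1 (x y : int) : Q (x, y) -> forall z, Q (z, y).
  move=> q z; have r (n : nat) : Q (x + n%:Z, y) /\ Q (x - n%:Z, y).
    elim: n => [|n [i1 i2]]; first by rewrite !(addr0, oppr0).
    by split; [apply: st i1 | apply: st i2]; rewrite /adjb /=; lia.
  have [a b] := r (absz (z - x)); have [e|e] : z = x + (absz (z - x))%:Z \/ z =
    x - (absz (z - x))%:Z by lia.
    by rewrite e.
  by rewrite e.
have h2 (x y : int) : Q (x, y) -> forall z, Q (x, z).
  move=> q z; have r (n : nat) : Q (x, y + n%:Z) /\ Q (x, y - n%:Z).
    elim: n => [|n [i1 i2]]; first by rewrite !(addr0, oppr0).
    by split; [apply: st i1 | apply: st i2]; rewrite /adjb /=; lia.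
  have [a b] := r (absz (z - y)); have [e|e] : z = y + (absz (z - y))%:Z \/ z =
    y - (absz (z - y))%:Z by lia.
    by rewrite e.
  by rewrite e.
by case: u Qu => x y q [z t]; apply: h2 (h1 _ _ q z) t.
Qed.

(** A contour avoiding the boundary of the filling stays on one side of it: two dual-adjacent edges
    are sides of one square, and the corners of a square without boundary edges are all inside or
    all outside. Such a contour would remain in a bounded region, so an infinite one meets the
    boundary, and contains it because it is connected. *)
Lemma infinite_contour_fill v e : contour_set sg e ->
  fill (cl v) e.1 || fill (cl v) (other_end e) ->
  ~ finite_set (contour_of sg e) ->
  forall f, contour_set (fill (cl v)) f -> dconn (contour_set sg) e f.
Proof.
move=> he te inf f hf; apply: contrapT => nef; apply: inf.
have [M bM] := cl_bounded v.
pose touch g := fill (cl v) g.1 || fill (cl v) (other_end g).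
suff tch g : dconn (contour_set sg) e g -> touch g.
  apply/finite_bounded_edges; exists M.+1 => g /tch.
  move=> /orP[] /(fill_bounded bM); rewrite /bnd_in /other_end.
    by case: g => -[x y] b /=; lia.
  by case: g => -[x y] [] /=; lia.
move=> eg; suff : touch g /\ dconn (contour_set sg) e g by case.
have [s /and3P[p /eqP <- a]] := eg.
apply: (path_all_connect (Q := fun g => touch g /\ dconn (contour_set sg) e g) p a).
  by split => //; apply: dconn_refl.
move=> {s p a g eg} g h gh Cg Ch [tg eg].
have eh := dconn_trans eg (dconn1 Cg Ch gh); split => //.
apply: contrapT => /negP; rewrite negb_or => /andP[h1 h2].
have [_ [[x y] [gs hs]]] := dadjP _ _ gh.
have nout k : k \in sq_edges (x, y) -> ~~ contour_set (fill (cl v)) k.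
  move=> ks; apply/negP => hk; apply: nef.
  have Ck := contour_fill_cl hk.
  apply: dconn_trans (fill_cl_contour hk hf).
  case: (eqVneq g k) => [<- //|n].
  apply: (dconn_trans eg); apply: dconn1 => //.
  by apply/dadjP; split; [apply/eqP | exists (x, y)].
have kk a b : (a, b) \in sq_edges (x, y) -> fill (cl v) a = fill (cl v) (other_end (a, b)).
  by move=> /nout; rewrite /contour_set negbK => /eqP.
have k1 := kk (x, y) true; have k2 := kk (x, y + 1) true.
have k3 := kk (x, y) false; have k4 := kk (x + 1, y) false.
have sq k : k \in sq_edges (x, y) ->
    fill (cl v) k.1 = fill (cl v) (x, y) /\ fill (cl v) (other_end k) = fill (cl v) (x, y).
  move: k1 k2 k3 k4; rewrite /sq_edges !inE !eqxx ?orbT /other_end /=.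
  move=> /(_ isT) k1 /(_ isT) k2 /(_ isT) k3 /(_ isT) k4.
  by move=> /or4P[] /eqP -> /=; rewrite -?k4 -?k2 -?k3 -?k1.
have [g1 g2] := sq _ gs; have [h1' h2'] := sq _ hs.
by move: tg h1 h2; rewrite /touch g1 g2 h1' h2' orbb => ->.
Qed.

(** Being covered by a filling whose boundary lies in the contour of [e] passes from a site to its
    neighbours: the edge leaving one filling belongs to this contour and touches the next filling.
    The property thus reaches [f], whose contour contains the boundary of the same filling. *)
Lemma infinite_contour_unique e f : contour_set sg e -> ~ finite_set (contour_of sg e) ->
  contour_set sg f -> ~ finite_set (contour_of sg f) -> contour_of sg f = contour_of sg e.
Proof.
move=> he ie hf jf.
have [c [fc ec]] : exists c, fill (cl c) f.1 /\
    forall g, contour_set (fill (cl c)) g -> dconn (contour_set sg) e g.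
  apply: (site_ind (Q := fun z => exists c, fill (cl c) z /\
    forall g, contour_set (fill (cl c)) g -> dconn (contour_set sg) e g) (u := e.1)).
    exists e.1; have fe := fill_subset (cl_self e.1); split => // g.
    by apply: infinite_contour_fill => //; rewrite fe.
  move=> a b ab [c [fa hc]].
  case: (boolP (fill (cl c) b)) => fb; first by exists c.
  have [g hg] := adjb_edge ab.
  have Cg : contour_set (fill (cl c)) g by rewrite (contour_edge _ hg) fa (negbTE fb).
  have eg := hc _ Cg; have sb := fill_subset (cl_self b).
  exists b; split => // h hh; apply: (dconn_trans eg).
  apply: infinite_contour_fill hh => //; first exact: contour_fill_cl Cg.
    by case: hg => -[-> ->]; rewrite sb ?orbT.
  by rewrite -(contour_of_eq eg).
have [M bM] := cl_bounded c.
have [k [Ck _]] := exit_right (fill_bounded bM) fc.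
apply: contour_of_eq; apply: dconn_trans (dconn_sym (ec _ Ck)).
by apply: (infinite_contour_fill hf) Ck => //; rewrite fc.
Qed.

(** Maximality of the cluster of [c] for inclusion of fillings. *)
Definition outermost (c : Site) : Prop := forall c', fill (cl c') c -> cl c' c.

Lemma outermost_mem c c' u : outermost c -> cl c u -> fill (cl c') u -> cl c' c.
Proof.
move=> o cu fu; case: (boolP (cl c' c)) => // n.
by rewrite -(negbTE n); apply: o (fill_nest n cu fu (fill_subset (cl_self c))).
Qed.

Lemma count_subset (T : Type) (a b : pred T) s : (forall x, a x -> b x) ->
  count b s = (count a s + count (predD b a) s)%N.
Proof.
move=> h; elim: s => [|x s ih] //=; rewrite ih.
by case: (boolP (a x)) => [/h -> |_] /=; lia.
Qed.

(** A cluster whose filling contains [v] meets the ray to the right of [v], so the hypothesis leaves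
    finitely many of them, and one has a largest filling. *)
Lemma exists_outermost v N : (forall k : nat, (N <= k)%N -> ~~ fill (cl (v.1 + k%:Z, v.2)) v) ->
  exists c, outermost c /\ fill (cl c) v.
Proof.
move=> hN; pose site (k : nat) : Site := (v.1 + k%:Z, v.2).
have [B bB] : exists B, forall c s, cl c s -> bnd_in (B c) s.
  by have [B h] := choice cl_bounded; exists B.
have f0 : fill (cl (site 0%N)) v.
  by apply: fill_subset; rewrite /site addr0 -surjective_pairing; apply: cl_self.
have N0 : (0 < N)%N by rewrite lt0n; apply/eqP => N0; have := hN 0%N;
  rewrite N0 -/(site 0%N) f0 => /(_ isT).
pose M := \max_(i < N) B (site i).
have bM (i : 'I_N) s : fill (cl (site i)) s -> bnd_in M s.
  move=> /(fill_bounded (bB _)).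
  have : (B (site i) <= M)%N by rewrite /M (bigD1 i) //= leq_maxl.
  by rewrite /bnd_in; lia.
pose F (i : 'I_N) := count (fill (cl (site i))) (box M).
have [m /= fm mx] := @arg_maxnP _ (Ordinal N0) (fun i => fill (cl (site i)) v) F f0.
exists (site m); split => // c' fc; apply: contrapT => /negP n.
have sub := fill_nest n (cl_self _) fc.
have fv := sub _ fm.
have [k [Ek fk]] := exit_right (fill_bounded (bB c')) fv.
have ck : cl c' (site k).
  apply: (fill_boundary_cl (adjb_other_end (site k, true)) fk).
  by move: Ek; rewrite /contour_set -/(site k) fk eq_sym eqb_id.
have ek := cl_eq ck.
have kN : (k < N)%N by rewrite ltnNge; apply/negP => /hN; rewrite -/(site k) ek fv.
have le : (count (fill (cl c')) (box M) <= count (fill (cl (site m))) (box M))%N.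
  by have := mx (Ordinal kN); rewrite ek => /(_ fv); rewrite /F [nat_of_ord (Ordinal kN)]/= ek.
have eqf s : fill (cl c') s = fill (cl (site m)) s.
  apply/idP/idP => [fs|]; last exact: sub.
  have sb : s \in box M by rewrite mem_box; apply: (bM (Ordinal kN)); rewrite /= ek.
  apply: contrapT => /negP fms; move: le; rewrite leqNgt => /negP; apply.
  have -> : count (fill (cl c')) (box M) =
     (count (fill (cl (site m))) (box M) + count (predD (fill (cl c')) (fill (cl (site m)))) (box
       M))%N.
    exact: count_subset.
  rewrite -[X in (X < _)%N]addn0 ltn_add2l -has_count; apply/hasP; exists s => //=.
  by rewrite fs fms.
move: Ek; rewrite /contour_set !eqf => Ek.
have cm : cl (site m) (site k).
  apply: fill_boundary_cl (adjb_other_end (site k, true)) _ _; first by rewrite -eqf.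
  by move: Ek; rewrite -/(site k) -(eqf (site k)) fk eq_sym eqb_id.
by have := cl_disjoint n cm; rewrite ck.
Qed.

(* Outermost clusters exist and cover the lattice by their fillings; adjacent
   ones have a common boundary edge, so a single contour bounds them all. *)
Lemma exists_infinite_contour :
  (forall v, exists N, forall k : nat, (N <= k)%N -> ~~ fill (cl (v.1 + k%:Z, v.2)) v) ->
  exists e, contour_set sg e /\ ~ finite_set (contour_of sg e).
Proof.
move=> hN.
have [c1 [oc1 fc1]] : exists c, outermost c /\ fill (cl c) (0, 0).
  by have [N h] := hN (0, 0); apply: exists_outermost h.
have [M0 bM0] := cl_bounded c1.
have [k0 [E0 _]] := exit_right (fill_bounded bM0) fc1.
set e := (_, true) in E0.
exists e; split; first exact: contour_fill_cl E0.
have all v : exists c, [/\ outermost c, fill (cl c) v &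
    forall g, contour_set (fill (cl c)) g -> dconn (contour_set sg) e g].
  apply: (site_ind (Q := fun v => exists c, [/\ outermost c, fill (cl c) v &
    forall g, contour_set (fill (cl c)) g -> dconn (contour_set sg) e g]) (u := (0, 0))).
    by exists c1; split => // g; apply: fill_cl_contour.
  move=> a b ab [c [oc fa hc]].
  case: (boolP (fill (cl c) b)) => fb; first by exists c.
  have ca := fill_boundary_cl ab fa fb.
  have sb := fill_subset (cl_self b).
  have nab : ~~ fill (cl b) a.
    apply/negP => /(outermost_mem oc ca) h.
    by move: fb; rewrite (cl_eq h) sb.
  have [g hg] := adjb_edge ab.
  have Cg : contour_set (fill (cl c)) g by rewrite (contour_edge _ hg) fa (negbTE fb).
  have Cg' : contour_set (fill (cl b)) g by rewrite (contour_edge _ hg) sb (negbTE nab).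
  exists b; split => //.
    (* [b] is outermost: a cluster enclosing both [a] and [b] would be that of [c], whose filling
       misses [b]; one enclosing [b] but not [a] has [b] on the rim of its filling, hence as a
       member. *)
    move=> c' fc'; case: (boolP (fill (cl c') a)) => [fa'|na'].
      have e' := outermost_mem oc ca fa'.
      by move: fb; rewrite (cl_eq e') fc'.
    by have ba := ab; rewrite adjb_sym in ba; exact: (fill_boundary_cl ba fc' na').
  move=> h hh; exact: dconn_trans (hc _ Cg) (fill_cl_contour Cg' hh).
move=> /finite_bounded_edges[M bM].
have [c [_ fc ec]] := all (0, M.+1%:Z).
have [M1 bM1] := cl_bounded c.
have [k [Ek _]] := exit_right (fill_bounded bM1) fc.
by have /bM := ec _ Ek; rewrite /bnd_in /=; lia.
Qed.

End Clusters.

(* A dual component of the boundary between two infinite clusters bounds a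
   finite set, which can contain neither of them. *)
Lemma unique_infinite_cluster sg v w :
  (forall e, contour_set sg e -> finite_set (contour_of sg e)) ->
  ~ finite_set (Defs.cluster sg v) -> ~ finite_set (Defs.cluster sg w) -> Defs.cluster sg w =
    Defs.cluster sg v.
Proof.
move=> fin iv iw; apply: contrapT => nvw.
have n0 : ~~ cl sg v w by apply/negP => /clP /cluster_eq.
(* The component of [w] in the complement of the cluster of [v]: each of its boundary edges leads
   into that cluster, so it is a contour edge. *)
pose X : pred Site := fun z => `[<conn_in (predC (cl sg v)) w z>].
have Xw : X w by apply/asboolP/conn_refl.
have XV z : X z -> ~~ cl sg v z by move=> /asboolP /conn_ends[].
have Xstep a b : adjb a b -> X a -> ~~ cl sg v b -> X b.
  move=> ab Xa nb; apply/asboolP; move/asboolP: (Xa) => ca.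
  by apply: (conn_trans ca); apply: conn1 => //; apply: XV.
have [e Ee] : exists e, contour_set X e.
  apply: contrapT => /forallNP nE.
  have : X v; last by move=> /XV; rewrite cl_self.
  apply: (site_ind (Q := fun z => X z) Xw) => a b ab Xa.
  have [g hg] := adjb_edge ab; have := nE g; rewrite (contour_edge _ hg) Xa.
  by case: (X b).
have edge g : contour_set X g -> exists a b, [/\ (g.1 = a /\ other_end g = b) \/ (g.1 =
  b /\ other_end g = a), X a, ~~ X b & cl sg v b].
  rewrite /contour_set => h; have ad := adjb_other_end g.
  case: (boolP (X g.1)) (boolP (X (other_end g))) h => [f1|f1] [f2|f2] //= _.
    exists g.1, (other_end g); split => //; first by left.
    by apply: contrapT => /negP nb; move: f2; rewrite (Xstep _ _ ad).
  exists (other_end g), g.1; split => //; first by right.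
  apply: contrapT => /negP nb; move: f1; rewrite (Xstep (other_end g)) //.
  by rewrite adjb_sym.
have Econt g : contour_set X g -> contour_set sg g.
  move=> /edge[a [b [hg Xa _ vb]]]; apply: (@contour_cl _ v).
  by rewrite (contour_edge _ hg) vb (negbTE (XV _ Xa)).
have /finite_bounded_edges[M bM] := fin _ (Econt _ Ee).
have [|D [bD hD]] := @component_boundary (contour_set X) e M (@even_contour_set _) Ee.
  by move=> f h; apply: bM; apply: dconn_mono h.
have Dconst (A : pred Site) u : (forall g a b, (g.1 = a /\ other_end g = b) \/ (g.1 =
  b /\ other_end g = a) ->
     A a -> A b -> ~~ contour_set X g) -> A u -> (forall z, A z -> conn_in A u z) ->
     ~ finite_set [set` A] -> forall z, A z -> ~~ D z.
  move=> hA Au cA iA.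
  have same z : A z -> D z = D u.
    move=> /cA c; apply: (conn_ind (Q := fun z => D z = D u) c) => // a b ab Aa Ab <-.
    have [g hg] := adjb_edge ab.
    have nE : ~~ contour_set D g.
      by apply/negP => /hD /dconn_ends[_]; apply/negP/(hA _ a b).
    by apply/esym/eqP; move: nE; rewrite (contour_edge _ hg) negbK.
  move=> z Az; rewrite same //; apply/negP => Du; apply: iA; apply/finite_bounded.
  by exists M.+1 => s /= As; apply: bD; rewrite same.
have [a [b [he Xa nXb vb]]] := edge _ Ee.
have : contour_set D e by apply/hD/dconn_refl.
rewrite (contour_edge _ he).
have -> : D a = false.
  apply/negbTE; apply: (Dconst X w) => //.
  - by move=> g x y hg Xx Xy; rewrite (contour_edge _ hg) Xx Xy.
  - by move=> z /asboolP; apply: conn_inside.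
  - move=> fX; apply: iw; apply: sub_finite_set fX => z hz /=; apply/asboolP.
    have : cl sg w z by apply/clP.
    move=> /clP c.
    apply: conn_mono (conn_inside c) => x /= /asboolP cx.
    by apply: (cl_disjoint n0); apply/clP.
have -> // : D b = false.
apply/negbTE; apply: (Dconst (cl sg v) v) => //.
- move=> g x y hg vx vy; rewrite (contour_edge _ hg).
  case: (boolP (X x)) => [/XV|_]; first by rewrite vx.
  by case: (boolP (X y)) => [/XV|_] //; rewrite vy.
- exact: cl_self.
- by move=> z vz; apply: cl_connected => //; apply: cl_self.
- move=> f; apply: iv; apply: sub_finite_set f => z hz /=; exact/clP.
Qed.

(** * Bernoulli site percolation *)

Definition upd (w : Config) (v : Site) (b : bool) : Config := fun s => if s == v then b else w s.

Lemma upd_eq w v b : upd w v b v = b. Proof. by rewrite /upd eqxx. Qed.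

Lemma upd_upd w v b c : upd (upd w v b) v c = upd w v c.
Proof. by apply/funext => s; rewrite /upd; case: eqP. Qed.

Lemma upd_comm w u v b c : u != v -> upd (upd w u b) v c = upd (upd w v c) u b.
Proof.
move=> n; apply/funext => s; rewrite /upd; case: eqP => [->|//].
by rewrite eq_sym (negbTE n).
Qed.

Lemma upd_id w v : upd w v (w v) = w.
Proof. by apply/funext => s; rewrite /upd; case: eqP => [->|]. Qed.

Definition depends (T : Type) (Z : pred Site) (f : Config -> T) : Prop :=
  forall w w', (forall s, Z s -> w s = w' s) -> f w = f w'.

Lemma depends_mono T (Z Z' : pred Site) (f : Config -> T) :
  (forall s, Z s -> Z' s) -> depends Z f -> depends Z' f.
Proof. by move=> h d w w' e; apply: d => s /h; apply: e. Qed.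

Definition incr_config {R : realType} (f : Config -> R) : Prop :=
  forall w w' : Config, (forall s, w s -> w' s) -> f w <= f w'.

Section EB.
Variable R : realType.
Implicit Types (p q : R) (W : seq Site) (f g : Config -> R) (w : Config).

(* Expectation of [f] when the sites of [W] are resampled independently, each
   being [true] with probability [p]. *)
Fixpoint EB p W f w : R :=
  if W is v :: W' then p * EB p W' f (upd w v true) + (1 - p) * EB p W' f (upd w v false)
  else f w.

Lemma EB_ext p W f g w : (forall w, f w = g w) -> EB p W f w = EB p W g w.
Proof. by move=> /funext ->. Qed.

Lemma EB_cst p W (c : R) w : EB p W (fun=> c) w = c.
Proof. by elim: W w => //= v W ih w; rewrite !ih; ring. Qed.

Lemma EB_add p W f g w : EB p W (fun w => f w + g w) w = EB p W f w + EB p W g w.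
Proof. by elim: W w => //= v W ih w; rewrite !ih; ring. Qed.

Lemma EB_scale p W (c : R) f w : EB p W (fun w => c * f w) w = c * EB p W f w.
Proof. by elim: W w => //= v W ih w; rewrite !ih; ring. Qed.

Lemma EB_sub p W f g w : EB p W (fun w => f w - g w) w = EB p W f w - EB p W g w.
Proof. by elim: W w => //= v W ih w; rewrite !ih; ring. Qed.

Lemma EB_sum p W (I : Type) (r : seq I) (P : pred I) (F : I -> Config -> R) w :
  EB p W (fun w => \sum_(i <- r | P i) F i w) w = \sum_(i <- r | P i) EB p W (F i) w.
Proof.
elim: r => [|i r ih].
  by rewrite big_nil -[RHS](EB_cst p W 0 w); apply: EB_ext => w'; rewrite big_nil.
rewrite big_cons -ih; case: (boolP (P i)) => Pi.
  by rewrite -EB_add; apply: EB_ext => w'; rewrite big_cons Pi.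
by apply: EB_ext => w'; rewrite big_cons (negbTE Pi).
Qed.

Lemma EB_le p W f g w : 0 <= p <= 1 -> (forall w, f w <= g w) -> EB p W f w <= EB p W g w.
Proof.
move=> /andP[p0 p1] h; elim: W w => //= v W ih w.
by apply: lerD; apply: ler_wpM2l; rewrite ?subr_ge0.
Qed.

Lemma EB_ge0 p W f w : 0 <= p <= 1 -> (forall w, 0 <= f w) -> 0 <= EB p W f w.
Proof. by move=> hp h; rewrite -(EB_cst p W 0 w); apply: EB_le. Qed.

Lemma EB_depends p W Z f : depends Z f -> depends [pred s | Z s & s \notin W] (EB p W f).
Proof.
elim: W => [|v W ih] d w w' e /=.
  by apply: d => s Zs; apply: e; rewrite /= Zs.
by congr (_ * _ + _ * _); apply: ih => // s /= /andP[Zs sW]; rewrite /upd;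
   case: eqP => // /eqP n; apply: e; rewrite /= Zs inE negb_or n.
Qed.

Lemma EB_const p W Z f w w' : depends Z f -> (forall s, Z s -> s \in W) ->
  EB p W f w = EB p W f w'.
Proof.
by move=> d h; apply: (EB_depends p d) => s /andP[/h ->].
Qed.

Lemma EB_id p W Z f w : depends Z f -> (forall s, Z s -> s \notin W) -> EB p W f w = f w.
Proof.
elim: W w => //= v W ih w d h; rewrite !ih //; last 2 first.
- by move=> s /h; rewrite inE negb_or => /andP[].
- by move=> s /h; rewrite inE negb_or => /andP[].
have e b : f (upd w v b) = f w.
  apply: d => s /h; rewrite inE negb_or /upd => /andP[/negbTE -> //].
by rewrite !e; ring.
Qed.

Definition resample p v f w : R := p * f (upd w v true) + (1 - p) * f (upd w v false).

Lemma EB_resample p v W f w : EB p W (resample p v f) w = resample p v (EB p W f) w.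
Proof.
elim: W w => // u W ih w /=; rewrite !ih /resample.
case: (eqVneq u v) => [->|n]; first by rewrite !upd_upd.
by rewrite !(@upd_comm w u v) //; ring.
Qed.

Lemma EB_comm p W1 W2 f w : EB p W1 (EB p W2 f) w = EB p W2 (EB p W1 f) w.
Proof.
elim: W1 w => // v W1 ih w.
transitivity (EB p W2 (resample p v (EB p W1 f)) w); last by [].
by rewrite EB_resample /resample /= !ih.
Qed.

(** Resampling over [W1] and over [W2] commute, and each alone already gives a constant. *)
Lemma EB_window p Z f W1 W2 w1 w2 : depends Z f -> (forall s, Z s -> s \in W1) ->
  (forall s, Z s -> s \in W2) -> EB p W1 f w1 = EB p W2 f w2.
Proof.
move=> d h1 h2.
have e1 : EB p W1 f = fun=> EB p W1 f w1 by apply/funext => w; apply: EB_const d h1.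
have e2 : EB p W2 f = fun=> EB p W2 f w2 by apply/funext => w; apply: EB_const d h2.
by rewrite -(EB_cst p W2 (EB p W1 f w1) w2) -e1 EB_comm e2 EB_cst.
Qed.

Lemma EB_mul p W Z f g w : depends Z f -> depends (predC Z) g ->
  EB p W (fun w => f w * g w) w = EB p W f w * EB p W g w.
Proof.
move=> df dg; elim: W w => //= v W ih w; rewrite !ih.
case: (boolP (Z v)) => Zv.
  have -> : EB p W g (upd w v true) = EB p W g (upd w v false); last by ring.
  apply: (EB_depends p dg) => s /= /andP[Zs _]; rewrite /upd.
  by case: eqP => // e; rewrite e Zv in Zs.
have -> : EB p W f (upd w v true) = EB p W f (upd w v false); last by ring.
apply: (EB_depends p df) => s /= /andP[Zs _]; rewrite /upd.
by case: eqP => // e; rewrite e (negbTE Zv) in Zs.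
Qed.

Lemma EB_incr p W f : 0 <= p <= 1 -> incr_config f -> incr_config (EB p W f).
Proof.
move=> /andP[p0 p1] hf; elim: W => //= v W ih w w' h.
have hu b s : upd w v b s -> upd w' v b s by rewrite /upd; case: eqP => // _; apply: h.
by apply: lerD; apply: ler_wpM2l; rewrite ?subr_ge0 //; apply: ih => s; apply: hu.
Qed.

(** In place of a monotone coupling, the parameter is raised one site at a time. *)
Lemma EB_mono p q W f w : 0 <= p -> p <= q -> q <= 1 -> incr_config f ->
  EB p W f w <= EB q W f w.
Proof.
move=> p0 pq q1 hf; elim: W w => //= v W ih w.
have h : EB q W f (upd w v false) <= EB q W f (upd w v true).
  apply: EB_incr => //; first by rewrite (le_trans p0).
  by move=> s; rewrite /upd; case: eqP.
have h1 := ih (upd w v true); have h2 := ih (upd w v false).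
have hp1 : 0 <= 1 - p by rewrite subr_ge0 (le_trans pq).
apply: (@le_trans _ _ (p * EB q W f (upd w v true) + (1 - p) * EB q W f (upd w v false))).
  by apply: lerD; apply: ler_wpM2l.
rewrite -subr_ge0; set a := EB _ _ _ _ in h *; set b := EB _ _ _ _ in h *.
have -> : q * b + (1 - q) * a - (p * b + (1 - p) * a) = (q - p) * (b - a) by ring.
by rewrite mulr_ge0 ?subr_ge0.
Qed.

Lemma EB_map p W f (h k : Site -> Site) w : cancel h k -> cancel k h ->
  EB p (map h W) f (w \o k) = EB p W (fun w => f (w \o k)) w.
Proof.
move=> hk kh; elim: W w => //= v W ih w.
have e b : upd (w \o k) (h v) b = upd w v b \o k.
  apply/funext => s; rewrite /upd /=; congr (if _ then _ else _).
  by rewrite -{1}(kh s) (inj_eq (can_inj hk)).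
by rewrite !e !ih.
Qed.

Definition influence (v : Site) f w : R := f (upd w v true) - f (upd w v false).

Lemma EB_influence p W f w v : v \notin W ->
  EB p W f (upd w v true) - EB p W f (upd w v false) = EB p W (influence v f) w.
Proof.
elim: W w => //= u W ih w; rewrite inE negb_or => /andP[n nW].
by rewrite -!ih // !(@upd_comm w v u) //; ring.
Qed.

Lemma influence_depends v Z f : depends Z f -> depends [pred s | Z s & s != v] (influence v f).
Proof.
move=> d w w' h; rewrite /influence; congr (_ - _); apply: d => s Zs; rewrite /upd;
  case: eqP => // /eqP n; apply: h; by rewrite /= Zs.
Qed.

(** The product rule applied to the recursion yields the difference of the two branches, which is
    the expected influence of the head site; that influence ignores the state of the site itself, so
    resampling this site leaves it unchanged. *)
Lemma russo_formula W f w p : uniq W ->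
  is_derive p (1 : R) (fun p => EB p W f w) (\sum_(v <- W) EB p W (influence v f) w).
Proof.
elim: W w => [|v W ih] w /=; first by rewrite big_nil => _; apply: is_derive_cst.
move=> /andP[nv uW].
have h1 := ih (upd w v true) uW; have h2 := ih (upd w v false) uW.
have := is_deriveD (is_deriveM (is_derive_id p (1 : R)) h1)
  (is_deriveM (is_deriveB (is_derive_cst (1 : R) p (1 : R)) (is_derive_id p (1 : R))) h2).
move=> h; apply: is_derive_eq h _.
have c b : EB p W (influence v f) (upd w v b) = EB p W (influence v f) w.
  have d : depends predT f by move=> w1 w2 e; congr f; apply/funext => s; apply: e.
  apply: (EB_depends p (influence_depends (v := v) d)) => s /= /andP[n _].
  by rewrite /upd (negbTE n).
rewrite big_cons /= !c -EB_influence // big_split /= -!mulr_sumr.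
have sc (a b : R) : a *: (b : R^o) = a * b by [].
rewrite !sc !fctE /cst; ring.
Qed.

End EB.
Arguments EB : simpl never.

Definition origin : Site := (0, 0).
Definition sub_site (s x : Site) : Site := (s.1 - x.1, s.2 - x.2).
Definition add_site (s x : Site) : Site := (s.1 + x.1, s.2 + x.2).

Lemma add_siteK x : cancel (add_site^~ x) (sub_site^~ x).
Proof. by case=> a b; rewrite /sub_site /add_site /= !addrK. Qed.

Lemma sub_siteK x : cancel (sub_site^~ x) (add_site^~ x).
Proof. by case=> a b; rewrite /sub_site /add_site /= !subrK. Qed.

Definition on_bd (N : nat) (s : Site) : bool := (`|s.1| == N%:Z) || (`|s.2| == N%:Z).

(** The path is confined to the box around [x], which makes this a local event. *)
Definition reach (N : nat) (x : Site) (w : Config) : bool :=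
  `[< exists y, on_bd N (sub_site y x) /\
        conn_in (fun s => w s && bnd_in N (sub_site s x)) x y >].

Lemma reach_depends N x : depends (fun s => bnd_in N (sub_site s x)) (reach N x).
Proof.
move=> w w' h; rewrite /reach.
suff -> : (fun s => w s && bnd_in N (sub_site s x)) =
  (fun s => w' s && bnd_in N (sub_site s x)) by [].
by apply/funext => s; case: (boolP (bnd_in N _)) => [/h ->|_] //; rewrite !andbF.
Qed.

Lemma reach_mono N x (w w' : Config) : (forall s, w s -> w' s) -> reach N x w -> reach N x w'.
Proof.
move=> h /asboolP[y [hy c]]; apply/asboolP; exists y; split => //.
by apply: conn_mono c => s /andP[/h -> ->].
Qed.

Lemma reach_of_conn N x (w : Config) y : conn_in w x y ->
  (N%:Z <= `|y.1 - x.1|) || (N%:Z <= `|y.2 - x.2|) -> reach N x w.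
Proof.
move=> c hy; have [wx _] := conn_ends c.
pose B : pred Site := fun s => w s && bnd_in N (sub_site s x).
have : reach N x w \/ conn_in B x y.
  apply: (conn_ind (Q := fun y => reach N x w \/ conn_in B x y) c).
    by right; apply: conn_refl; rewrite /B wx /bnd_in /sub_site /=; lia.
  move=> a b ab wa wb [|ca]; first by left.
  have [_ Ba] := conn_ends ca.
  case: (boolP (bnd_in N (sub_site b x))) => hb.
    right; apply: (conn_trans ca); apply: conn1 => //; first by rewrite /B wb.
  left; apply/asboolP; exists a; split => //.
  move: Ba hb ab; rewrite /B /bnd_in /on_bd /sub_site /adjb /=.
  by case: a {ca wa} => a1 a2; case: b {wb} => b1 b2 /=; case: (w _) => //=; lia.
case=> // cy; apply/asboolP; exists y; split => //.
have [_] := conn_ends cy; move: hy; rewrite /B /bnd_in /on_bd /sub_site /=.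
by case: y {c cy} => y1 y2 /=; case: (w _) => //=; lia.
Qed.

Lemma conn_translate (A : pred Site) x u v : conn_in A u v ->
  conn_in (fun s => A (sub_site s x)) (add_site u x) (add_site v x).
Proof.
move=> c; have [Au _] := conn_ends c.
have E s : A (sub_site (add_site s x) x) = A s by rewrite add_siteK.
apply: (conn_ind (Q := fun v => conn_in _ (add_site u x) (add_site v x)) c).
  by apply: conn_refl; rewrite E.
move=> a b ab Aa Ab h; apply: (conn_trans h); apply: conn1; rewrite ?E //.
by move: ab; rewrite /adjb /add_site /=; lia.
Qed.

Lemma reach_translate N x (w : Config) : reach N x (w \o (sub_site^~ x)) = reach N origin w.
Proof.
have s0 s : sub_site s origin = s by case: s => a b; rewrite /sub_site /= !subr0.
apply/asboolP/asboolP => -[y [hy c]].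
  pose z : Site := (- x.1, - x.2); have e s : sub_site s z = add_site s x.
    by rewrite /sub_site /add_site /= !opprK.
  have e' s : add_site s z = sub_site s x by [].
  exists (sub_site y x); rewrite s0; split => //.
  have := conn_translate z c; rewrite !e'.
  rewrite (_ : sub_site x x = origin); last by rewrite /sub_site !subrr.
  by apply: conn_mono => s; rewrite e /= add_siteK s0.
exists (add_site y x); rewrite add_siteK; rewrite s0 in hy; split => //.
have := conn_translate x c.
rewrite (_ : add_site origin x = x); last by case: x {c} => a b; rewrite /add_site /= !add0r.
by apply: conn_mono => s; rewrite s0.
Qed.

Lemma bnd_in_adj L u x : adjb u x -> bnd_in L u -> bnd_in L.+1 x.
Proof. by case: u x => u1 u2 [x1 x2]; rewrite /adjb /bnd_in /=; lia. Qed.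

Lemma on_bd_far L N x y : (L < N)%N -> on_bd N (sub_site y origin) -> bnd_in L.+1 x ->
  ((N - L.+1)%:Z <= `|y.1 - x.1|) || ((N - L.+1)%:Z <= `|y.2 - x.2|).
Proof.
by case: x y => x1 x2 [y1 y2]; rewrite /on_bd /bnd_in /sub_site /= !subr0; lia.
Qed.

Lemma last_exit (A P : pred Site) a b : conn_in A a b -> P a -> ~~ P b ->
  exists u x, [/\ A u, P u, adjb u x, ~~ P x & conn_in (fun s => A s && ~~ P s) x b].
Proof.
move=> c Pa Pb; apply: contrapT => h.
suff : P b by rewrite (negbTE Pb).
suff : P b \/ (~~ P a /\ conn_in (fun s => A s && ~~ P s) a b) by rewrite Pa => -[|[]].
have c' := conn_sym c; have [_ Ab] := conn_ends c.
apply: (conn_ind (Q := fun a => P b \/ (~~ P a /\ conn_in (fun s => A s && ~~ P s) a b)) c').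
  by right; split => //; apply: conn_refl; rewrite Ab.
move=> x y xy Ax Ay [|[Px cx]]; first by left.
case: (boolP (P y)) => Py.
  by case: h; exists y, x; split => //; rewrite adjb_sym.
right; split => //; apply: conn_trans cx.
by apply: conn1; rewrite ?Ay ?Ax // adjb_sym.
Qed.

Section Masks.
Variable S : seq Site.

(** Subsets of [S] as Boolean tuples: a finite type over which one can condition on the value of a
    random set. *)
Definition mask_pred (m : (size S).-tuple bool) : pred Site :=
  fun u => (u \in S) && nth false m (index u S).

Definition pattern (P : pred Site) : (size S).-tuple bool := map_tuple P (in_tuple S).

Lemma mask_pattern P u : mask_pred (pattern P) u = (u \in S) && P u.
Proof.
rewrite /mask_pred; case: (boolP (u \in S)) => //= uS.
by rewrite (nth_map u) ?index_mem // nth_index.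
Qed.

Lemma eq_patternP (P Q : pred Site) : reflect {in S, P =1 Q} (pattern P == pattern Q).
Proof.
apply: (iffP eqP) => [e u uS|h].
  by have := mask_pattern P u; rewrite e mask_pattern uS.
by apply: val_inj => /=; apply/eq_in_map.
Qed.

Lemma sum_pattern (R : realType) (P : pred Site) (F : (size S).-tuple bool -> R) :
  \sum_m (pattern P == m)%:R * F m = F (pattern P).
Proof.
rewrite (bigD1 (pattern P)) //= eqxx mul1r big1 ?addr0 // => m n.
by rewrite eq_sym (negbTE n) mul0r.
Qed.

End Masks.

(** * Exploration of clusters and decay of connection probabilities *)

Section Percolation.
Variable R : realType.
Implicit Types (p q : R).

Definition theta p (N : nat) : R := EB p (box N) (fun w => (reach N origin w)%:R) (fun=> false).

Definition open_in (S : seq Site) (w : Config) : pred Site := fun u => w u && (u \in S).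

Definition open_cluster (S : seq Site) (w : Config) : pred Site :=
  fun u => `[< conn_in (open_in S w) origin u >].

(** The state of [x] is left free: in site percolation it is paid for by the connection that starts
    at [x]. *)
Definition touch (S : seq Site) (x : Site) (w : Config) : bool :=
  has (fun u => open_cluster S w u && adjb u x) S.

(* The Duminil-Copin--Tassion functional of a set [S] contained in the box of radius [L]. *)
Definition phi p (L : nat) (S : seq Site) : R :=
  \sum_(x <- box L.+1 | x \notin S) EB p S (fun w => (touch S x w)%:R) (fun=> false).

Lemma reach_incr N x : incr_config (fun w => (reach N x w)%:R : R).
Proof.
by move=> w w' /(@reach_mono N x) h; rewrite ler_nat; case: (reach N x w) h => // ->.
Qed.

Lemma theta_ge0 p N : 0 <= p <= 1 -> 0 <= theta p N.
Proof. by move=> hp; apply: EB_ge0. Qed.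

Lemma theta_le1 p N : 0 <= p <= 1 -> theta p N <= 1.
Proof.
move=> hp; rewrite -[leRHS](EB_cst p (box N) 1 (fun=> false)); apply: EB_le => // w.
by rewrite lern1; case: reach.
Qed.

Lemma theta_mono p q N : 0 <= p -> p <= q -> q <= 1 -> theta p N <= theta q N.
Proof. by move=> ? ? ?; apply: EB_mono => //; apply: reach_incr. Qed.

Lemma EB_reach p N x W w : (forall s, bnd_in N (sub_site s x) -> s \in W) ->
  EB p W (fun w => (reach N x w)%:R) w = theta p N.
Proof.
move=> h; rewrite /theta.
have -> : (fun w => (reach N origin w)%:R : R) = fun w => (reach N x (w \o (sub_site^~ x)))%:R.
  by apply/funext => w'; rewrite reach_translate.
rewrite -(EB_map p (box N) (fun w => (reach N x w)%:R) _ (add_siteK x) (sub_siteK x)).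
apply: (@EB_window _ _ (fun s => bnd_in N (sub_site s x))) => // [|s hs].
  by move=> w1 w2 /(@reach_depends N x) ->.
by apply/mapP; exists (sub_site s x); rewrite ?mem_box // sub_siteK.
Qed.

Lemma open_cluster_mem S w u : open_cluster S w u -> u \in S.
Proof. by move=> /asboolP /conn_ends[_ /andP[]]. Qed.

(** Exploring the cluster queries only the origin, the cluster and its neighbours in [S]. This set
    is read off from [w] alone, so it becomes deterministic once the cluster is prescribed. *)
Lemma open_cluster_agree S (w w' : Config) :
  (forall s, (s \in S) && [|| s == origin, open_cluster S w s | has (fun u => open_cluster S w u &&
    adjb u s) S] ->
     w s = w' s) -> open_cluster S w =1 open_cluster S w'.
Proof.
move=> h u; apply/asboolP/asboolP => c.
  apply: conn_mono (conn_inside c) => x /= /asboolP cx.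
  have /andP[wx xS] : open_in S w x by have [] := conn_ends cx.
  rewrite /open_in -h ?wx xS //= (_ : open_cluster S w x) ?orbT //.
  exact/asboolP.
have [/andP[w0 oS] _] := conn_ends c.
have w0' : open_in S w origin by rewrite /open_in h ?w0 ?oS ?eqxx.
apply: (conn_ind (Q := fun u => conn_in (open_in S w) origin u) c); first exact: conn_refl.
move=> a b ab /andP[_ aS] /andP[wb bS] ca; apply: (conn_trans ca).
have [wa _] := conn_ends (conn_sym ca).
apply: conn1 => //; rewrite /open_in bS h ?wb // bS /=.
apply/or3P/Or33; apply/hasP; exists a => //; rewrite ab andbT.
exact/asboolP.
Qed.

(* Conditionally on the open cluster of the origin inside [S], the path leaves
   [S] at a site [x] next to this cluster and reaches distance [N - L.+1] from
   [x] through sites that have not been explored. *)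
Lemma theta_decay p L S N : 0 <= p <= 1 -> (forall s, s \in S -> bnd_in L s) -> origin \in S ->
  (L < N)%N -> theta p N <= phi p L S * theta p (N - L.+1).
Proof.
move=> hp hS oS LN; set n := (N - L.+1)%N; set W := box N.
(* [Z m] holds the sites queried when the cluster has pattern [m]: [F] is determined on [Z m] and
   [G] off it, whence independence. *)
pose Z (m : (size S).-tuple bool) s := (s \in S) &&
  [|| s == origin, mask_pred m s | has (fun u => mask_pred m u && adjb u s) S].
pose adm (m : (size S).-tuple bool) x := has (fun u => mask_pred m u && adjb u x) S.
pose F (m : (size S).-tuple bool) x (w : Config) : R := ((pattern S (open_cluster S w) ==
  m) && adm m x)%:R.
pose G (m : (size S).-tuple bool) x (w : Config) : R := (reach n x (fun s => w s && ~~ Z m s))%:R.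
have mcomp w u : mask_pred (pattern S (open_cluster S w)) u = open_cluster S w u.
  by rewrite mask_pattern; case: (boolP (open_cluster S w u)) => [/open_cluster_mem ->|_];
    rewrite ?andbF.
have key w : (reach N origin w)%:R <= \sum_m \sum_(x <- box L.+1 | x \notin S) F m x w * G m x w.
  have pos m x : 0 <= F m x w * G m x w by rewrite mulr_ge0.
  case: (boolP (reach N origin w)); last by move=> _; apply: sumr_ge0 => m _; apply: sumr_ge0.
  move=> /asboolP[y [hy c]].
  set B : pred Site := (fun s => _ && _) in c.
  have [B0 By] := conn_ends c.
  have P0 : open_cluster S w origin.
    by apply/asboolP/conn_refl; rewrite /open_in oS andbT; case/andP: B0.
  have Py : ~~ open_cluster S w y.
    apply/negP => /open_cluster_mem /hS; move: hy; rewrite /on_bd /bnd_in /sub_site /= !subr0; lia.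
  have [u [x [Bu Pu ux Px cx]]] := last_exit c P0 Py.
  have [/andP[/andP[wx _] _] _] := conn_ends cx.
  have closed z : w z -> z \in S -> (exists2 v, open_cluster S w v & adjb v z) ->
    open_cluster S w z.
    move=> wz zS [v /asboolP cv vz]; apply/asboolP/(conn_trans cv).
    by apply: conn1 => //; [have [] := conn_ends (conn_sym cv) | rewrite /open_in wz].
  have xS : x \notin S by apply: contra Px => xS; apply: closed => //; exists u.
  have xb : x \in box L.+1.
    by rewrite mem_box; apply: bnd_in_adj ux (hS _ (open_cluster_mem Pu)).
  rewrite (bigD1 (pattern S (open_cluster S w))) //=.
  apply: (@le_trans _ _ (F (pattern S (open_cluster S w)) x w
    * G (pattern S (open_cluster S w)) x w)); last first.
    rewrite -[leLHS]addr0; apply: lerD; last by apply: sumr_ge0 => m _; apply: sumr_ge0.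
    by rewrite (big_rem x) //= xS lerDl; apply: sumr_ge0.
  have -> : F (pattern S (open_cluster S w)) x w = 1.
    rewrite /F eqxx /= (_ : adm _ x) //; apply/hasP; exists u; first exact: open_cluster_mem Pu.
    by rewrite mcomp Pu.
  rewrite mul1r /G (_ : reach _ _ _) //.
  apply: (@reach_of_conn _ _ _ y).
    apply: conn_mono cx => s /andP[/andP[ws _] Ps]; rewrite ws /=.
    apply/negP => /andP[sS]; rewrite mcomp (negbTE Ps) orFb => /orP[/eqP s0|].
      by rewrite s0 P0 in Ps.
    move=> /hasP[v _]; rewrite mcomp => /andP[vc vs].
    by move: Ps; rewrite closed //; exists v.
  by apply: (on_bd_far LN hy); rewrite -mem_box.
have depF m x : depends (Z m) (F m x).
  move=> w w' h; rewrite /F; congr (_%:R); congr (nat_of_bool (_ && _)).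
  apply/eqP/eqP => e.
    rewrite -e; apply/eqP/eq_patternP => u _; apply/esym; apply: open_cluster_agree => s hs.
    by apply: h; rewrite /Z -e; under eq_has do rewrite mcomp; rewrite mcomp.
  rewrite -e; apply/eqP/eq_patternP => u _; apply/esym; apply: open_cluster_agree => s hs.
  by apply/esym/h; rewrite /Z -e; under eq_has do rewrite mcomp; rewrite mcomp.
have depG m x : depends (predC (Z m)) (G m x).
  move=> w w' h; rewrite /G; congr (reach n x _)%:R; apply/funext => s.
  by case: (boolP (Z m s)) => /= hs; rewrite ?andbF // h.
(* The box of radius [n] around [x] fits into [W], because [n + L.+1 = N]. *)
have EG m x : x \in box L.+1 -> EB p W (G m x) (fun=> false) <= theta p n.
  rewrite mem_box => hx; rewrite -(@EB_reach p n x W (fun=> false)).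
    by apply: EB_le => // w; apply: reach_incr => s /andP[].
  move=> s; rewrite /W mem_box; move: hx; rewrite /bnd_in /sub_site /n /=.
  by case: (x) => x1 x2; case: (s) => s1 s2 /=; lia.
have -> : theta p N = EB p W (fun w => (reach N origin w)%:R) (fun=> false) by [].
apply: (le_trans (EB_le _ _ hp key)).
rewrite EB_sum.
apply: (@le_trans _ _ (\sum_m \sum_(x <- box L.+1 | x \notin S) EB p W (F m x) (fun=> false)
  * theta p n)).
  apply: ler_sum => m _; rewrite EB_sum big_seq_cond [leRHS]big_seq_cond.
  apply: ler_sum => x /andP[xb _].
  by rewrite (EB_mul p W _ (depF m x) (depG m x)); apply: ler_wpM2l (EG _ _ xb); apply: EB_ge0.
rewrite exchange_big /= /phi mulr_suml; apply: ler_sum => x _.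
rewrite -mulr_suml; apply: ler_wpM2r; first exact: theta_ge0.
rewrite -(EB_sum p W _ xpredT (fun m => F m x)) le_eqVlt; apply/orP; left; apply/eqP.
have -> : (fun w => \sum_m F m x w) = fun w => (touch S x w)%:R.
  apply/funext => w.
  transitivity (\sum_m (pattern S (open_cluster S w) == m)%:R * (adm m x)%:R : R).
    by apply: eq_bigr => m _; rewrite /F -natrM mulnb.
  rewrite sum_pattern /adm /touch; congr (nat_of_bool _)%:R.
  by apply: eq_has => u; rewrite mcomp.
apply: (@EB_window _ _ (mem S)) => //.
  move=> w w' h; congr (nat_of_bool _)%:R; apply: eq_has => u.
  by rewrite (@open_cluster_agree S w w') // => s /andP[/h].
move=> s /= /hS; rewrite /W mem_box /bnd_in; lia.
Qed.

End Percolation.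

Lemma nonincreasing_of_derive (R : realType) (f df : R -> R) (a b : R) :
  (forall x, is_derive x (1 : R) f (df x)) -> (forall x, a <= x <= b -> df x <= 0) -> a <= b ->
  f b <= f a.
Proof.
move=> hd h ab.
have cf : {within `[a, b], continuous f}.
  by apply: derivable_within_continuous => x _; have [] := hd x.
have [c] := @MVT_segment R f df a b ab (fun x _ => hd x) cf.
rewrite in_itv /= => hc e; rewrite -subr_le0 e mulr_le0_ge0 ?subr_ge0 //.
exact: h.
Qed.

Lemma sub_site0 s : sub_site s origin = s.
Proof. by case: s => a b; rewrite /sub_site /= !subr0. Qed.

(** * Sharpness of the phase transition: pivotal sites and summability *)

Section Sharpness.
Variable R : realType.
Implicit Types (p q : R).

Definition to_bd (N : nat) (w : Config) (u : Site) : bool :=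
  `[< exists y, on_bd N y /\ conn_in (fun s => w s && bnd_in N s) y u >].

(** The sites left unexplored when the cluster of the boundary is revealed together with its closed
    neighbours. Altering isolated sites does not change the set, while a site outside it but next to
    it is closed, and either on the boundary or next to the boundary cluster. *)
Definition isolated (n : nat) (w : Config) (u : Site) : bool :=
  [&& bnd_in n u, ~~ to_bd n.+1 w u & ~~ has (fun v => adjb v u && to_bd n.+1 w v) (box n.+1)].

Lemma to_bd_mem N w u : to_bd N w u -> w u /\ bnd_in N u.
Proof. by move=> /asboolP[y [_ /conn_ends[_ /andP[]]]]. Qed.

Lemma to_bd_step N w u v : to_bd N w u -> adjb u v -> w v -> bnd_in N v -> to_bd N w v.
Proof.
move=> h uv wv bv; have [wu bu] := to_bd_mem h.
move: h => /asboolP[y [hy c]]; apply/asboolP; exists y; split => //.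
by apply: (conn_trans c); apply: conn1; rewrite ?wu ?wv.
Qed.

Lemma to_bd_reach N w : to_bd N w origin = reach N origin w.
Proof.
apply/asboolP/asboolP => -[y [hy c]]; exists y; rewrite sub_site0 in hy *; split => //.
  by apply: conn_mono (conn_sym c) => s; rewrite sub_site0.
by apply: conn_mono (conn_sym c) => s; rewrite sub_site0.
Qed.

Lemma isolated_adj n w u v : isolated n w u -> adjb u v -> ~~ to_bd n.+1 w v.
Proof.
move=> /and3P[bu _ h] uv; apply: contra h => h; apply/hasP; exists v.
  by rewrite mem_box (bnd_in_adj uv).
by rewrite adjb_sym uv.
Qed.

Lemma on_bd_bnd n y : on_bd n.+1 y -> ~~ bnd_in n y.
Proof. by case: y => a b; rewrite /on_bd /bnd_in /=; lia. Qed.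

Lemma isolated_agree n (w w' : Config) : (forall s, ~~ isolated n w s -> w s = w' s) ->
  isolated n w =1 isolated n w'.
Proof.
move=> h; suff e : to_bd n.+1 w = to_bd n.+1 w' by move=> u; rewrite /isolated e.
apply/funext => u; apply/idP/idP => [|] /asboolP[y [hy c]].
  apply/asboolP; exists y; split => //; apply: conn_mono (conn_inside c) => x /= /asboolP cx.
  have [_ /andP[wx bx]] := conn_ends cx.
  rewrite -h ?wx //; apply/negP => /and3P[_ /negP nx _]; apply: nx.
  by apply/asboolP; exists y.
have [/andP[wy by_] _] := conn_ends c.
have ny : ~~ isolated n w y by apply/negP => /and3P[b _ _]; have := on_bd_bnd hy; rewrite b.
apply: (conn_ind (Q := fun u => to_bd n.+1 w u) c).
  by apply/asboolP; exists y; split => //; apply: conn_refl; rewrite h ?wy.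
move=> a b ab _ /andP[wb bb] ta; apply: (to_bd_step ta ab) => //.
rewrite h //; apply/negP => ib; rewrite adjb_sym in ab.
by have := isolated_adj ib ab; rewrite ta.
Qed.

Lemma to_bd_upd N w v : bnd_in N v -> on_bd N v \/ (exists2 z, adjb v z & to_bd N w z) ->
  to_bd N (upd w v true) v.
Proof.
move=> bv [ov|[z vz tz]].
  by apply/asboolP; exists v; split => //; apply: conn_refl; rewrite upd_eq.
have zv : adjb z v by rewrite adjb_sym.
suff tz' : to_bd N (upd w v true) z by apply: to_bd_step tz' zv _ bv; rewrite upd_eq.
move: tz => /asboolP[y [hy c]]; apply/asboolP; exists y; split => //.
by apply: conn_mono c => s /andP[ws ->]; rewrite andbT /upd; case: eqP.
Qed.

Lemma influence_ge0 v (f : Config -> R) w : incr_config f -> 0 <= influence v f w.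
Proof. by move=> h; rewrite subr_ge0; apply: h => s; rewrite /upd; case: eqP. Qed.

Lemma pivotal_influence N w v : ~~ to_bd N w v -> bnd_in N v ->
  on_bd N v \/ (exists2 z, adjb v z & to_bd N w z) ->
  ~~ reach N origin w -> reach N origin (upd w v true) ->
  influence v (fun w => (reach N origin w)%:R) w = 1 :> R.
Proof.
move=> nv bv h n0 n1; have wv : w v = false.
  apply/negP => wv; move/negP: nv; apply; have := to_bd_upd bv h.
  by rewrite -wv upd_id.
have e : upd w v false = w by rewrite -[RHS](upd_id w v) wv.
by rewrite /influence n1 e (negbTE n0) subr0.
Qed.

Let f n : Config -> R := fun w => (reach n.+1 origin w)%:R.

Definition sub_pattern n (m : (size (box n)).-tuple bool) : seq Site :=
  [seq u <- box n | mask_pred m u].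

Lemma mem_sub_pattern n w u : (u \in sub_pattern (pattern (box n) (isolated n w))) = isolated n w u.
Proof.
rewrite mem_filter mask_pattern mem_box; case: (boolP (bnd_in n u)) => //=; rewrite ?andbT //.
by move=> h; apply/esym/negP => /and3P[]; rewrite (negbTE h).
Qed.

(** A site outside the isolated set but next to it is closed and would join the boundary cluster if
    opened, so it is pivotal once it touches the cluster of an isolated origin. If the origin is not
    isolated and does not reach the boundary, the origin itself is pivotal. *)
Lemma influence_lower n w :
  (if origin \in sub_pattern (pattern (box n) (isolated n w))
   then \sum_(v <- box n.+1 | v \notin sub_pattern (pattern (box n) (isolated n w)))
          (touch (sub_pattern (pattern (box n) (isolated n w))) v w)%:R
   else 1 - f n w)
  <= \sum_(v <- box n.+1) influence v (f n) w.
Proof.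
have finc : incr_config (f n) by apply: reach_incr.
set S := sub_pattern _.
have mS u : u \in S = isolated n w u by rewrite mem_sub_pattern.
case: (boolP (origin \in S)) => oS.
  rewrite big_mkcond big_seq [leRHS]big_seq; apply: ler_sum => v; rewrite mem_box => bv.
  case: (boolP (v \notin S)) => // vS; last exact: influence_ge0.
  case: (boolP (touch S v w)) => [/hasP[u uS /andP[cu uv]]|_]; last exact: influence_ge0.
  rewrite mS in oS; rewrite mS in vS; rewrite mS in uS.
  have nv : ~~ to_bd n.+1 w v by apply: isolated_adj uv.
  have hv : on_bd n.+1 v \/ exists2 z, adjb v z & to_bd n.+1 w z.
    move: vS; rewrite /isolated nv andTb negb_and negbK => /orP[|/hasP[z _ /andP[zv tz]]].
      by move=> h; left; move: bv h; rewrite /bnd_in /on_bd; case: (v) => a b /=; lia.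
    by right; exists z => //; rewrite adjb_sym.
  have t1 := to_bd_upd bv hv.
  rewrite pivotal_influence //; first by rewrite -to_bd_reach; case/and3P: oS.
  rewrite -to_bd_reach; have /asboolP[y [hy c]] := t1.
  apply/asboolP; exists y; split => //; apply: (conn_trans c).
  have step s : open_in S w s -> upd w v true s && bnd_in n.+1 s.
    move=> /andP[ws]; rewrite mS => /and3P[bs _ _]; apply/andP; split.
      by rewrite /upd; case: eqP.
    by move: bs; rewrite /bnd_in; lia.
  have c0 : conn_in (fun s => upd w v true s && bnd_in n.+1 s) u origin.
    by apply: conn_sym; move/asboolP: cu; apply: conn_mono.
  apply: conn_trans c0; apply: conn1; rewrite ?upd_eq //.
    by have /asboolP cu' := cu; have [_ /step] := conn_ends cu'.
  by rewrite adjb_sym.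
have pos : 0 <= \sum_(v <- box n.+1) influence v (f n) w.
  by apply: sumr_ge0 => v _; apply: influence_ge0.
rewrite /f; case: (boolP (reach n.+1 origin w)) => h; first by rewrite subrr.
have b0 : bnd_in n.+1 origin by [].
have ob : origin \in box n.+1 by rewrite mem_box.
rewrite (big_rem origin) //= subr0 -[leLHS]addr0; apply: lerD; last first.
  by apply: sumr_ge0 => v _; apply: influence_ge0.
rewrite mS in oS.
have n0 : ~~ to_bd n.+1 w origin by rewrite to_bd_reach.
have hv : on_bd n.+1 origin \/ exists2 z, adjb origin z & to_bd n.+1 w z.
  move: oS; rewrite /isolated n0 (_ : bnd_in n origin) // !andTb negbK => /hasP[z _ /andP[zv tz]].
  by right; exists z => //; rewrite adjb_sym.
by rewrite pivotal_influence // -to_bd_reach; apply: to_bd_upd.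
Qed.

(* The set of isolated sites is determined by the sites outside it. Given that
   it equals [S], the sites next to both [S] and the open cluster of the origin
   in [S] are pivotal, and their expected number is [phi p n S]. *)
Lemma theta_derive_ge p n : 0 <= p <= 1 ->
  (forall S : seq Site, (forall s, s \in S -> bnd_in n s) -> origin \in S -> 1 <= phi p n S) ->
  1 - theta p n.+1 <= \sum_(v <- box n.+1) EB p (box n.+1) (influence v (f n)) (fun=> false).
Proof.
move=> hp hphi; set W := box n.+1; set w0 := (fun=> false) : Config.
rewrite -EB_sum; apply: le_trans (EB_le W w0 hp (influence_lower n)).
pose I (m : (size (box n)).-tuple bool) (w : Config) : R := (pattern (box n) (isolated n w) ==
  m)%:R.
pose H (m : (size (box n)).-tuple bool) (w : Config) : R := 
  if origin \in sub_pattern m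
  then \sum_(v <- box n.+1 | v \notin sub_pattern m) (touch (sub_pattern m) v w)%:R
  else 1 - f n w.
rewrite -[leRHS]/(EB p W (fun w => H (pattern (box n) (isolated n w)) w) w0).
have -> : (fun w => H (pattern (box n) (isolated n w)) w) = fun w => \sum_m I m w * H m w.
  by apply/funext => w; rewrite (sum_pattern (isolated n w) (fun m => H m w)).
have -> : 1 - theta p n.+1 = EB p W (fun w => \sum_m I m w * (1 - f n w)) w0.
  rewrite /theta -[X in X - _](EB_cst p W 1 w0) -EB_sub; congr (EB p W _ w0).
  by apply/funext => w; rewrite (sum_pattern (isolated n w) (fun m => 1 - f n w)).
rewrite !EB_sum; apply: ler_sum => m _.
rewrite /H; case: (boolP (origin \in sub_pattern m)) => // om.
set S := sub_pattern m in om *.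
have bS s : s \in S -> bnd_in n s by rewrite mem_filter mem_box => /andP[].
have dI : depends (predC (mem S)) (I m).
  move=> w w' h; rewrite /I; congr (nat_of_bool _)%:R.
  have ag (w1 w2 : Config) : (forall s, predC (mem S) s -> w1 s = w2 s) ->
      pattern (box n) (isolated n w1) == m -> pattern (box n) (isolated n w2) == m.
    move=> e /eqP em; rewrite -em; apply/eq_patternP => u _; apply/esym.
    by apply: isolated_agree => s hs; apply: e; rewrite /= /S -em mem_sub_pattern.
  by apply/idP/idP; apply: ag => // s hs; rewrite h.
apply: (@le_trans _ _ (EB p W (I m) w0)).
  apply: EB_le => // w; rewrite -[leRHS]mulr1; apply: ler_wpM2l; first by rewrite /I.
  by rewrite lerBlDr lerDl.
have -> : (fun w => I m w * \sum_(v <- box n.+1 | v \notin S) (touch S v w)%:R) =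
    fun w => \sum_(v <- box n.+1 | v \notin S) I m w * (touch S v w)%:R.
  by apply/funext => w; rewrite mulr_sumr.
rewrite EB_sum.
have dT v : depends (mem S) (fun w => (touch S v w)%:R : R).
  move=> w w' h; congr (nat_of_bool _)%:R; apply: eq_has => u.
  by rewrite (@open_cluster_agree S w w') // => s /andP[/h].
have dT' v : depends (predC (predC (mem S))) (fun w => (touch S v w)%:R : R).
  by apply: depends_mono (dT v) => s /=; rewrite negbK.
under eq_bigr => v _.
  rewrite (EB_mul p W w0 dI (dT' v)).
  rewrite (@EB_window _ p (mem S) (fun w => (touch S v w)%:R) W S w0 w0) //; last first.
    by move=> s /bS; rewrite /W mem_box /bnd_in; lia.
  over.
rewrite -mulr_sumr -[leLHS]mulr1; apply: ler_wpM2l; first exact: EB_ge0.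
exact: hphi.
Qed.

Lemma phi_mono p q L S : 0 <= p -> p <= q -> q <= 1 -> phi p L S <= phi q L S.
Proof.
move=> p0 pq q1; apply: ler_sum => x _; apply: EB_mono => // w w' h.
rewrite ler_nat; case: (boolP (touch S x w)) => // /hasP[u uS /andP[/asboolP cu ux]].
suff -> : touch S x w' by [].
apply/hasP; exists u => //; rewrite ux andbT; apply/asboolP.
by apply: conn_mono cu => s /andP[/h ws sS]; rewrite /open_in ws.
Qed.

Lemma uniq_box M : uniq (box M).
Proof.
have ui : uniq (irange M).
  by rewrite map_inj_in_uniq ?iota_uniq // => i j _ _; lia.
by apply: allpairs_uniq => // -[a b] [c d] _ _ /= [-> ->].
Qed.

(* Above a parameter where [phi >= 1] throughout, Russo's formula gives
   [theta' >= 1 - theta], so [(1 - theta) * exp] is nonincreasing. *)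
Lemma theta_lower p q n : 0 <= p -> p <= q -> q <= 1 ->
  (forall S : seq Site, (forall s, s \in S -> bnd_in n s) -> origin \in S -> 1 <= phi p n S) ->
  (1 - theta q n.+1) * expR q <= expR p.
Proof.
move=> p0 pq q1 h.
pose F (r : R) : R := (1 - theta r n.+1) * expR r.
pose T (r : R) : R := \sum_(v <- box n.+1) EB r (box n.+1) (influence v (f n)) (fun=> false).
have hd r : is_derive r (1 : R) F ((1 - theta r n.+1) * expR r - expR r * T r).
  have h1 : is_derive r (1 : R) (fun r => theta r n.+1) (T r).
    by apply: russo_formula; apply: uniq_box.
  have := is_deriveM (is_deriveB (is_derive_cst (1 : R) r (1 : R)) h1) (is_derive_expR r).
  move=> h2; apply: is_derive_eq h2 _.
  have sc (a b : R) : a *: (b : R^o) = a * b by [].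
  by rewrite !sc !fctE /cst; ring.
have : F q <= F p.
  apply: (nonincreasing_of_derive hd) => // r /andP[pr rq].
  have r1 : r <= 1 by apply: le_trans q1.
  have r0 : 0 <= r by apply: le_trans pr.
  have hT : 1 - theta r n.+1 <= T r.
    apply: theta_derive_ge; first by rewrite r0.
    by move=> S hS oS; apply: le_trans (h S hS oS) _; apply: phi_mono.
  rewrite [X in X - _]mulrC -mulrBr; apply: mulr_ge0_le0; first exact: expR_ge0.
  by rewrite subr_le0.
move=> /le_trans; apply; rewrite /F -[leRHS]mul1r; apply: ler_wpM2r; first exact: expR_ge0.
by rewrite lerBlDr lerDl theta_ge0 // p0 (le_trans pq).
Qed.

(** Otherwise [theta_lower] keeps [theta q] above [1 - expR (p - q)] at every positive scale. *)
Lemma exists_phi_lt1 p q : 0 <= p -> p < q -> q <= 1 -> theta q n @[n --> \oo] --> (0 : R) ->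
  exists L S, [/\ forall s, s \in S -> bnd_in L s, origin \in S & phi p L S < 1].
Proof.
move=> p0 pq q1 cv; apply: contrapT => nex.
have lo n : 1 - expR (p - q) <= theta q n.+1.
  have := @theta_lower p q n p0 (ltW pq) q1 _.
  rewrite expRB lerBlDr -lerBlDl ler_pdivlMr ?expR_gt0 //; apply => S hS oS.
  by rewrite leNgt; apply/negP => hlt; apply: nex; exists n, S.
have pos : 0 < 1 - expR (p - q) by rewrite subr_gt0 expR_lt1 subr_lt0.
have : 1 - expR (p - q) <= 0.
  by apply: (cvgr_to_ge cv); exists 1%N => // -[|n] //= _.
by rewrite leNgt pos.
Qed.

(** Summing [theta_decay] over the scales bounds the partial sum A by [L.+1 + phi p L S * A].
    Summability is all that Borel-Cantelli asks for. *)
Lemma theta_sum_bounded p L S : 0 <= p <= 1 -> (forall s, s \in S -> bnd_in L s) -> origin \in S ->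
  phi p L S < 1 -> exists C : R, forall M, \sum_(0 <= N < M) theta p N <= C.
Proof.
move=> hp hS oS h1; have phi0 : 0 <= phi p L S by apply: sumr_ge0 => x _; apply: EB_ge0.
have t0 N := theta_ge0 N hp; have t1 N := theta_le1 N hp.
exists (L.+1%:R / (1 - phi p L S)) => M.
rewrite ler_pdivlMr ?subr_gt0 // mulrBr mulr1 lerBlDr.
apply: (@le_trans _ _ (\sum_(0 <= N < M + L.+1) theta p N)).
  by rewrite [leRHS](big_cat_nat (n := M)) ?leq_addr //= lerDl; apply: sumr_ge0.
rewrite addnC [leLHS](big_cat_nat (n := L.+1)) ?leq_addr //=.
apply: lerD.
  apply: (@le_trans _ _ (\sum_(0 <= N < L.+1) 1)); first exact: ler_sum.
  by rewrite sumr_const_nat subn0.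
have -> : \sum_(L.+1 <= N < L.+1 + M) theta p N = \sum_(0 <= N < M) theta p (N + L.+1).
  by rewrite -{1}[L.+1]add0n big_addn addKn.
rewrite mulr_suml; apply: ler_sum => N _.
by have := @theta_decay _ p L S (N + L.+1) hp hS oS; rewrite addnK mulrC; apply;
  rewrite addnS ltnS leq_addl.
Qed.

End Sharpness.

(** * The critical probability in terms of [theta] *)

Section CriticalPoint.
Variable R : realType.
Implicit Types (p q : R).

Lemma EB_prod p (I : eqType) (c : I -> Site) (s : seq I) (g : I -> bool -> R) w :
  injective c -> uniq s ->
  EB p [seq c i | i <- s] (fun w => \prod_(i <- s) g i (w (c i))) w =
  \prod_(i <- s) (p * g i true + (1 - p) * g i false).
Proof.
move=> ci; elim: s w => [|v s ih] w /=.
  by move=> _; rewrite /EB !big_nil.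
move=> /andP[nv us]; rewrite big_cons.
have e b : EB p [seq c i | i <- s] (fun w => \prod_(i <- v :: s) g i (w (c i))) (upd w (c v) b) =
    g v b * \prod_(i <- s) (p * g i true + (1 - p) * g i false).
  have -> : (fun w => \prod_(i <- v :: s) g i (w (c i))) =
     fun w => g v (w (c v)) * \prod_(i <- s) g i (w (c i)).
    by apply/funext => w'; rewrite big_cons.
  have d1 : depends (pred1 (c v)) (fun w => g v (w (c v))).
    by move=> w1 w2 h; rewrite h /=.
  rewrite (EB_mul p _ _ d1) ?ih //; last first.
    move=> w1 w2 h; rewrite big_seq [RHS]big_seq; apply: eq_bigr => i si; rewrite h //=.
    by apply: contraNneq nv => /ci <-.
  rewrite (@EB_id _ _ _ _ _ _ d1) ?upd_eq // => u /eqP ->.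
  by rewrite mem_map.
by rewrite /= /EB -/(EB _ _) !e; ring.
Qed.

Section Box.
Variable N : nat.
Let I := ('I_(N.*2.+1) * 'I_(N.*2.+1))%type.
Let c (ij : I) : Site := (bcoord N ij.1, bcoord N ij.2).

Let ci : injective c.
Proof.
move=> [[a ha] [b hb]] [[a' ha'] [b' hb']]; rewrite /c /bcoord /= => -[e1 e2].
by congr (_, _); apply: val_inj => /=; lia.
Qed.

Let c_onto s : bnd_in N s -> exists ij, c ij = s.
Proof.
case: s => x y; rewrite /bnd_in /= => h.
have hx : (absz (x + N%:Z)%R < N.*2.+1)%N by lia.
have hy : (absz (y + N%:Z)%R < N.*2.+1)%N by lia.
by exists (Ordinal hx, Ordinal hy); rewrite /c /bcoord /=; congr (_, _); lia.
Qed.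

Let box_extE om ij : box_ext N om (c ij) = om ij.
Proof.
apply/existsP/idP => [[kl /and3P[/eqP h1 /eqP h2]]|h].
  by have /ci -> : c kl = c ij by rewrite /c h1 h2.
by exists ij; rewrite !eqxx.
Qed.

Let box_ext_out om s : box_ext N om s -> bnd_in N s.
Proof.
move=> /existsP[[[a ha] [b hb]] /and3P[/eqP h1 /eqP h2 _]].
by move: h1 h2; rewrite /bcoord /bnd_in /= => <- <-; lia.
Qed.

Lemma perc_box_theta p : perc_box R p N = theta p N.
Proof.
pose wt (om : {ffun I -> bool}) : R := \prod_ij (if om ij then p else 1 - p).
pose F (w : Config) : R := (reach N origin w)%:R.
have F_ext (om : {ffun I -> bool}) (w : Config) : (forall ij, w (c ij) = om ij) -> F w =
  F (box_ext N om).
  move=> h; rewrite /F (@reach_depends N origin w (box_ext N om)) // => s.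
  by rewrite sub_site0 => /c_onto[ij <-]; rewrite h box_extE.
have -> : perc_box R p N = \sum_(om : {ffun I -> bool}) wt om * F (box_ext N om).
  rewrite /perc_box big_mkcond /=; apply: eq_bigr => om _.
  have -> : p ^+ #|[set ij | om ij]| * (1 - p) ^+ #|[set ij | ~~ om ij]| = wt om.
    rewrite /wt (bigID (fun ij => om ij)) /=; congr (_ * _).
      rewrite -prodr_const; apply: eq_big => [ij|ij /set_mem /= -> //].
      by apply/idP/idP => [/set_mem|h]; [|apply/mem_set].
    rewrite -prodr_const; apply: eq_big => [ij|ij /set_mem /= /negbTE -> //].
    by apply/idP/idP => [/set_mem|h]; [|apply/mem_set].
  suff -> : `[< exists w : Site, (`|w.1| == N%:Z \/ `|w.2| == N%:Z) /\
               conn_in (box_ext N om) (0, 0) w >] = reach N origin (box_ext N om).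
    by rewrite /F; case: reach; rewrite ?mulr1 ?mulr0.
  apply/asboolP/asboolP => -[y [hy h]]; exists y; split.
  - by rewrite sub_site0 /on_bd; apply/orP.
  - by apply: conn_mono h => s hs; rewrite hs sub_site0 (box_ext_out hs).
  - by apply/orP; move: hy; rewrite sub_site0.
  - by apply: conn_mono h => s /andP[].
have -> : theta p N = EB p [seq c ij | ij <- enum {: I}] F (fun=> false).
  apply: (@EB_window _ _ (bnd_in N)).
  - by move=> w w' h; rewrite /F (@reach_depends N origin w w') // => s; rewrite sub_site0;
    apply: h.
  - by move=> s; rewrite mem_box.
  - by move=> s /c_onto[ij <-]; rewrite mem_map // mem_enum.
pose chi (om : {ffun I -> bool}) (w : Config) : R := \prod_(ij <- enum {: I}) (w (c ij) ==
  om ij)%:R.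
(* Decomposing [F] over the configurations of the box turns iterated resampling into explicit
   product weights. *)
have eF : F = fun w => \sum_om F (box_ext N om) * chi om w.
  apply/funext => w; pose ow : {ffun I -> bool} := [ffun ij => w (c ij)].
  rewrite (bigD1 ow) //= big1 ?addr0 => [|om n].
    rewrite /chi big1 ?mulr1; last by move=> ij _; rewrite ffunE eqxx.
    by apply: F_ext => ij; rewrite ffunE.
  have /existsP[ij hij] : [exists ij, w (c ij) != om ij].
    rewrite -negb_forall; apply: contra n => /forallP h; apply/eqP/ffunP => ij.
    by rewrite ffunE; apply/esym/eqP.
  by rewrite /chi (big_rem ij) ?mem_enum //= (negbTE hij) mul0r mulr0.
rewrite [in RHS]eF EB_sum; apply: eq_bigr => om _.
rewrite EB_scale mulrC; congr (_ * _); apply/esym.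
apply: (etrans (@EB_prod p _ c (enum {: I}) (fun ij b => (b ==
  om ij)%:R) (fun=> false) ci (enum_uniq _))).
rewrite /wt big_enum /=.
by apply: eq_bigr => ij _; case: (om ij); rewrite /= ?mulr1 ?mulr0 ?addr0 ?add0r.
Qed.

End Box.

Lemma theta_zeroE p : theta_zero R p = (theta p n @[n --> \oo] --> (0 : R)).
Proof.
rewrite /theta_zero (_ : (fun n => perc_box R p n) = theta p) //.
by apply/funext => n; rewrite perc_box_theta.
Qed.

Lemma below_p_c p : 0 <= p -> p < p_c R ->
  exists q, [/\ p < q, q <= 1 & theta q n @[n --> \oo] --> (0 : R)].
Proof.
move=> p0 hp; set E := [set p : R | 0 <= p <= 1 /\ theta_zero R p].
(* An empty [E] would give [p_c] the default value 0 of [sup], against [0 <= p < p_c]. *)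
have ne : E !=set0.
  apply: contrapT => /set0P/negP; rewrite negbK => /eqP e.
  by move: hp; rewrite /p_c -/E e sup0 ltNge p0.
have [q [/andP[q0 q1] tq] pq] := sup_gt ne hp.
by exists q; split => //; rewrite -theta_zeroE.
Qed.

Lemma p_c_le q : 0 <= q <= 1 -> ~ (theta q n @[n --> \oo] --> (0 : R)) -> p_c R <= q.
Proof.
move=> /andP[q0 q1] nq; rewrite /p_c; set E := [set p : R | _].
have ubE : ubound E q.
  move=> p [/andP[p0 p1] tp]; rewrite leNgt; apply/negP => qp; apply: nq.
  rewrite theta_zeroE in tp.
  apply: (squeeze_cvgr _ (cvg_cst 0) tp); apply: nearW => n.
  by rewrite theta_ge0 ?q0 ?q1 //= theta_mono // ltW.
have [ne|/set0P/negP] := pselect (E !=set0); first exact: ge_sup.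
by rewrite negbK => /eqP ->; rewrite sup0.
Qed.

End CriticalPoint.

(** * An upper bound on the critical probability *)

Section GapFree.
Variables (T : eqType) (r : rel T).

(** Local minimality: no vertex is related to the one two steps later. Unlike being shortest, this
    restricts only consecutive steps, so such paths can be counted with a transfer matrix. *)
Fixpoint gap_free (x : T) (s : seq T) : bool :=
  if s is y :: t then (if t is z :: _ then ~~ r x z else true) && gap_free y t else true.

Lemma gap_shortcut (A : pred T) x s : path r x s -> all A (x :: s) -> ~~ gap_free x s ->
  exists s', [/\ path r x s', last x s' = last x s, all A (x :: s') & (size s' < size s)%N].
Proof.
elim: s x => [|y [|z t] ih] x //=.
case: (boolP (r x z)) => /= [rxz /and3P[_ _ pt] /and4P[Ax _ Az At] _|_ /andP[rxy pt] /andP[Ax At]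
  g].
  by exists (z :: t); rewrite /= rxz pt Ax Az At.
have [s' [p l a sz]] := ih y pt At g.
by exists (y :: s'); split => //=; [rewrite rxy p | move: a => /= ->; rewrite Ax].
Qed.

Lemma exists_gap_free (A : pred T) x s : path r x s -> all A (x :: s) ->
  exists s', [/\ path r x s', last x s' = last x s, all A (x :: s'),
    uniq (x :: s') & gap_free x s'].
Proof.
have [n] := ubnP (size s); elim: n s => // n ih s; rewrite ltnS => sn p a.
case/shortenP: p => s' p' u' sub.
have a' : all A (x :: s').
  move: a => /= /andP[-> /allP h]; apply/allP => z /sub; exact: h.
have sz : (size s' <= n)%N by apply: leq_trans sn; apply: uniq_leq_size sub; case/andP: u'.
case: (boolP (gap_free x s')) => g; first by exists s'.
have [t [pt <- at_ st]] := gap_shortcut p' a' g.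
by apply: ih => //; apply: leq_trans sz.
Qed.

Lemma gap_free_take n x s : gap_free x s -> gap_free x (take n s).
Proof.
elim: s x n => [|y t ih] x [|n] //=; case/andP => h g; rewrite ih // andbT.
by case: t n h {g ih} => [|z t] [|n].
Qed.

End GapFree.

Section Walks.
Variables (D : eqType) (dirs : seq D) (ok : rel D).

Fixpoint walks (n : nat) (d : D) : seq (seq D) :=
  if n is n'.+1 then [seq d' :: s | d' <- [seq d' <- dirs | ok d d'], s <- walks n' d']
  else [:: [::]].

Lemma mem_walks n d s : size s = n -> path ok d s -> {subset s <= dirs} -> s \in walks n d.
Proof.
elim: n d s => [|n ih] d [|e s] //= [sz] /andP[de p] sub.
apply/allpairsPdep; exists e, s; split => //.
  by rewrite mem_filter de sub ?mem_head.
by apply: ih => // z zs; apply: sub; rewrite inE zs orbT.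
Qed.

(** [beta] is a supersolution of the transfer operator, standing in for its Perron eigenvector;
    [1 <= beta] starts the induction. *)
Lemma walks_sum (R : realType) (wt beta : D -> R) (lambda : R) n d : 0 <= lambda ->
  (forall e, 0 <= wt e) -> (forall e, 1 <= beta e) ->
  (forall e, e \in dirs -> \sum_(e' <- dirs | ok e e') wt e' * beta e' <= lambda * beta e) ->
  d \in dirs ->
  \sum_(s <- walks n d) \prod_(e <- s) wt e <= lambda ^+ n * beta d.
Proof.
move=> l0 w0 b1 h; elim: n d => [|n ih] d dd.
  by rewrite /= big_seq1 big_nil expr0 mul1r.
rewrite /= big_allpairs_dep big_filter /=.
apply: (@le_trans _ _ (\sum_(e <- dirs | ok d e) lambda ^+ n * (wt e * beta e))).
  rewrite big_seq_cond [leRHS]big_seq_cond; apply: ler_sum => e /andP[ed _].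
  under eq_bigr do rewrite big_cons.
  rewrite -mulr_sumr mulrCA; apply: ler_wpM2l => //; exact: ih.
rewrite -mulr_sumr exprSr -mulrA; apply: ler_wpM2l; first exact: exprn_ge0.
exact: h.
Qed.

End Walks.

Fixpoint steps (x : Site) (t : seq Site) : seq Site :=
  if t is y :: t' then sub_site y x :: steps y t' else [::].

Fixpoint points (x : Site) (s : seq Site) : seq Site :=
  if s is d :: s' then add_site x d :: points (add_site x d) s' else [::].

Lemma add_sub_site x y : add_site x (sub_site y x) = y.
Proof. by case: x y => a b [c d]; rewrite /add_site /sub_site /=; congr (_, _); lia. Qed.

Lemma points_steps x t : points x (steps x t) = t.
Proof. by elim: t x => //= y t ih x; rewrite add_sub_site ih. Qed.

Lemma size_steps x t : size (steps x t) = size t.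
Proof. by elim: t x => //= y t ih x; rewrite ih. Qed.

Lemma size_points x t : size (points x t) = size t.
Proof. by elim: t x => //= y t ih x; rewrite ih. Qed.

(** A king's move: the closed sites around an open cluster need diagonal steps to be connected. *)
Definition starb (a b : Site) : bool := (a != b) && bnd_in 1 (sub_site b a).

Definition star_dirs : seq Site := [seq d <- box 1 | d != origin].

(** Gap-freeness forbids two steps to end next to their start, and self-avoidance forbids the start
    itself. *)
Definition star_ok (d e : Site) : bool := ~~ bnd_in 1 (add_site d e).

Lemma star_ok_steps x y t : path starb x (y :: t) -> uniq (x :: y :: t) ->
  gap_free starb x (y :: t) -> path star_ok (sub_site y x) (steps y t).
Proof.
elim: t x y => // z t ih x y /= /and3P[xy yz p] u /andP[nxz g].
apply/andP; split; last first.
  by apply: ih => //=; rewrite ?yz //; case/andP: u.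
move: nxz u; rewrite /starb /star_ok !inE !negb_or /= => h /and3P[/and3P[_ xz _] _ _].
move: h; rewrite xz /= (_ : add_site _ _ = sub_site z x) //.
by case: (x) (y) (z) => a b [c d] [e f]; rewrite /add_site /sub_site /=; congr (_, _); lia.
Qed.

Lemma mem_star_dirs x y : starb x y -> sub_site y x \in star_dirs.
Proof.
rewrite /starb mem_filter mem_box => /andP[n ->]; rewrite andbT; apply: contra n.
case: x y => a b [c d]; rewrite /sub_site /origin !xpair_eqE /=; lia.
Qed.

Lemma steps_star_dirs x t : path starb x t -> {subset steps x t <= star_dirs}.
Proof.
elim: t x => [|y t ih] x //= /andP[xy p] d; rewrite inE => /orP[/eqP ->|].
  exact: mem_star_dirs.
exact: ih.
Qed.

Definition closed_path (n : nat) (x : Site) (w : Config) : bool :=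
  `[< exists s, [/\ size s = n, path starb x s, all (fun u => ~~ w u) (x :: s),
                    uniq (x :: s) & gap_free starb x s] >].

Lemma closed_path_of_conn n x y (w : Config) :
  (exists s, [&& path starb x s, last x s == y & all (fun u => ~~ w u) (x :: s)]) ->
  n%:Z <= `|y.1 - x.1| -> closed_path n x w.
Proof.
move=> [s /and3P[p /eqP l a]] far.
have [t [pt lt at_ ut gt]] := exists_gap_free p a.
have len z v : path starb z v -> `|(last z v).1 - z.1| <= (size v)%:Z.
  elim: v z => [|c v ih] z /=; first by rewrite subrr.
  by move=> /andP[/andP[_]]; rewrite /bnd_in /sub_site /= => h /ih; lia.
have nt : (n <= size t)%N by rewrite -lez_nat; apply: le_trans far _; have := len _ _ pt;
  rewrite lt l.
apply/asboolP; exists (take n t); split.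
- by rewrite size_takel.
- by have := pt; rewrite -{1}(cat_take_drop n t) cat_path => /andP[].
- move: at_ => /= /andP[-> at_]; apply/allP => z /mem_take; exact: (allP at_).
- move: ut => /= /andP[xt ut]; rewrite take_uniq // andbT.
  by apply: contra xt => /mem_take.
- exact: gap_free_take.
Qed.

Section ClosedPaths.
Variable R : realType.
Implicit Types p q : R.

Lemma EB_closed_prod p W (l : seq Site) : 0 <= p <= 1 -> uniq l ->
  EB p W (fun w => \prod_(u <- l) (~~ w u)%:R) (fun=> true) <= (1 - p) ^+ size l.
Proof.
move=> hp ul; have [p0 p1] := andP hp.
case: (boolP (all (mem W) l)) => [/allP sub|/allPn[u ul' uW]].
  have dl : depends (mem l) (fun w => \prod_(u <- l) (~~ w u)%:R : R).
    by move=> w w' h; rewrite big_seq [RHS]big_seq; apply: eq_bigr => u /h ->.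
  rewrite (@EB_window _ _ _ _ W [seq id u | u <- l] _ (fun=> true) dl) //; last first.
    by move=> s sl; rewrite map_id.
  rewrite (@EB_prod _ p _ id l (fun u b => (~~ b)%:R)) //.
  rewrite le_eqVlt; apply/orP; left; apply/eqP.
  under eq_bigr do rewrite mulr0 mulr1 add0r.
  by rewrite big_const_seq count_predT; elim: (size l) => //= n ->; rewrite exprS.
(* A site outside [W] keeps its initial value [true], so a path through it is never closed; this is
   why the expectation starts from the open configuration. *)
have e0 : EB p W (fun w => (~~ w u)%:R) (fun=> true) = 0 :> R.
  rewrite (@EB_id _ _ _ (pred1 u)) // => [w w' h|s /eqP -> //].
  by rewrite h /=.
apply: le_trans (_ : 0 <= _); last by rewrite exprn_ge0 ?subr_ge0.
rewrite -e0; apply: EB_le => // w; rewrite (big_rem u) //= -[leRHS]mulr1.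
apply: ler_wpM2l => //; apply: prodr_ile1 => v _.
by rewrite ler0n lern1; case: (w v).
Qed.

(* Weight 5 for axis-parallel and 8 for diagonal steps is nearly a Perron
   eigenvector of the transfer matrix of skip-free king walks, whose
   eigenvalue is [2 + sqrt 5 < 17 / 4]. *)
Definition star_weight (d : Site) : nat := if (d.1 == 0) || (d.2 == 0) then 5%N else 8%N.

Lemma star_weight_ok d : d \in star_dirs ->
  (4 * sumn [seq star_weight e | e <- star_dirs & star_ok d e] <= 17 * star_weight d)%N.
Proof.
suff /allP h : all (fun d => 4 * sumn [seq star_weight e | e <- star_dirs & star_ok d e]
   <= 17 * star_weight d)%N star_dirs by exact: h.
by vm_compute.
Qed.

(** The 64 is 8 first steps times the largest value 8 of [star_weight]. The path has [n.+2] closed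
    sites, and the factors of two of them are dropped. *)
Lemma EB_closed_path p W n x : 0 <= p <= 1 ->
  EB p W (fun w => (closed_path n.+1 x w)%:R) (fun=> true) <= 64 * (17 / 4 * (1 - p)) ^+ n.
Proof.
move=> hp; have [p0 p1] := andP hp; set q := 1 - p; have q0 : 0 <= q by rewrite subr_ge0.
have q1 : q <= 1 by rewrite lerBlDr lerDl.
pose G ds (w : Config) : R := if uniq (x :: points x ds) then
   \prod_(u <- x :: points x ds) (~~ w u)%:R else 0.
have G0 ds w : 0 <= G ds w by rewrite /G; case: ifP => // _; apply: prodr_ge0.
have key w : (closed_path n.+1 x w)%:R <=
    \sum_(d <- star_dirs) \sum_(s <- walks star_dirs star_ok n d) G (d :: s) w.
  case: (boolP (closed_path n.+1 x w)) => [/asboolP[[|y t] [sz pt at_ ut gt]]|_] //; last first.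
    by apply: sumr_ge0 => d _; apply: sumr_ge0.
  have dd : sub_site y x \in star_dirs by apply: mem_star_dirs; case/andP: pt.
  have sw : steps y t \in walks star_dirs star_ok n (sub_site y x).
    apply: mem_walks; first by rewrite size_steps; case: sz.
      exact: star_ok_steps.
    by apply: steps_star_dirs; case/andP: pt.
  rewrite (big_rem _ dd) /= (big_rem _ sw) /=.
  have -> : G (sub_site y x :: steps y t) w = 1.
    rewrite /G [points _ _]/= add_sub_site points_steps ut big_seq big1 // => u /(allP at_).
    by move=> /= ->.
  rewrite -addrA lerDl; apply: addr_ge0; first by apply: sumr_ge0.
  by apply: sumr_ge0 => d _; apply: sumr_ge0.
apply: le_trans (EB_le _ _ hp key) _; rewrite EB_sum.
apply: (@le_trans _ _ (\sum_(d <- star_dirs) 8 * (17 / 4 * q) ^+ n)); last first.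
  rewrite big_const_seq (_ : count xpredT star_dirs = 8%N) //.
  rewrite /= !addr0; set z := _ ^+ n; lra.
rewrite big_seq [leRHS]big_seq; apply: ler_sum => d dd; rewrite EB_sum.
apply: (@le_trans _ _ (\sum_(s <- walks star_dirs star_ok n d) \prod_(e <- s) q)).
  apply: ler_sum => s _; rewrite /G; case u : (uniq (x :: points x (d :: s))).
    apply: le_trans (EB_closed_prod W hp u) _.
    rewrite /= size_points big_const_seq count_predT.
    have -> : iter (size s) ( *%R q) 1 = q ^+ size s by elim: (size s) => //= k ->; rewrite exprS.
    by apply: ler_wiXn2l => //; exact: leq_trans (leqnSn _) (leqnSn _).
  by rewrite EB_cst; apply: prodr_ge0.
apply: (@le_trans _ _ ((17 / 4 * q) ^+ n * (star_weight d)%:R)).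
  apply: (walks_sum (beta := fun d => (star_weight d)%:R)) => //.
  - by rewrite mulr_ge0 // divr_ge0.
  - by move=> e; rewrite /star_weight; case: ifP; rewrite ler1n.
  move=> e ed; have := star_weight_ok ed.
  rewrite -mulr_sumr -big_filter.
  have -> : \sum_(i <- [seq i <- star_dirs | star_ok e i]) (star_weight i)%:R =
     (sumn [seq star_weight i | i <- star_dirs & star_ok e i])%:R :> R.
    by elim: [seq i <- _ | _] => [|i l ih]; rewrite ?big_nil // big_cons ih /= natrD.
  set a := sumn _; set b := star_weight e => h.
  have h' : 4 * a%:R <= 17 * b%:R :> R by rewrite -!natrM ler_nat.
  rewrite mulrAC mulrC -[leRHS]mulrC; nra.
rewrite mulrC; apply: ler_wpM2r; first by rewrite exprn_ge0 // mulr_ge0 // divr_ge0.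
by rewrite /star_weight; case: ifP => _; rewrite ler_nat.
Qed.

End ClosedPaths.

Lemma sq_corner a e : e \in sq_edges a ->
  [/\ a.1 <= e.1.1 <= a.1 + 1, a.2 <= e.1.2 <= a.2 + 1,
      a.1 <= (other_end e).1 <= a.1 + 1 & a.2 <= (other_end e).2 <= a.2 + 1].
Proof.
by case: a => x y; rewrite /sq_edges !inE /other_end => /or4P[] /eqP -> /=; split; lia.
Qed.

Lemma corner_dist (a x y : Site) : a.1 <= x.1 <= a.1 + 1 -> a.2 <= x.2 <= a.2 + 1 ->
  a.1 <= y.1 <= a.1 + 1 -> a.2 <= y.2 <= a.2 + 1 -> bnd_in 1 (sub_site y x).
Proof. by case: a x y => a b [c d] [e f]; rewrite /bnd_in /sub_site /=; lia. Qed.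

Lemma strictly_inside N (k : nat) : bnd_in N (k%:Z, 0) -> ~~ on_bd N (k%:Z, 0) -> (k < N)%N.
Proof. by rewrite /bnd_in /on_bd /=; lia. Qed.

(** The filling of the blocked cluster has a connected boundary that crosses both halves of the
    axis. Replacing its edges by their outer ends gives closed sites joined by king's moves, since
    consecutive ones are corners of a common square. The path from [(j, 0)] ends on the negative
    half, at distance more than [j]. *)
Lemma reach_or_closed_path K N (w : Config) : (forall s, bnd_in K s -> w s) ->
  ~~ reach N origin w -> exists2 j : nat, (K < j <= N)%N & closed_path j (j%:Z, 0) w.
Proof.
move=> wK nr.
pose A : pred Site := fun s => w s && bnd_in N s.
pose C : pred Site := fun s => `[<conn_in A origin s>].
have A0 : A origin by rewrite /A wK.
have C0 : C origin by apply/asboolP/conn_refl.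
have CA s : C s -> A s by move=> /asboolP /conn_ends[].
have bC s : C s -> bnd_in N s by move=> /CA /andP[].
have ins s : C s -> ~~ on_bd N s.
  move=> /asboolP c; apply: contra nr => b; apply/asboolP; exists s; rewrite sub_site0; split => //.
  by apply: conn_mono c => z; rewrite sub_site0.
have closed u v : C u -> adjb u v -> ~~ C v -> ~~ w v.
  move=> Cu uv; apply: contra => wv; have Au := CA _ Cu.
  have Av : A v.
    rewrite /A wv /=; move: uv (bC _ Cu) (ins _ Cu); rewrite /adjb /bnd_in /on_bd.
    by case: (u) (v) => a b [c d] /=; lia.
  move/asboolP: Cu => cu; apply/asboolP/(conn_trans cu); exact: conn1.
have cC u v : C u -> C v -> conn_in C u v.
  move=> /asboolP cu /asboolP cv.
  exact: conn_trans (conn_sym (conn_inside cu)) (conn_inside cv).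
pose outer (e : PEdge) := if fill C e.1 then other_end e else e.1.
have outer_closed e : contour_set (fill C) e -> ~~ w (outer e).
  move=> he; have [u [v [ev Cu fu Cv fv]]] := fill_edgeP he.
  have -> : outer e = v.
    by rewrite /outer; case: ev => -[-> ->]; [rewrite fu | rewrite (negbTE fv)].
  apply: closed Cu _ Cv; case: ev => -[<- <-]; first exact: adjb_other_end.
  by rewrite adjb_sym adjb_other_end.
have chain e f : dconn (contour_set (fill C)) e f ->
    exists s, [&& path starb (outer e) s, last (outer e) s ==
      outer f & all (fun u => ~~ w u) (outer e :: s)].
  move=> [s /and3P[p /eqP <- a]].
  apply: (path_all_connect (Q := fun f => exists s, [&& path starb (outer e) s,
      last (outer e) s == outer f & all (fun u => ~~ w u) (outer e :: s)]) p a).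
    by exists [::]; rewrite /= eqxx outer_closed //; case/andP: a.
  move=> g h gh Eg Eh cg; apply: path_cat_conn cg _.
  case: (eqVneq (outer g) (outer h)) => [->|n].
    by exists [::]; rewrite /= eqxx outer_closed.
  exists [:: outer h]; rewrite /= !outer_closed // eqxx !andbT /starb n /=.
  have [_ [b [/sq_corner[g1 g2 g3 g4] /sq_corner[h1 h2 h3 h4]]]] := dadjP _ _ gh.
  by rewrite /outer; case: ifP => _; case: ifP => _; apply: (@corner_dist b).
have f0 := fill_subset C0.
have [k [Ek fk]] := exit_right (fill_bounded bC) f0.
have [l [El fl]] := exit_left (fill_bounded bC) f0.
have z0 (z : int) : Posz 0 - z = - z by lia.
rewrite /= ?add0r in Ek fk; rewrite /= !z0 in El fl.
have okk : outer ((k%:Z, 0), true) = (k.+1%:Z, 0).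
  by rewrite /outer /= fk /other_end /=; congr (_, _); lia.
have okl : outer ((- l.+1%:Z, 0), true) = (- l.+1%:Z, 0).
  rewrite /outer /=; case: ifP => // fl'; move: El.
  by rewrite /contour_set /= fl' /other_end /= (_ : - l.+1%:Z + 1 = - l%:Z) ?fl //; lia.
have Ck : C (k%:Z, 0).
  have [] := @fill_boundary C (k%:Z, 0) (other_end ((k%:Z, 0), true)) => //.
    exact: (adjb_other_end ((k%:Z, 0), true)).
  by move: Ek; rewrite /contour_set fk; case: (fill C _).
exists k.+1.
  apply/andP; split.
    rewrite ltnNge; apply/negP => kK; have := outer_closed _ Ek; rewrite okk wK //.
    by rewrite /bnd_in /=; lia.
  exact: strictly_inside (bC _ Ck) (ins _ Ck).
have := chain _ _ (fill_boundary_connected bC cC Ek El); rewrite okk okl => h.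
apply: (closed_path_of_conn h) => /=; lia.
Qed.

Section CriticalBound.
Variable R : realType.

Lemma geometric_tail (x c : R) m n : 0 <= x -> (m <= n)%N -> 0 <= c ->
  (1 - x) * \sum_(m <= i < n) c * x ^+ i <= c * x ^+ m.
Proof.
move=> x0 mn c0; suff -> : (1 - x) * \sum_(m <= i < n) c * x ^+ i = c * x ^+ m - c * x ^+ n.
  by rewrite lerBlDr lerDl mulr_ge0 // exprn_ge0.
elim: n mn => [|n ih].
  by rewrite leqn0 => /eqP ->; rewrite big_geq // mulr0 subrr.
rewrite leq_eqVlt => /orP[/eqP ->|]; first by rewrite big_geq // mulr0 subrr.
by rewrite ltnS => mn; rewrite big_nat_recr //= mulrDr ih // exprS; ring.
Qed.

Lemma exists_expr_le (x c : R) : 0 <= x < 1 -> 0 < c -> exists n, x ^+ n <= c.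
Proof.
move=> /andP[x0 x1] c0.
have cv : x ^+ n @[n --> \oo] --> (0 : R) by apply: cvg_expr; rewrite ger0_norm.
have [n _ h] := cvgr_le _ cv _ c0.
by exists n; apply: h => /=.
Qed.

(** The box of radius [K] is opened at the cost of the power of [p]. A blocking path must then start
    on the axis beyond [K], and by the assumption on [K] all such paths together have probability at
    most 1/2. *)
Lemma theta_lower_bound (p : R) K N : 0 <= p <= 1 -> 17 / 4 * (1 - p) < 1 -> (K < N)%N ->
  128 * (17 / 4 * (1 - p)) ^+ K <= 1 - 17 / 4 * (1 - p) ->
  p ^+ size (box K) / 2 <= theta p N.
Proof.
move=> hp; have [p0 p1] := andP hp; set x := 17 / 4 * (1 - p) => x1 KN hK.
have x0 : 0 <= x by rewrite mulr_ge0 ?divr_ge0 // subr_ge0.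
set W := box N; pose w1 : Config := fun=> true.
have -> : theta p N = EB p W (fun w => (reach N origin w)%:R) w1.
  apply: (@EB_window _ _ (bnd_in N)) => [w w' h|s|s]; rewrite ?mem_box //.
  by rewrite (@reach_depends N origin w w') // => s; rewrite sub_site0; apply: h.
pose F (w : Config) : R := \prod_(u <- box K) (w u)%:R.
(* The box is declared open here, so that [G] does not see it and is independent of [F]. *)
pose E j (w : Config) : R := (closed_path j (j%:Z, 0) (fun s => w s || bnd_in K s))%:R.
pose G (w : Config) : R := 1 - \sum_(K <= i < N) E i.+1 w.
have F01 w : F w = 0 \/ F w = 1 /\ forall s, bnd_in K s -> w s.
  have [h|/existsNP[s /not_implyP[hs /negP ws]]] := pselect (forall s, bnd_in K s -> w s).
    by right; split => //; rewrite /F big_seq big1 // => s; rewrite mem_box => /h ->.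
  by left; rewrite /F (big_rem s) ?mem_box //= (negbTE ws) mul0r.
have key w : F w * G w <= (reach N origin w)%:R.
  have [->|[-> h]] := F01 w; first by rewrite mul0r.
  rewrite mul1r /G; have S0 : 0 <= \sum_(K <= i < N) E i.+1 w by apply: sumr_ge0.
  case: (boolP (reach N origin w)) => r; first by rewrite lerBlDr lerDl.
  have [[//|j] /andP[Kj jN] cj] := reach_or_closed_path h r.
  rewrite subr_le0 (bigD1_seq j) ?mem_index_iota ?iota_uniq //=; last by rewrite -ltnS Kj.
  have -> : E j.+1 w = 1.
    rewrite /E (_ : (fun s => w s || bnd_in K s) = w) ?cj //.
    by apply/funext => s; case: (boolP (bnd_in K s)) => [/h ->|_]; rewrite ?orbF.
  by rewrite lerDl; apply: sumr_ge0.
apply: le_trans (EB_le W w1 hp key).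
have dF : depends (bnd_in K) F.
  by move=> w w' h; rewrite /F big_seq [RHS]big_seq; apply: eq_bigr => s; rewrite mem_box => /h ->.
have dG : depends (predC (bnd_in K)) G.
  move=> w w' h; rewrite /G; congr (1 - _); apply: eq_bigr => i _; rewrite /E.
  congr (nat_of_bool (closed_path _ _ _))%:R; apply/funext => s.
  by case: (boolP (bnd_in K s)) => hs; rewrite ?orbT // !orbF h.
rewrite (EB_mul p W w1 dF dG).
have -> : EB p W F w1 = p ^+ size (box K).
  rewrite (@EB_window _ _ _ _ W [seq id u | u <- box K] _ w1 dF) //; last 2 first.
  - by move=> s; rewrite /W mem_box /bnd_in; lia.
  - by move=> s hs; rewrite map_id mem_box.
  rewrite (@EB_prod _ p _ id (box K) (fun u b => b%:R)) ?uniq_box //.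
  under eq_bigr do rewrite mulr0 mulr1 addr0.
  by rewrite big_const_seq count_predT; elim: (size _) => //= n ->; rewrite exprS.
apply: ler_wpM2l; first exact: exprn_ge0.
have -> : EB p W G w1 = 1 - \sum_(K <= i < N) EB p W (E i.+1) w1.
  by rewrite /G EB_sub EB_cst EB_sum.
have b : \sum_(K <= i < N) EB p W (E i.+1) w1 <= \sum_(K <= i < N) 64 * x ^+ i.
  apply: ler_sum => i _; apply: le_trans (EB_closed_path W i (i.+1%:Z, 0) hp).
  apply: EB_le => // w; rewrite ler_nat.
  suff h : closed_path i.+1 (i.+1%:Z, 0) (fun s => w s || bnd_in K s) -> closed_path i.+1 (i.+1%:Z,
    0) w.
    by case: (closed_path _ _ (fun s => _)) h => // ->.
  move=> /asboolP[s [h1 h2 h3 h4 h5]]; apply/asboolP; exists s; split => //.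
  by apply: sub_all h3 => u; rewrite negb_or => /andP[].
have t := geometric_tail x0 (ltnW KN) (ler0n R 64).
set S := \sum_(K <= i < N) 64 * x ^+ i in b t *.
have S2 : S <= 2^-1.
  have x1' : 0 < 1 - x by rewrite subr_gt0.
  rewrite -(ler_pM2l x1'); apply: le_trans t _.
  lra.
lra.
Qed.

Lemma p_c_bound : p_c R <= 10 / 13.
Proof.
have h01 : 0 <= 10 / 13 :> R by lra.
have h1 : 10 / 13 <= 1 :> R by lra.
apply: p_c_le; first by rewrite h01 h1.
move=> cv.
(* 51/52 is 17/4 times the closed density 3/13, and 1/6656 is (1 - 51/52) / 128. *)
have [||K hK] := @exists_expr_le (51 / 52) (1 / 6656); [lra|lra|].
have lo N : (K < N)%N -> (10 / 13 : R) ^+ size (box K) / 2 <= theta (10 / 13) N.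
  move=> KN; have e : 17 / 4 * (1 - 10 / 13) = 51 / 52 :> R by field.
  apply: theta_lower_bound => //; rewrite ?e ?h01 ?h1 //; first by lra.
  lra.
have : (10 / 13 : R) ^+ size (box K) / 2 <= 0.
  by apply: (cvgr_to_ge cv); exists K.+1 => // n /= /lo.
by rewrite leNgt divr_gt0 // exprn_gt0 //; lra.
Qed.

End CriticalBound.

(** * Ising measures on tori *)

Lemma to_torus_inj M n (s s' : Site) : (2 * M < n.+1)%N -> bnd_in M s -> bnd_in M s' ->
  to_torus n s = to_torus n s' -> s = s'.
Proof.
case: s s' => x y [x' y']; rewrite /bnd_in /to_torus /= => Mn h h' [] e1 e2.
have aux (a b : int) : `|a| <= M%:Z -> `|b| <= M%:Z ->
    inord (absz (a %% n.+1%:Z)%Z) = inord (absz (b %% n.+1%:Z)%Z) :> 'I_n.+1 -> a = b.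
  move=> ha hb /(congr1 val) /=.
  have pos : (n.+1%:Z != 0 :> int) by [].
  have a0 := modz_ge0 a pos; have b0 := modz_ge0 b pos.
  have alt := ltz_pmod a (isT : 0 < n.+1%:Z); have blt := ltz_pmod b (isT : 0 < n.+1%:Z).
  rewrite !inordK; [|lia|lia] => e.
  have em : (a %% n.+1%:Z)%Z = (b %% n.+1%:Z)%Z by lia.
  have : (n.+1%:Z %| a - b)%Z by rewrite -eqz_mod_dvd; apply/eqP.
  move=> /dvdzP[q hq].
  have d : `|a - b| < n.+1%:Z by clear -ha hb Mn; lia.
  have [q1|[q1|q1]] : q <= -1 \/ q = 0 \/ 1 <= q by lia.
  - by clear -d hq q1; nia.
  - by clear -d hq q1; nia.
  - by clear -d hq q1; nia.
by congr (_, _); apply: aux => //; case/andP: h; case/andP: h'.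
Qed.

Section Torus.
Variables (R : realType) (n : nat).
Local Notation T := ({ffun TSite n -> bool}).
Implicit Types (t : T) (v : TSite n).

Definition periodic (t : T) : Config := fun s => t (to_torus n s).

Definition flip (t : T) v : T := [ffun u => if u == v then ~~ t v else t u].

Lemma flipK v : involutive (flip^~ v).
Proof.
move=> t; apply/ffunP => u; rewrite !ffunE eqxx; case: eqP => [->|//].
by rewrite negbK.
Qed.

Lemma spin_mul b c : spin R b * spin R c = if b == c then 1 else -1.
Proof. by case: b; case: c; rewrite /spin /=; ring. Qed.

Section Weights.
Variables Jh Jv : R.

Lemma torus_weight_gt0 t : 0 < torus_weight R Jh Jv n t.
Proof. exact: expR_gt0. Qed.

Lemma torus_Z_gt0 : 0 < torus_Z R Jh Jv n.
Proof.
apply: (@lt_le_trans _ _ (torus_weight R Jh Jv n [ffun=> true])); first exact: torus_weight_gt0.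
rewrite /torus_Z (bigD1 [ffun=> true]) //= lerDl; apply: sumr_ge0 => t _.
exact/ltW/torus_weight_gt0.
Qed.

Hypotheses (Jh0 : 0 <= Jh) (Jv0 : 0 <= Jv).

(** Flipping [v] changes an edge term by at most 2 J for each endpoint equal to [v]. The shifts
    being bijections, each direction has two such endpoints, even on tori whose edges are loops. *)
Lemma torus_weight_flip t v : torus_weight R Jh Jv n t <=
  expR (4 * (Jh + Jv)) * torus_weight R Jh Jv n (flip t v).
Proof.
rewrite /torus_weight -expRD ler_expR -lerBlDr -sumrB.
pose d (u : TSite n) : R := (u == v)%:R.
pose rt (u : TSite n) : TSite n := (ordS u.1, u.2).
pose up (u : TSite n) : TSite n := (u.1, ordS u.2).
have rti : injective rt by move=> [a b] [c e] h; have /ordS_inj /= -> := congr1 fst h; have /= ->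
  := congr1 snd h.
have upi : injective up by move=> [a b] [c e] h; have /ordS_inj /= -> := congr1 snd h; have /= ->
  := congr1 fst h.
have one J a b : 0 <= J -> J * spin R (t a) * spin R (t b) -
    J * spin R (flip t v a) * spin R (flip t v b) <= 2 * J * (d a + d b).
  move=> J0; rewrite -!mulrA -mulrBr mulrCA; apply: ler_wpM2l => //.
  rewrite !spin_mul /d !ffunE.
  case: (eqVneq a v) => [->|na]; case: (eqVneq b v) => [->|nb] /=.
  - by rewrite !eqxx; lra.
  - by case: (t v); case: (t b) => /=; lra.
  - by case: (t v); case: (t a) => /=; lra.
  - by case: (t a); case: (t b) => /=; lra.
apply: (@le_trans _ _ (\sum_u (2 * Jh * (d u + d (rt u)) + 2 * Jv * (d u + d (up u))))).
  apply: ler_sum => u _; rewrite opprD addrACA; apply: lerD; exact: one.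
have sd (f : TSite n -> TSite n) : injective f -> \sum_u d (f u) = 1.
  move=> fi; have [g gf fg] := injF_bij fi.
  rewrite (bigD1 (g v)) //= /d fg eqxx big1 ?addr0 // => u nu.
  by rewrite -(inj_eq (can_inj fg)) gf; move/negbTE: nu => ->.
rewrite big_split /= -!mulr_sumr !big_split /= (sd rt rti) (sd up upi) (sd id (@inj_id _)).
lra.
Qed.

(** The conditional probability of a spin with which all four neighbours agree, the extreme case of
    the single-site conditional law. *)
Definition flip_prob : R := expR (2 * (Jh + Jv)) / (expR (2 * (Jh + Jv)) + expR (- (2
  * (Jh + Jv)))).

Lemma flip_prob01 : 0 <= flip_prob <= 1.
Proof.
have h1 := expR_gt0 (2 * (Jh + Jv)); have h2 := expR_gt0 (- (2 * (Jh + Jv))).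
apply/andP; split; first by rewrite divr_ge0 // ltW // addr_gt0.
by rewrite ler_pdivrMr ?addr_gt0 // mul1r lerDl ltW.
Qed.

Lemma weight_ratio t v : torus_weight R Jh Jv n t * (1 - flip_prob) <=
  flip_prob * torus_weight R Jh Jv n (flip t v).
Proof.
have h1 := expR_gt0 (2 * (Jh + Jv)); have h2 := expR_gt0 (- (2 * (Jh + Jv))).
set a := expR (2 * (Jh + Jv)) in h1; set b := expR (- (2 * (Jh + Jv))) in h2.
have e : 1 - flip_prob = b / (a + b).
  by rewrite /flip_prob -/a -/b; field; rewrite gt_eqF // addr_gt0.
rewrite e /flip_prob -/a -/b mulrA [leRHS]mulrAC; apply: ler_wpM2r.
  by rewrite invr_ge0 ltW // addr_gt0.
have := torus_weight_flip t v; rewrite (_ : 4 * (Jh + Jv) = 2 * (Jh + Jv) + 2 * (Jh + Jv));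
  last by ring.
rewrite expRD -/a => h.
have ab : a * b = 1 by rewrite /a /b -expRD subrr expR0.
apply: le_trans (ler_wpM2r (ltW h2) h) _.
by rewrite mulrAC -[a * a * b]mulrA ab mulr1.
Qed.

Section Domination.
Variables (W : seq Site) (tau : Config).
Hypothesis injW : {in W &, injective (to_torus n)}.

(** With [tau] one Ising copy or its negation, this marks the sites where the XOR spin has a
    prescribed sign. *)
Definition rel_conf t : Config := fun s => tau s == t (to_torus n s).

(** Pairing each configuration with its flip at [v] leaves a two-point inequality, namely
    [weight_ratio] times the increment of [f]. *)
Lemma domination_step (v : Site) (f : Config -> R) : v \in W -> depends (mem W) f ->
  incr_config f ->
  \sum_t torus_weight R Jh Jv n t * f (rel_conf t) <=
  \sum_t torus_weight R Jh Jv n t * resample flip_prob v f (rel_conf t).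
Proof.
move=> vW df incf; set w := torus_weight R Jh Jv n; set tv := to_torus n v.
have sym (F : T -> R) : \sum_t F t = \sum_t F (flip t tv).
  by rewrite (reindex_inj (inv_inj (flipK tv))).
suff h t : w t * f (rel_conf t) + w (flip t tv) * f (rel_conf (flip t tv)) <=
    w t * resample flip_prob v f (rel_conf t) +
    w (flip t tv) * resample flip_prob v f (rel_conf (flip t tv)).
  rewrite -(ler_pM2l (ltr0n R 2)) !mulr_natl !mulr2n {2}sym [X in _ <= _ + X]sym -!big_split /=.
  by apply: ler_sum => t _; apply: h.
wlog c : t / rel_conf t v.
  move=> wl; case: (boolP (rel_conf t v)) => [|c]; first exact: wl.
  have := wl (flip t tv); rewrite flipK addrC [leRHS]addrC; apply.
  by move: c; rewrite /rel_conf ffunE eqxx /tv; case: (tau v); case: (t _).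
have f1 : f (upd (rel_conf t) v true) = f (rel_conf t) by rewrite -{1}c upd_id.
have f0 : f (rel_conf (flip t tv)) = f (upd (rel_conf t) v false).
  apply: df => s sW; rewrite /rel_conf /upd ffunE /tv (inj_in_eq injW) //.
  case: (eqVneq s v) => [->|//]; move: c; rewrite /rel_conf.
  by case: (tau v); case: (t _).
have r0 : resample flip_prob v f (rel_conf (flip t tv)) = resample flip_prob v f (rel_conf t).
  have e b : f (upd (rel_conf (flip t tv)) v b) = f (upd (rel_conf t) v b).
    apply: df => s sW; rewrite /upd; case: eqP => // /eqP n'.
    by rewrite /rel_conf ffunE /tv (inj_in_eq injW) // (negbTE n').
  by rewrite /resample !e.
rewrite r0 f0 /resample f1; set a := f (rel_conf t); set b := f (upd _ _ _).
have ba : b <= a by rewrite /a -f1; apply: incf => s; rewrite /upd; case: eqP.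
have := weight_ratio t tv; rewrite -/w => hw.
rewrite -subr_ge0 (_ : _ - _ = (a - b) * (flip_prob * w (flip t tv) - w t * (1 - flip_prob)));
  last by ring.
by rewrite mulr_ge0 // subr_ge0.
Qed.

Lemma domination (f : Config -> R) w0 : depends (mem W) f -> incr_config f ->
  \sum_t torus_weight R Jh Jv n t * f (rel_conf t) <=
  torus_Z R Jh Jv n * EB flip_prob W f w0.
Proof.
move=> df incf.
have sub W' : {subset W' <= W} -> \sum_t torus_weight R Jh Jv n t * f (rel_conf t) <=
    \sum_t torus_weight R Jh Jv n t * EB flip_prob W' f (rel_conf t).
  elim: W' => // v W' ih sub.
  have sub' : {subset W' <= W} by move=> s hs; apply: sub; rewrite inE hs orbT.
  apply: le_trans (ih sub') _; apply: domination_step.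
  - by apply: sub; rewrite mem_head.
  - move=> w w' h; apply: (EB_depends flip_prob df) => s /= /andP[sW _]; exact: h.
  - by apply: EB_incr => //; apply: flip_prob01.
apply: le_trans (sub W _) _ => //.
rewrite /torus_Z mulr_suml; apply: ler_sum => t _.
by rewrite (@EB_const _ _ _ _ _ _ w0 df).
Qed.

End Domination.

End Weights.
End Torus.

(** * Spin monomial expansions and contour weights *)

Section SpinSums.
Variables (R : realType) (V : finType).
Local Notation T := ({ffun V -> bool}).

Lemma prod_count (S : seq V) (g : V -> R) : \prod_(v <- S) g v = \prod_v g v ^+ count_mem v S.
Proof.
elim: S => [|u S ih]; first by rewrite big_nil big1 // => v _; rewrite expr0.
rewrite big_cons ih [RHS](bigD1 u) //= eqxx exprD expr1 -mulrA (bigD1 u) //=; congr (_ * (_ * _)).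
by apply: eq_bigr => v /negbTE n; rewrite eq_sym n.
Qed.

(** The sum factors over the sites, and a spin of multiplicity k contributes 1 + (-1)^k. *)
Lemma sum_spin_prod_ge0 (S : seq V) : 0 <= \sum_(t : T) \prod_(v <- S) spin R (t v).
Proof.
under eq_bigr do rewrite prod_count.
rewrite -(bigA_distr_bigA (fun v b => spin R b ^+ count_mem v S)) /=.
apply: prodr_ge0 => v _; rewrite big_bool /= expr1n /spin.
by rewrite -signr_odd; case: (odd _); rewrite ?expr1 ?expr0; lra.
Qed.

(* Expanding in spin monomials, whose sums over all configurations are
   nonnegative, the comparison holds coefficient by coefficient. *)
Lemma spin_comparison (E : Type) (src dst : E -> V) (a b b' : E -> R) (l : seq E) (S : seq V) :
  (forall e, 0 <= a e) -> (forall e, `|b' e| <= b e) ->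
  `|\sum_(t : T) \prod_(e <- l) (a e + b' e * (spin R (t (src e)) * spin R (t (dst e)))) *
       \prod_(v <- S) spin R (t v)| <=
  \sum_(t : T) \prod_(e <- l) (a e + b e * (spin R (t (src e)) * spin R (t (dst e)))) *
       \prod_(v <- S) spin R (t v).
Proof.
move=> a0 bb; elim: l S => [|e l ih] S.
  under eq_bigr do rewrite big_nil mul1r.
  under [leRHS]eq_bigr do rewrite big_nil mul1r.
  by rewrite ger0_norm // sum_spin_prod_ge0.
have ex (c : E -> R) : \sum_(t : T) \prod_(e <- e :: l) (a e + c e * (spin R (t (src e))
  * spin R (t (dst e)))) *
       \prod_(v <- S) spin R (t v) =
    a e * (\sum_(t : T) \prod_(e <- l) (a e + c e * (spin R (t (src e)) * spin R (t (dst e)))) *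
       \prod_(v <- S) spin R (t v)) +
    c e * (\sum_(t : T) \prod_(e <- l) (a e + c e * (spin R (t (src e)) * spin R (t (dst e)))) *
       \prod_(v <- src e :: dst e :: S) spin R (t v)).
  rewrite !mulr_sumr -big_split /=; apply: eq_bigr => t _; rewrite !big_cons; ring.
rewrite !ex; apply: le_trans (ler_normD _ _) _; apply: lerD.
  by rewrite normrM (ger0_norm (a0 e)); apply: ler_wpM2l.
by rewrite normrM; apply: ler_pM => //; apply: ih.
Qed.

End SpinSums.

Section TorusEdges.
Variable n : nat.
Local Notation T := ({ffun TSite n -> bool}).
Definition TEdge : finType := (TSite n * bool)%type.
Definition tdst (e : TEdge) : TSite n := if e.2 then (ordS e.1.1, e.1.2) else (e.1.1, ordS e.1.2).
Definition disagree (e : TEdge) (t : T) : bool := t e.1 != t (tdst e).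
Definition xor_disagree (e : TEdge) (t1 t2 : T) : bool := disagree e t1 (+) disagree e t2.

Definition torus_edge (e : PEdge) : TEdge := (to_torus n e.1, e.2).

Lemma to_torus_other_end e : to_torus n (other_end e) = tdst (torus_edge e).
Proof.
have suc (x : int) : inord (absz ((x + 1) %% n.+1%:Z)%Z) =
  ordS (inord (absz (x %% n.+1%:Z)%Z)) :> 'I_n.+1.
  have pos : (n.+1%:Z != 0 :> int) by [].
  have a0 := modz_ge0 x pos; have alt := ltz_pmod x (isT : 0 < n.+1%:Z).
  apply: val_inj => /=; rewrite -modzDml.
  rewrite [LHS]inordK; last first.
    have b0 := modz_ge0 ((x %% n.+1%:Z)%Z + 1) pos.
    have blt := ltz_pmod ((x %% n.+1%:Z)%Z + 1) (isT : 0 < n.+1%:Z); lia.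
  rewrite inordK; last by lia.
  have -> : (x %% n.+1%:Z)%Z + 1 = (absz (x %% n.+1%:Z)%Z).+1%:Z by lia.
  by rewrite modz_nat.
by case: e => [[x y] []]; rewrite /other_end /to_torus /tdst /torus_edge /= suc.
Qed.

Lemma contour_periodic e t1 t2 :
  contour_set (xor_conf (periodic t1) (periodic t2)) e = xor_disagree (torus_edge e) t1 t2.
Proof.
rewrite /contour_set /xor_conf /periodic /xor_disagree /disagree to_torus_other_end /=.
by case: (t1 _); case: (t1 _); case: (t2 _); case: (t2 _).
Qed.

End TorusEdges.

Section TorusPeierls.
Variables (R : realType) (n : nat).
Local Notation T := ({ffun TSite n -> bool}).
Local Notation TEdge := (TEdge n).
Variables Jh Jv : R.
Hypotheses (Jh0 : 0 <= Jh) (Jv0 : 0 <= Jv).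

Definition tcoupling (b : bool) : R := if b then Jh else Jv.
Let ss (e : TEdge) (t : T) : R := spin R (t e.1) * spin R (t (tdst e)).

Lemma torus_weight_prod t : torus_weight R Jh Jv n t =
  \prod_(e : TEdge) expR (tcoupling e.2 * ss e t).
Proof.
rewrite /torus_weight -expR_sum; congr expR.
rewrite -(pair_bigA _ (fun v b => tcoupling b * ss (v, b) t)) /=.
by apply: eq_bigr => v _; rewrite big_bool /= /ss /tcoupling /tdst /= !mulrA.
Qed.

Definition contour_weight (b : bool) : R := expR (- 2 * tcoupling b).

Lemma contour_weight_ge0 b : 0 <= contour_weight b.
Proof. exact: expR_ge0. Qed.

(* By [spin_comparison], forcing the edges of [A] to disagree has at most the
   weight of forcing them to agree. *)
Lemma torus_contour_bound (A : seq TEdge) : uniq A ->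
  \sum_t torus_weight R Jh Jv n t * \prod_(e <- A) (disagree e t)%:R <=
  (\prod_(e <- A) contour_weight e.2) * torus_Z R Jh Jv n.
Proof.
move=> uA; pose J (e : TEdge) := tcoupling e.2.
have J0 e : 0 <= J e by rewrite /J /tcoupling; case: ifP.
(* Let s be the product of the end spins. Off [A], exp(J s) = cosh J + s sinh J. On [A], [a + b s]
   and [a + b' s] keep exp(J) for agreeing and for disagreeing ends respectively, and the true
   weight of a disagreeing edge is exp(-2 J) times the latter. *)
pose a e : R := if e \in A then expR (J e) / 2 else (expR (J e) + expR (- J e)) / 2.
pose b e : R := if e \in A then expR (J e) / 2 else (expR (J e) - expR (- J e)) / 2.
pose b' e : R := if e \in A then - (expR (J e) / 2) else (expR (J e) - expR (- J e)) / 2.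
have ssE e t : ss e t = if disagree e t then -1 else 1.
  by rewrite /ss spin_mul /disagree; case: eqP.
have pe e : 0 < expR (J e) by apply: expR_gt0.
have me e : 0 < expR (- J e) by apply: expR_gt0.
have epm e : expR (- J e) <= expR (J e) by rewrite ler_expR; have := J0 e; lra.
have a0 e : 0 <= a e by rewrite /a; case: ifP => _; have := pe e; have := me e; lra.
have bb e : `|b' e| <= b e.
  rewrite /b /b'; case: ifP => _; first by rewrite normrN ger0_norm // divr_ge0 // ltW.
  by rewrite ger0_norm // divr_ge0 // subr_ge0.
have prodA (F : TEdge -> R) : \prod_(e <- A) F e = \prod_e (if e \in A then F e else 1).
  by rewrite big_uniq //= big_mkcond.
have lhs t : torus_weight R Jh Jv n t * \prod_(e <- A) (disagree e t)%:R =
   (\prod_(e <- A) contour_weight e.2) * \prod_e (a e + b' e * ss e t).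
  rewrite torus_weight_prod !prodA -!big_split /=; apply: eq_bigr => e _.
  rewrite -/(J e) /a /b' ssE /contour_weight -/(J e).
  have ex : expR (- 2 * J e) * expR (J e) = expR (- J e) by rewrite -expRD; congr expR; ring.
  case: (boolP (e \in A)) => eA; case: (boolP (disagree e t)) => d /=.
  - by rewrite mulrN1 mulr1 -ex; field.
  - by rewrite mulr0; ring.
  - by rewrite mulrN1; field.
  - by rewrite !mulr1 mul1r; field.
rewrite (eq_bigr _ (fun t _ => lhs t)).
rewrite -mulr_sumr; apply: ler_wpM2l; first by apply: prodr_ge0 => e _; apply: contour_weight_ge0.
have := @spin_comparison R _ TEdge fst (@tdst n) a b b' (index_enum TEdge) [::] a0 bb.
under eq_bigr do rewrite big_nil mulr1.
under [leRHS]eq_bigr do rewrite big_nil mulr1.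
move=> /(le_trans (ler_norm _)) h; apply: (le_trans h).
rewrite /torus_Z; apply: ler_sum => t _; rewrite torus_weight_prod.
apply: ler_prod => e _; rewrite -/(ss e t) -/(J e) ssE /a /b.
have := pe e; have := me e => h1 h2.
by case: (e \in A); case: (disagree e t); rewrite ?mulrN1 ?mulr1; apply/andP; split; lra.
Qed.

(** An edge of the XOR contour lies in the contour of exactly one copy. Assigning the edges of [A]
    one by one gives 2 to the power |A| products of single-copy events, each bounded by the same
    weight; in the induction [B1] and [B2] hold the edges assigned so far. *)
Lemma torus_xor_contour_bound (A : seq TEdge) : uniq A ->
  \sum_t1 \sum_t2 torus_weight R Jh Jv n t1 * torus_weight R Jh Jv n t2 *
     \prod_(e <- A) (xor_disagree e t1 t2)%:R <=
  (\prod_(e <- A) (2 * contour_weight e.2)) * torus_Z R Jh Jv n ^+ 2.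
Proof.
move=> uA; set w := torus_weight R Jh Jv n.
have w0 t : 0 <= w t by apply/ltW/torus_weight_gt0.
pose P (B : seq TEdge) t : R := \prod_(e <- B) (disagree e t)%:R.
have P0 B t : 0 <= P B t by apply: prodr_ge0.
suff gen (C B1 B2 : seq TEdge) : uniq (C ++ B1) -> uniq (C ++ B2) ->
    \sum_t1 \sum_t2 w t1 * w t2 * (P B1 t1 * P B2 t2 * \prod_(e <- C) (xor_disagree e t1 t2)%:R) <=
    (\prod_(e <- C) (2 * contour_weight e.2)) *
      ((\prod_(e <- B1) contour_weight e.2) * (\prod_(e <- B2) contour_weight e.2)) *
      torus_Z R Jh Jv n ^+ 2.
  have := gen A [::] [::]; rewrite !cats0 !big_nil !mulr1 => /(_ uA uA).
  congr (_ <= _); apply: eq_bigr => t1 _; apply: eq_bigr => t2 _.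
  by rewrite /P !big_nil !mul1r.
elim: C B1 B2 => [|e C ih] B1 B2 u1 u2.
  rewrite big_nil mul1r.
  have -> : \sum_t1 \sum_t2 w t1 * w t2 * (P B1 t1 * P B2 t2
    * \prod_(e <- [::]) (xor_disagree e t1 t2)%:R) =
      (\sum_t1 w t1 * P B1 t1) * (\sum_t2 w t2 * P B2 t2).
    rewrite mulr_suml; apply: eq_bigr => t1 _; rewrite mulr_sumr; apply: eq_bigr => t2 _.
    by rewrite big_nil; ring.
  rewrite expr2 mulrACA; apply: ler_pM.
  - by apply: sumr_ge0 => t _; apply: mulr_ge0.
  - by apply: sumr_ge0 => t _; apply: mulr_ge0.
  - exact: torus_contour_bound.
  - exact: torus_contour_bound.
have perm (B : seq TEdge) : uniq ((e :: C) ++ B) -> uniq (C ++ (e :: B)) /\ uniq (C ++ B).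
  have -> : uniq (C ++ e :: B) = uniq ((e :: C) ++ B).
    by apply: perm_uniq; rewrite perm_catC /= perm_cons perm_catC.
  by move=> h; split => //; case/andP: h.
have [u1e u1'] := perm _ u1; have [u2e u2'] := perm _ u2.
apply: (@le_trans _ _ (\sum_t1 \sum_t2 (w t1 * w t2 * (P (e :: B1) t1 * P B2 t2
  * \prod_(e <- C) (xor_disagree e t1 t2)%:R)
   + w t1 * w t2 * (P B1 t1 * P (e :: B2) t2 * \prod_(e <- C) (xor_disagree e t1 t2)%:R)))).
  apply: ler_sum => t1 _; apply: ler_sum => t2 _.
  rewrite -mulrDr; apply: ler_wpM2l; first exact: mulr_ge0.
  rewrite /P !big_cons -/(P B1 t1) -/(P B2 t2); set Q := \prod_(_ <- C) _.
  have Q0 : 0 <= Q by apply: prodr_ge0.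
  have := mulr_ge0 (mulr_ge0 (P0 B1 t1) (P0 B2 t2)) Q0.
  rewrite /xor_disagree; case: (disagree e t1); case: (disagree e t2) => /=;
    rewrite ?mul0r ?mul1r ?mulr0 ?addr0 ?add0r //; lra.
rewrite (eq_bigr _ (fun t1 _ => big_split _ _ _ _ _)) big_split /=;
  apply: le_trans (lerD (ih _ _ u1e u2') (ih _ _ u1' u2e)) _.
rewrite !big_cons /=.
set c1 := \prod_(_ <- C) _; set c2 := \prod_(_ <- B1) _; set c3 := \prod_(_ <- B2) _.
by rewrite le_eqVlt; apply/orP; left; apply/eqP; ring.
Qed.

End TorusPeierls.

(** * The infinite-volume law *)

Lemma pattern_eq (W : seq Site) (s : Config) (m : (size W).-tuple bool) : uniq W ->
  (pattern W s == m) = all (fun u => s u == mask_pred m u) W.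
Proof.
move=> uW; apply/eqP/allP => [<- u uW'|h]; first by rewrite mask_pattern uW'.
apply: val_inj; apply: (@eq_from_nth _ false) => [|i];
  first by apply: etrans (size_map _ _) (esym (size_tuple m)).
rewrite size_map => iW; rewrite (nth_map origin) //.
have sW : nth origin W i \in W by apply: mem_nth.
by rewrite (eqP (h _ sW)) /mask_pred sW index_uniq.
Qed.

Section Law.
Variables (R : realType) (Jh Jv : R).
Variables (d : measure_display) (Omega : measurableType d) (P : probability Omega R).
Variables (sig1 sig2 : Omega -> Config).
Hypothesis law : ising_pair_law R Jh Jv d Omega P sig1 sig2.

Lemma measurable_spin v b : measurable [set w | sig1 w v == b] /\ measurable [set w | sig2 w v ==
  b].
Proof.
have [m1 [m2 _]] := law.
have aux (sg : Omega -> Config) : measurable [set w | sg w v] -> measurable [set w | sg w v == b].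
  case: b => m; first by rewrite (_ : [set w | sg w v == true] = [set w | sg w v]) //;
    apply/seteqP; split=> w /=; rewrite eqb_id.
  rewrite (_ : [set w | sg w v == false] = ~` [set w | sg w v]); first exact: measurableC.
  by apply/seteqP; split=> w /=; rewrite eqbF_neg => /negP.
by split; apply: aux.
Qed.

Lemma measurable_cylinder (W : seq Site) (xi1 xi2 : Config) :
  measurable [set w | all (fun s => (sig1 w s == xi1 s) && (sig2 w s == xi2 s)) W].
Proof.
elim: W => [|v W ih].
  by rewrite (_ : [set w | _] = setT) //; apply/seteqP; split.
have [h1 h2] := measurable_spin v (xi1 v); have [_ h3] := measurable_spin v (xi2 v).
rewrite (_ : [set w | _] = [set w | sig1 w v == xi1 v] `&` [set w | sig2 w v == xi2 v] `&`
   [set w | all (fun s => (sig1 w s == xi1 s) && (sig2 w s == xi2 s)) W]).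
  by apply: measurableI => //; apply: measurableI.
apply/seteqP; split=> w /=; first by move=> /andP[/andP[-> ->] ->].
by move=> [[-> ->] ->].
Qed.

Lemma measure_bigsetU_le (I : Type) (r : seq I) (F : I -> set Omega) : (forall i,
  measurable (F i)) ->
  (P (\big[setU/set0]_(i <- r) F i) <= \sum_(i <- r) P (F i))%E.
Proof.
move=> mF; elim: r => [|i r ih]; first by rewrite !big_nil measure0.
rewrite !big_cons; apply: le_trans (measureU2 _ _ _) _ => //.
  exact: bigsetU_measurable.
exact: leeD2l.
Qed.

Local Notation w n := (torus_weight R Jh Jv n).

Definition depends_on_pair (W : seq Site) (A : Config -> Config -> bool) : Prop :=
  forall s1 s1' s2 s2' : Config, {in W, s1 =1 s1'} -> {in W, s2 =1 s2'} -> A s1 s2 = A s1' s2'.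

Section Event.
Variables (W : seq Site) (A : Config -> Config -> bool).
Hypotheses (uW : uniq W) (dA : depends_on_pair W A).

Let I := ((size W).-tuple bool * (size W).-tuple bool)%type.
Let cyl (m : I) : set Omega :=
  [set w | all (fun s => (sig1 w s == mask_pred m.1 s) && (sig2 w s == mask_pred m.2 s)) W].
Let r : seq I := [seq m <- enum {: I} | A (mask_pred m.1) (mask_pred m.2)].

Let pattern_in (s : Config) : {in W, mask_pred (pattern W s) =1 s}.
Proof. by move=> u uin; rewrite mask_pattern uin. Qed.

Lemma event_cylinders : [set w | A (sig1 w) (sig2 w)] = \big[setU/set0]_(m <- r) cyl m.
Proof.
rewrite -bigcup_seq; apply/seteqP; split=> x /=.
  move=> Ax; exists (pattern W (sig1 x), pattern W (sig2 x)).
    rewrite /= mem_filter mem_enum /= andbT -(dA (s1 := sig1 x) (s2 := sig2 x)) // => u uin;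
      by rewrite pattern_in.
  by apply/allP => u uin; rewrite /= !pattern_in // !eqxx.
move=> [m]; rewrite /= mem_filter => /andP[Am _] /allP h.
rewrite -(dA (s1 := mask_pred m.1) (s2 := mask_pred m.2)) // in Am *;
  by move=> u uin; have /andP[/eqP h1 /eqP h2] := h u uin.
Qed.

Lemma event_measurable : measurable [set w | A (sig1 w) (sig2 w)].
Proof.
rewrite event_cylinders; apply: bigsetU_measurable => m _; exact: measurable_cylinder.
Qed.

Lemma torus_event n : \sum_(m <- r) torus_cyl R Jh Jv n W (mask_pred m.1)
  * torus_cyl R Jh Jv n W (mask_pred m.2) =
  (\sum_t1 \sum_t2 w n t1 * w n t2 * (A (periodic t1) (periodic t2))%:R) / torus_Z R Jh Jv n ^+ 2.
Proof.
have cylE (m : (size W).-tuple bool) : torus_cyl R Jh Jv n W (mask_pred m) =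
    (\sum_t (pattern W (periodic t) == m)%:R * w n t) / torus_Z R Jh Jv n.
  rewrite /torus_cyl big_mkcond /=; congr (_ / _); apply: eq_bigr => t _.
  rewrite pattern_eq // -[X in (if X then _ else _)]/(all (fun s => periodic t s ==
    mask_pred m s) W).
  by case: (all _ W); rewrite ?mul1r ?mul0r.
have expand t1 t2 : (A (periodic t1) (periodic t2))%:R = \sum_(m : I)
    (pattern W (periodic t1) == m.1)%:R * (pattern W (periodic t2) == m.2)%:R *
    (A (mask_pred m.1) (mask_pred m.2))%:R :> R.
  rewrite -(pair_bigA _ (fun m1 m2 => (pattern W (periodic t1) == m1)%:R
    * (pattern W (periodic t2) == m2)%:R *
    (A (mask_pred m1) (mask_pred m2))%:R)) /=.
  under eq_bigr => m1 _ do (under eq_bigr => m2 _ do rewrite -mulrA; rewrite -mulr_sumr).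
  rewrite (sum_pattern (periodic t1) (fun m1 => \sum_i _
    * _)) (sum_pattern (periodic t2) (fun m2 => _)).
  by congr (nat_of_bool _)%:R; apply: dA => u uW'; rewrite pattern_in.
rewrite /r big_filter big_enum_cond /= big_mkcond /=.
transitivity (\sum_(m : I) (A (mask_pred m.1) (mask_pred m.2))%:R *
   (\sum_t1 (pattern W (periodic t1) == m.1)%:R * w n t1) * (\sum_t2 (pattern W (periodic t2) ==
     m.2)%:R * w n t2)
   / torus_Z R Jh Jv n ^+ 2).
  apply: eq_bigr => m _; rewrite !cylE; case: (A _ _); last by rewrite !mul0r.
  rewrite mul1r expr2 invfM; ring.
rewrite -mulr_suml; congr (_ / _).
transitivity (\sum_(m : I) \sum_t1 \sum_t2 w n t1 * w n t2 * ((pattern W (periodic t1) == m.1)%:R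
  * (pattern W (periodic t2) == m.2)%:R *
    (A (mask_pred m.1) (mask_pred m.2))%:R)).
  apply: eq_bigr => m _; rewrite -mulrA mulr_suml mulr_sumr; apply: eq_bigr => t1 _.
  rewrite mulr_sumr mulr_sumr; apply: eq_bigr => t2 _; ring.
rewrite exchange_big; apply: eq_bigr => t1 _; rewrite exchange_big; apply: eq_bigr => t2 _.
by rewrite expand mulr_sumr.
Qed.

(** A local event is a finite union of cylinders, on which the law is a limit of torus averages;
    subadditivity suffices for an upper bound. *)
Lemma event_le (B : R) :
  (\forall n \near \oo, \sum_t1 \sum_t2 w n t1 * w n t2 * (A (periodic t1) (periodic t2))%:R <=
     B * torus_Z R Jh Jv n ^+ 2) ->
  (P [set w | A (sig1 w) (sig2 w)] <= B%:E)%E.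
Proof.
move=> hB; have [_ [_ cv]] := law.
pose T n := \sum_(m <- r) torus_cyl R Jh Jv n W (mask_pred m.1)
  * torus_cyl R Jh Jv n W (mask_pred m.2).
have cvT : T n @[n --> \oo] --> (\sum_(m <- r) fine (P (cyl m)) : R).
  rewrite /T; elim: r => [|m l ih].
    by under eq_fun do rewrite big_nil; rewrite big_nil; apply: cvg_cst.
  under eq_fun do rewrite big_cons.
  by rewrite big_cons; apply: cvgD => //; apply: cv.
have fin m : P (cyl m) \is a fin_num by apply: fin_num_measure; apply: measurable_cylinder.
rewrite event_cylinders; apply: le_trans (measure_bigsetU_le _ _) _.
  by move=> m; apply: measurable_cylinder.
rewrite (eq_bigr (fun m => (fine (P (cyl m)))%:E)); last by move=> m _; rewrite fineK.
rewrite sumEFin lee_fin; apply: (cvgr_to_le cvT).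
apply: filterS hB => n hn; rewrite /T torus_event ler_pdivrMr // exprn_gt0 //.
exact: torus_Z_gt0.
Qed.

End Event.

Lemma near_torus_inj (W : seq Site) : \forall n \near \oo, {in W &, injective (to_torus n)}.
Proof.
have [M hM] : exists M, forall s, s \in W -> bnd_in M s.
  by have /finite_bounded[M hM] := finite_seq W; exists M.
exists (2 * M)%N => // n /= hn s s' /hM hs /hM hs'; apply: to_torus_inj hs hs'.
by rewrite ltnS.
Qed.

Definition xor_of (w : Omega) : Config := xor_conf (sig1 w) (sig2 w).

Section Domination.
Hypotheses (Jh0 : 0 <= Jh) (Jv0 : 0 <= Jv).

Lemma xor_domination (W : seq Site) (b : bool) (A : Config -> bool) w0 : uniq W ->
  depends (mem W) A -> incr_config (fun s => (A s)%:R : R) ->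
  measurable [set w | A (fun s => xor_of w s == b)] /\
  (P [set w | A (fun s => xor_of w s == b)] <= (EB (flip_prob Jh Jv) W (fun s => (A s)%:R)
    w0)%:E)%E.
Proof.
move=> uW dA incA.
pose A2 (s1 s2 : Config) : bool := A (fun s => xor_conf s1 s2 s == b).
have dA2 : depends_on_pair W A2.
  move=> s1 s1' s2 s2' e1 e2; apply: dA => s sW.
  by rewrite /xor_conf e1 // e2.
split; first exact: (event_measurable dA2).
apply: (event_le uW dA2).
near=> n.
have inj : {in W &, injective (to_torus n)} by near: n; apply: near_torus_inj.
have dA' : depends (mem W) (fun s => (A s)%:R : R) by move=> s s' /dA ->.
apply: (@le_trans _ _ (\sum_t1 w n t1 * (torus_Z R Jh Jv n
  * EB (flip_prob Jh Jv) W (fun s => (A s)%:R) w0))).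
  apply: ler_sum => t1 _.
  (* Given the first copy, the XOR spin has sign [b] exactly where the second copy agrees with
     [tau]. *)
  pose tau : Config := fun s => if b then periodic t1 s else ~~ periodic t1 s.
  apply: le_trans (_ : _ <= w n t1 * \sum_t2 w n t2 * (A (rel_conf tau t2))%:R) _.
    rewrite mulr_sumr le_eqVlt; apply/orP; left; apply/eqP; apply: eq_bigr => t2 _.
    rewrite -mulrA; congr (_ * (_ * (nat_of_bool (A _))%:R)); apply/funext => s.
    rewrite /xor_conf /rel_conf /tau /periodic; case: (b); rewrite ?eqb_id ?eqbF_neg //.
    by case: (t1 _); case: (t2 _).
  apply: ler_wpM2l; first exact/ltW/torus_weight_gt0.
  exact: (domination Jh0 Jv0 tau inj w0 dA' incA).
by rewrite -mulr_suml -/(torus_Z R Jh Jv n) le_eqVlt; apply/orP; left; apply/eqP; ring.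
Unshelve. all: by end_near.
Qed.

Lemma xor_contour_bound (E : seq PEdge) : uniq E ->
  measurable [set w | all (contour_set (xor_of w)) E] /\
  (P [set w | all (contour_set (xor_of w)) E] <= (\prod_(e <- E) (2
    * contour_weight Jh Jv e.2))%:E)%E.
Proof.
move=> uE.
pose W := undup ([seq e.1 | e <- E] ++ [seq other_end e | e <- E]).
pose A2 (s1 s2 : Config) : bool := all (contour_set (xor_conf s1 s2)) E.
have dA2 : depends_on_pair W A2.
  move=> s1 s1' s2 s2' e1 e2; apply: eq_in_all => e eE.
  have h1 : e.1 \in W by rewrite mem_undup mem_cat map_f.
  have h2 : other_end e \in W by rewrite mem_undup mem_cat map_f ?orbT.
  by rewrite /contour_set /xor_conf !e1 // !e2.
split; first exact: (event_measurable dA2).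
apply: (event_le (undup_uniq _) dA2).
near=> n.
have inj : {in W &, injective (to_torus n)} by near: n; apply: near_torus_inj.
have uT : uniq [seq torus_edge n e | e <- E].
  rewrite map_inj_in_uniq // => -[s b] [s' b'] h h' eq; have /= e1 := congr1 fst eq; have /= -> :=
    congr1 snd eq; congr (_, _).
  by apply: inj e1; rewrite mem_undup mem_cat; apply/orP; left; apply/mapP; [exists (s,
    b)|exists (s', b')].
have := torus_xor_contour_bound Jh0 Jv0 uT; rewrite big_map.
apply: le_trans; rewrite le_eqVlt; apply/orP; left; apply/eqP.
apply: eq_bigr => t1 _; apply: eq_bigr => t2 _; congr (_ * _).
rewrite big_map /A2; elim: (E) => [|e l ih]; first by rewrite big_nil.
by rewrite big_cons /= -ih contour_periodic -natrM mulnb.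
Unshelve. all: by end_near.
Qed.

End Domination.
End Law.

(** * Borel-Cantelli and the high-temperature regime *)

Section BorelCantelli.
Variables (R : realType) (d : measure_display) (Omega : measurableType d) (P : probability Omega R).

Lemma borel_cantelli (F : nat -> set Omega) (a : nat -> R) (C : R) :
  (forall k, measurable (F k)) -> (forall k, (P (F k) <= (a k)%:E)%E) ->
  (forall M, \sum_(0 <= k < M) a k <= C) -> P.-negligible (lim_sup_set F).
Proof.
move=> mF Fa aC; apply/negligibleP.
  by apply: bigcap_measurable => // n _; apply: bigcup_measurable.
apply: lim_sup_set_cvg0 => //; apply: (@le_lt_trans _ _ C%:E); last exact: ltry.
apply: lime_le; first exact: is_cvg_nneseries.
apply: nearW => n; apply: (@le_trans _ _ (\sum_(0 <= k < n) (a k)%:E)%E);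
  first by apply: lee_sum => k _; apply: Fa.
by rewrite sumEFin lee_fin.
Qed.

Lemma negligible_exists (T : countType) (G : T -> set Omega) :
  (forall v, P.-negligible (G v)) -> P.-negligible [set w | exists v, G v w].
Proof.
move=> h; apply: (@negligibleS _ _ _ _ (\bigcup_n (if unpickle n is Some v then G v else set0))).
  by move=> w [v Gv]; exists (pickle v) => //=; rewrite pickleK.
apply: negligible_bigcup => n; by case: (unpickle n) => [v|]; [exact: h | exact: negligible_set0].
Qed.

Lemma not_lim_sup (F : nat -> set Omega) w : ~ lim_sup_set F w ->
  exists N, forall k, (N <= k)%N -> ~ F k w.
Proof.
move=> h; apply: contrapT => n; apply: h => N _; apply: contrapT => hN; apply: n.
by exists N => k Nk Fk; apply: hN; exists k.
Qed.

End BorelCantelli.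

Definition shift_site (v : Site) (k : nat) : Site := (v.1 + k%:Z, v.2).

Lemma infinite_conn_reach (w : Config) v : ~ finite_set [set u | conn_in w v u] ->
  forall N, reach N v w.
Proof.
move=> inf N; apply: contrapT => /negP nr; apply: inf; apply/finite_bounded.
exists (absz v.1 + absz v.2 + N)%N => u /= c; apply: contrapT => /negP hu.
move/negP: nr; apply; apply: reach_of_conn c _.
by move: hu; rewrite /bnd_in; case: (u) (v) => a b [x y] /=; lia.
Qed.

(** Going left from [v], one leaves the filling at a site of the cluster, and this site is at
    distance at least [k] from [shift_site v k]. *)
Lemma fill_cl_reach sg v k (M : nat) : (forall s, cl sg (shift_site v k) s -> bnd_in M s) ->
  fill (cl sg (shift_site v k)) v ->
  reach k (shift_site v k) (fun s => sg s == sg (shift_site v k)).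
Proof.
move=> bM fv; have [j [Ej fj]] := exit_left (fill_bounded bM) fv.
have cj : cl sg (shift_site v k) (v.1 - j%:Z, v.2).
  have ad := adjb_other_end ((v.1 - j.+1%:Z, v.2), true).
  rewrite /other_end /= (_ : v.1 - j.+1%:Z + 1 = v.1 - j%:Z) in ad; last by lia.
  rewrite adjb_sym in ad; apply: (fill_boundary_cl ad fj).
  move: Ej; rewrite /contour_set /other_end /= (_ : v.1 - j.+1%:Z + 1 = v.1 - j%:Z) ?fj;
    last by lia.
  by case: (fill _ _).
move/clP: cj => c; apply: (reach_of_conn c).
by rewrite /shift_site /=; lia.
Qed.

Section HighTemperature.
Variables (R : realType) (Jh Jv : R).
Hypotheses (Jh0 : 0 <= Jh) (Jv0 : 0 <= Jv).
Variables (d : measure_display) (Omega : measurableType d) (P : probability Omega R).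
Variables (sig1 sig2 : Omega -> Config).
Hypothesis law : ising_pair_law R Jh Jv d Omega P sig1 sig2.

Let sg (w : Omega) : Config := xor_conf (sig1 w) (sig2 w).

Lemma xor_reach N x b : let E := [set w | reach N x (fun s => sg w s == b)] in
  measurable E /\ (P E <= (theta (flip_prob Jh Jv) N)%:E)%E.
Proof.
pose W := [seq add_site s x | s <- box N].
have uW : uniq W by rewrite map_inj_uniq ?uniq_box //; apply: can_inj (add_siteK x).
have mW s : bnd_in N (sub_site s x) -> s \in W.
  by move=> h; apply/mapP; exists (sub_site s x); rewrite ?mem_box // sub_siteK.
have dr : depends (mem W) (reach N x).
  by apply: depends_mono (@reach_depends N x).
have [m h] := xor_domination law Jh0 Jv0 b (fun=> false) uW dr (@reach_incr R N x).
split => //; apply: le_trans h _.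
by rewrite (EB_reach _ _ mW).
Qed.

Lemma high_temperature : flip_prob Jh Jv < p_c R ->
  {ae P, forall w, no_inf_cluster_of_sign (sg w) true /\ no_inf_cluster_of_sign (sg w) false /\
     unique_inf_contour (sg w)}.
Proof.
move=> lt; have hp := flip_prob01 Jh Jv; have [p0 _] := andP hp.
have [q [pq q1 tq]] := below_p_c p0 lt.
have [L [S [hS oS phi1]]] := exists_phi_lt1 p0 pq q1 tq.
have [C hC] := theta_sum_bounded hp hS oS phi1.
pose E (x : nat -> Site) b k := [set w | reach k (x k) (fun s => sg w s == b)].
have negl x b : P.-negligible (lim_sup_set (E x b)).
  apply: (borel_cantelli (a := theta (flip_prob Jh Jv)) _ _ hC) => k.
    by have [] := xor_reach k (x k) b.
  by have [] := xor_reach k (x k) b.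
(* A fixed centre excludes infinite clusters; a centre moving along the ray from [v] limits how far
   out a cluster enclosing [v] can meet that ray. *)
pose bad := [set w | exists vb : Site * bool, lim_sup_set (E (fun=> vb.1) vb.2) w] `|`
            [set w | exists vb : Site * bool, lim_sup_set (E (shift_site vb.1) vb.2) w].
have nbad : P.-negligible bad by apply: negligibleU; apply: negligible_exists => vb.
apply: (negligibleS _ nbad) => w nQ; apply: contrapT => /not_orP[g1 g2]; apply: nQ => /=.
have fin v : finite_set (Defs.cluster (sg w) v).
  apply: contrapT => inf; apply: g1; exists (v, sg w v) => /=;
    apply: contrapT => /not_lim_sup[N hN].
  exact: (hN N (leqnn N) (infinite_conn_reach inf N)).
have [e [Ce ie]] : exists e, contour_set (sg w) e /\ ~ finite_set (contour_of (sg w) e).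
  apply: exists_infinite_contour => // v.
  have nb b : exists N, forall k, (N <= k)%N -> ~ E (shift_site v) b k w.
    by apply: not_lim_sup => h; apply: g2; exists (v, b).
  have [N1 h1] := nb true; have [N2 h2] := nb false.
  exists (maxn N1 N2) => k; rewrite geq_max => /andP[k1 k2].
  apply/negP => fv; have [M bM] := cl_bounded fin (shift_site v k).
  have := fill_cl_reach bM fv.
  by case: (sg w (shift_site v k)); [exact: (h1 k k1) | exact: (h2 k k2)].
split; first by move=> v _.
split; first by move=> v _.
exists e; split => //; split => // f Cf jf; exact: infinite_contour_unique.
Qed.

End HighTemperature.

(** * Low temperature *)

Definition axis_dirs : seq Site := [:: (1, 0); (-1, 0); (0, 1); (0, -1)].

Definition no_backtrack (d e : Site) : bool := add_site d e != origin.

(* The primal edge crossed by the dual edge leaving the dual vertex [a] in direction [d]. *)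
Definition crossed (a d : Site) : PEdge :=
  if d.2 == 0 then ((if d.1 == 1 then a.1 + 1 else a.1, a.2), false)
  else ((a.1, if d.2 == 1 then a.2 + 1 else a.2), true).

Fixpoint crossings (a : Site) (s : seq Site) : seq PEdge :=
  if s is d :: s' then crossed a d :: crossings (add_site a d) s' else [::].

Lemma sq_edges_crossed a e : e \in sq_edges a -> exists2 d, d \in axis_dirs & e = crossed a d.
Proof.
case: a => x y; rewrite /sq_edges !inE => /or4P[] /eqP ->.
- by exists (0, -1).
- by exists (0, 1).
- by exists (-1, 0).
- by exists (1, 0).
Qed.

Lemma crossed_sq a b d : d \in axis_dirs -> crossed a d \in sq_edges b -> b = a \/ b = add_site a d.
Proof.
case: a b => x y [z t]; rewrite /axis_dirs !inE => /or4P[] /eqP ->;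
  rewrite /crossed /add_site !xpair_eqE /= ?andbF ?andbT ?orbF ?orFb => h.
- have [[-> ->]|[-> ->]] : (z = x /\ t = y) \/ (z = x + 1 /\ t = y + 0) by lia.
    by left.
  by right.
- have [[-> ->]|[-> ->]] : (z = x /\ t = y) \/ (z = x - 1 /\ t = y + 0) by lia.
    by left.
  by right.
- have [[-> ->]|[-> ->]] : (z = x /\ t = y) \/ (z = x + 0 /\ t = y + 1) by lia.
    by left.
  by right.
- have [[-> ->]|[-> ->]] : (z = x /\ t = y) \/ (z = x + 0 /\ t = y - 1) by lia.
    by left.
  by right.
Qed.

Lemma crossed_back a d e : d \in axis_dirs -> e \in axis_dirs -> ~~ no_backtrack d e ->
  crossed (add_site a d) e = crossed a d.
Proof.
case: a => x y; rewrite /axis_dirs !inE => /or4P[] /eqP -> /or4P[] /eqP -> //= _;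
  rewrite /crossed /add_site /=; congr (_, _, _); lia.
Qed.

(** Consecutive edges share a dual vertex, and gap-freeness keeps three successive ones from sharing
    the same vertex, so the edges trace a walk on dual vertices. A reversal would repeat an edge. *)
Lemma dadj_crossings s e a d : d \in axis_dirs -> e \in sq_edges a ->
  path dadj e (crossed a d :: s) -> uniq (e :: crossed a d :: s) ->
    gap_free dadj e (crossed a d :: s) ->
  exists ds, [/\ size ds = size s, path no_backtrack d ds, {subset ds <= axis_dirs} &
                 crossed a d :: s = crossings a (d :: ds)].
Proof.
elim: s e a d => [|f s ih] e a d dd ea p u g; first by exists [::].
have /andP[_ /andP[cf ps]] := p.
have /andP[/= ne /andP[nf us]] := u.
have [nef gs] := andP g.
have [nn [b [cb fb]]] := dadjP _ _ cf.
have eb : b = add_site a d.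
  have [eb|//] := crossed_sq dd cb; case/negP: nef; apply/dadjP; split.
    by move=> ef; move: ne; rewrite ef !inE eqxx orbT.
  by exists a; split => //; rewrite -eb.
rewrite eb in fb; have [d' dd' ef] := sq_edges_crossed fb.
rewrite ef in p u g nf nn us gs cf ps ih *.
have cs : crossed a d \in sq_edges (add_site a d) by rewrite -eb.
have p1 : path dadj (crossed a d) (crossed (add_site a d) d' :: s) by rewrite /= cf.
have u1 : uniq (crossed a d :: crossed (add_site a d) d' :: s) by case/andP: u.
have [ds [sz pd sub es]] := ih _ _ _ dd' cs p1 u1 gs.
exists (d' :: ds); split => //=; first by rewrite sz.
- rewrite pd andbT; apply: contraT => /(crossed_back a dd dd') h.
  by case: nn.
- by move=> z; rewrite inE => /orP[/eqP -> //|/sub].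
- by rewrite es.
Qed.

Definition dual_path (m : nat) (e : PEdge) (sg : Config) : Prop :=
  exists s, [/\ size s = m, path dadj e s, all (contour_set sg) (e :: s), uniq (e :: s) &
                gap_free dadj e s].

Lemma dadj_dist e f : dadj e f -> `|f.1.1 - e.1.1| <= 1 /\ `|f.1.2 - e.1.2| <= 1.
Proof.
by move=> /dadjP[_ [a [/sq_corner[h1 h2 _ _] /sq_corner[g1 g2 _ _]]]];
  have /andP := corner_dist h1 h2 g1 g2.
Qed.

Lemma dual_path_of_dconn m e f sg : dconn (contour_set sg) e f ->
  (m%:Z <= `|f.1.1 - e.1.1|) || (m%:Z <= `|f.1.2 - e.1.2|) -> dual_path m e sg.
Proof.
move=> [s /and3P[p /eqP l a]] far.
have [t [pt lt at_ ut gt]] := exists_gap_free p a.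
have len z v : path dadj z v -> `|(last z v).1.1 - z.1.1| <= (size v)%:Z /\
    `|(last z v).1.2 - z.1.2| <= (size v)%:Z.
  elim: v z => [|c v ih] z /=; first by rewrite !subrr.
  by move=> /andP[/dadj_dist[h1 h2] /ih[h3 h4]]; split; lia.
have nt : (m <= size t)%N.
  have [h1 h2] := len _ _ pt; rewrite lt l in h1 h2.
  by rewrite -lez_nat; case/orP: far => h; [apply: le_trans h1 | apply: le_trans h2].
exists (take m t); split.
- by rewrite size_takel.
- by have := pt; rewrite -{1}(cat_take_drop m t) cat_path => /andP[].
- move: at_ => /= /andP[-> at_]; apply/allP => z /mem_take; exact: (allP at_).
- move: ut => /= /andP[xt ut]; rewrite take_uniq // andbT.
  by apply: contra xt => /mem_take.
- exact: gap_free_take.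
Qed.

Section LowTemperature.
Variables (R : realType) (Jh Jv : R).
Hypotheses (Jh0 : 0 <= Jh) (Jv0 : 0 <= Jv).
Variables (d : measure_display) (Omega : measurableType d) (P : probability Omega R).
Variables (sig1 sig2 : Omega -> Config).
Hypothesis law : ising_pair_law R Jh Jv d Omega P sig1 sig2.

Let sg (w : Omega) : Config := xor_conf (sig1 w) (sig2 w).
(** A vertical dual step crosses a horizontal edge, hence carries the coupling [Jh]. *)
Let wt (e : Site) : R := 2 * contour_weight Jh Jv (e.2 != 0).

Lemma prod_crossings a s :
  \prod_(e <- crossings a s) (2 * contour_weight Jh Jv e.2) = \prod_(e <- s) wt e.
Proof.
elim: s a => [|e s ih] a /=; first by rewrite !big_nil.
by rewrite !big_cons ih /wt /crossed; case: eqP.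
Qed.

Variables (beta : Site -> R) (lambda B : R).
Hypotheses (l0 : 0 <= lambda) (l1 : lambda < 1) (b1 : forall e, 1 <= beta e)
  (bB : forall e, wt e * beta e <= B).
Hypothesis transfer : forall e, e \in axis_dirs ->
  \sum_(e' <- axis_dirs | no_backtrack e e') wt e' * beta e' <= lambda * beta e.

Let candidates (m : nat) (e : PEdge) : seq (seq PEdge) :=
  [seq crossings a ds | a <- dual_ends e,
     ds <- [seq d :: s | d <- axis_dirs, s <- walks axis_dirs no_backtrack m d]].

Let event (m : nat) (e : PEdge) : set Omega :=
  \big[setU/set0]_(s <- candidates m e | uniq s) [set w | all (contour_set (sg w)) s].

Lemma dual_path_event m e w : dual_path m.+1 e (sg w) -> event m e w.
Proof.
move=> [t [szt p a u g]]; case: t szt p a u g => // f s [sz] p a u g.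
have ef : dadj e f by case/andP: p.
have [ne [x [ex fx]]] := dadjP _ _ ef.
have [d1 dd fe] := sq_edges_crossed fx; rewrite fe in p a u g.
have [ds [szd pd sub eq]] := dadj_crossings dd ex p u g.
rewrite /event -bigcup_seq_cond; exists (crossed x d1 :: s); last by case/andP: a.
apply/andP; split; last by case/andP: u.
rewrite eq; apply/allpairsP; exists (x, d1 :: ds); split; [by rewrite mem_dual_ends | | by []].
apply/allpairsPdep; exists d1, ds; split => //.
by apply: mem_walks => //; rewrite szd.
Qed.

(** The 8 counts two ends of [e] and four first directions; [B] bounds the weight of the first step
    times the [beta] of its direction. The starting edge [e] is not charged. *)
Lemma event_measure m e : measurable (event m e) /\ (P (event m e) <= (8 * B * lambda ^+ m)%:E)%E.
Proof.
have wt0 x : 0 <= wt x by rewrite mulr_ge0 // contour_weight_ge0.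
split.
  apply: bigsetU_measurable => s us.
  by have [] := xor_contour_bound law Jh0 Jv0 us.
rewrite /event -big_filter.
have mE s : s \in [seq s <- candidates m e | uniq s] ->
  measurable [set w | all (contour_set (sg w)) s] /\
    (P [set w | all (contour_set (sg w)) s] <= (\prod_(e <- s) (2
      * contour_weight Jh Jv e.2))%:E)%E.
  by rewrite mem_filter => /andP[us _]; apply: xor_contour_bound us.
pose F s := if s \in [seq s <- candidates m e | uniq s] then [set w | all (contour_set (sg w)) s]
  else set0.
have -> : \big[setU/set0]_(s <- [seq s <- candidates m e | uniq s]) [set w | all (contour_set (sg
  w)) s] =
    \big[setU/set0]_(s <- [seq s <- candidates m e | uniq s]) F s.
  by rewrite big_seq [RHS]big_seq; apply: eq_bigr => s hs; rewrite /F hs.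
apply: le_trans (measure_bigsetU_le _ _ _) _.
  by move=> s; rewrite /F; case: ifP => // /mE[].
apply: (@le_trans _ _ (\sum_(s <- [seq s <- candidates m e | uniq s])
    (\prod_(e <- s) (2 * contour_weight Jh Jv e.2))%:E)%E).
  rewrite big_seq [leRHS]big_seq; apply: lee_sum => s hs.
  by rewrite /F hs; have [] := mE s hs.
rewrite sumEFin lee_fin big_filter.
have p0 s : 0 <= \prod_(e <- s) (2 * contour_weight Jh Jv e.2) :> R.
  by apply: prodr_ge0 => x _; rewrite mulr_ge0 // contour_weight_ge0.
apply: (@le_trans _ _ (\sum_(s <- candidates m e) \prod_(e <- s) (2 * contour_weight Jh Jv e.2))).
  rewrite [leRHS](bigID uniq) /= lerDl; apply: sumr_ge0 => s _; exact: p0.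
rewrite /candidates big_allpairs_dep.
apply: (@le_trans _ _ (\sum_(a <- dual_ends e) 4 * B * lambda ^+ m)); last first.
  rewrite big_const_seq count_predT (_ : size (dual_ends e) = 2%N); last by rewrite /dual_ends;
    case: e.2.
  by rewrite /= addr0; lra.
apply: ler_sum => a _; rewrite big_allpairs_dep.
apply: (@le_trans _ _ (\sum_(x <- axis_dirs) B * lambda ^+ m)); last first.
  by rewrite big_const_seq (_ : count xpredT axis_dirs = 4%N) //= addr0; lra.
rewrite big_seq [leRHS]big_seq; apply: ler_sum => x xd.
under eq_bigr do rewrite (prod_crossings a (_ :: _)) big_cons.
rewrite -mulr_sumr.
have := walks_sum m l0 wt0 b1 transfer xd => h.
apply: le_trans (ler_wpM2l (wt0 x) h) _.
rewrite mulrCA [leRHS]mulrC; apply: ler_wpM2l; first exact: exprn_ge0.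
exact: bB.
Qed.

Lemma low_temperature : {ae P, forall w, unique_inf_cluster (sg w)}.
Proof.
have B0 : 0 <= B.
  apply: le_trans (bB origin); apply: mulr_ge0; last exact: le_trans (b1 _).
  by rewrite mulr_ge0 // contour_weight_ge0.
have sumB M : \sum_(0 <= k < M) (8 * B * lambda ^+ k) <= 8 * B / (1 - lambda).
  rewrite ler_pdivlMr ?subr_gt0 // mulrC; apply: le_trans (geometric_tail l0 (leq0n M) _) _.
    by rewrite mulr_ge0.
  by rewrite expr0 mulr1.
have negl (e : nat -> PEdge) : P.-negligible (lim_sup_set (fun k => event k (e k))).
  apply: (borel_cantelli (a := fun k => 8 * B * lambda ^+ k) _ _ sumB) => k.
    by have [] := event_measure k (e k).
  by have [] := event_measure k (e k).
(* The shift by one makes the distance from [v] equal to the length [k.+1] of the dual path in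
   [event k]. *)
pose row (v : Site) (k : nat) : PEdge := (shift_site v k.+1, true).
pose bad := [set w | exists e : PEdge, lim_sup_set (fun k => event k e) w] `|`
            [set w | exists v : Site, lim_sup_set (fun k => event k (row v k)) w].
have nbad : P.-negligible bad by apply: negligibleU; apply: negligible_exists => vb.
apply: (negligibleS _ nbad) => w nQ; apply: contrapT => /not_orP[g1 g2]; apply: nQ => /=.
have fin e : contour_set (sg w) e -> finite_set (contour_of (sg w) e).
  move=> Ce; apply: contrapT => inf; apply: g1; exists e => /=.
  apply: contrapT => /not_lim_sup[N hN]; apply: (hN N (leqnn N)).
  apply: dual_path_event; have [f ef far] : exists2 f, dconn (contour_set (sg w)) e f &
      (N.+1%:Z <= `|f.1.1 - e.1.1|) || (N.+1%:Z <= `|f.1.2 - e.1.2|).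
    apply: contrapT => nf; apply: inf; apply/finite_bounded_edges.
    exists (absz e.1.1 + absz e.1.2 + N.+1)%N => f ef; apply: contrapT => /negP hf.
    apply: nf; exists f => //; move: hf; rewrite /bnd_in.
    by case: (f) (e) => -[a b] c [[x y] z] /=; lia.
  exact: dual_path_of_dconn ef far.
(* If all clusters were finite, [exists_infinite_contour] would give an infinite contour, which is
   already excluded. *)
have [v iv] : exists v, ~ finite_set (Defs.cluster (sg w) v).
  apply: contrapT => /forallNP nfin.
  have finc v : finite_set (Defs.cluster (sg w) v) by apply: contrapT; apply: nfin.
  have [|e [Ce]] := exists_infinite_contour finc; last by move=> ie; apply: ie; apply: fin.
  move=> v; have [N hN] : exists N, forall k, (N <= k)%N -> ~ event k (row v k) w.
    apply: (not_lim_sup (F := fun k => event k (row v k))) => h; apply: g2; by exists v.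
  exists N.+1 => k Nk; apply/negP => fv.
  have [M bM] := cl_bounded finc (v.1 + k%:Z, v.2).
  (* The boundary of the filling crosses the row at distance [k + k'] to the right of [v] and again
     to the left of [v], so it contains a dual path of length [k + k']. *)
  have [k' [Ek' _]] := exit_right (fill_bounded bM) (fill_subset (cl_self (sg w) (v.1 + k%:Z,
    v.2))).
  have [j [Ej _]] := exit_left (fill_bounded bM) fv.
  have c := fill_cl_contour finc Ek' Ej.
  apply: (hN (k + k').-1); first by lia.
  apply: dual_path_event.
  have er : row v (k + k').-1 = ((v.1 + k%:Z + k'%:Z, v.2), true).
    by rewrite /row /shift_site prednK ?PoszD ?addrA //; lia.
  rewrite er; apply: dual_path_of_dconn c _; apply/orP; left => /=.
  by clear -Nk; lia.
exists v; split => // u iu; exact: unique_infinite_cluster fin iv iu.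
Qed.

End LowTemperature.

(** * Numerical bounds on couplings and contour weights *)

Section Couplings.
Variable R : realType.
Implicit Types J h x y u v : R.

(** This is tanh J <= J with the denominator cleared, and [F] is the difference of the two sides. *)
Lemma tanh_le J : 0 <= J -> 1 - expR (-2 * J) <= J * (1 + expR (-2 * J)).
Proof.
move=> J0; rewrite -subr_le0.
pose F (x : R) : R := 1 - expR (-2 * x) - x * (1 + expR (-2 * x)).
have hd x : is_derive x (1 : R) F (expR (-2 * x) * (1 + 2 * x) - 1).
  have he : is_derive x (1 : R) (fun x => expR (-2 * x)) (-2 * expR (-2 * x)).
    have h1 : is_derive x (1 : R) (fun x => -2 * x) (-2).
      by have := is_deriveZ (-2) (is_derive_id x (1 : R)) => h; apply: is_derive_eq h _;
        rewrite /GRing.scale /= mulr1.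
    have := is_derive1_comp (is_derive_expR (-2 * x)) h1 => h.
    by apply: is_derive_eq h _; rewrite mulrC.
  have := is_deriveB (is_deriveB (is_derive_cst (1 : R) x (1 : R)) he)
    (is_deriveM (is_derive_id x (1 : R)) (is_deriveD (is_derive_cst (1 : R) x (1 : R)) he)).
  move=> h; apply: is_derive_eq h _.
  have sc (a b : R) : a *: (b : R^o) = a * b by [].
  by rewrite !sc !fctE /cst; ring.
have := nonincreasing_of_derive hd (a := 0) (b := J); rewrite /F mulr0 expR0 mul0r !subr0 subrr;
  apply => //.
move=> x /andP[x0 _]; rewrite subr_le0.
have : 1 + 2 * x <= expR (2 * x) by apply: expR_ge1Dx.
have e0 := expR_gt0 (-2 * x).
move=> /(ler_wpM2l (ltW e0)) /le_trans; apply.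
by rewrite -expRD (_ : -2 * x + 2 * x = 0) ?expR0 //; ring.
Qed.

Lemma gibbs_prob_lt h1 h2 : h1 < h2 ->
  expR h1 / (expR h1 + expR (- h1)) < expR h2 / (expR h2 + expR (- h2)).
Proof.
move=> lt; have p x := expR_gt0 x.
rewrite ltr_pdivrMr ?addr_gt0 // mulrAC ltr_pdivlMr ?addr_gt0 //.
rewrite !mulrDr mulrC ltrD2l -!expRD ltr_expR; lra.
Qed.

Lemma critical_field_lt h : expR h / (expR h + expR (- h)) <= 10 / 13 -> h < 2 / 3.
Proof.
move=> hle; rewrite ltNge; apply/negP => h23.
have p x := expR_gt0 x.
have inv : expR h * expR (- h) = 1 by rewrite -expRD subrr expR0.
rewrite ler_pdivrMr ?addr_gt0 // in hle.
have a2 : 3 * expR h ^+ 2 <= 10.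
  have := ler_wpM2l (ltW (p h)) hle; rewrite mulrCA mulrDr inv -expr2; lra.
(* Since e^(2/3) is the fourth power of e^(1/6), it is at least (7/6)^4; as (7/6)^8 exceeds 10/3,
   this contradicts [a2]. *)
have e6 : 7 / 6 <= expR (1 / 6 : R) by have := expR_ge1Dx (1 / 6 : R); lra.
have e4 : expR (1 / 6 : R) ^+ 4 <= expR h.
  rewrite -expRM_natl ler_expR; lra.
have b4 : (7 / 6 : R) ^+ 4 <= expR h.
  by apply: le_trans e4; apply: lerXn2r; rewrite ?nnegrE //; lra.
have q0 : 0 <= (7 / 6 : R) ^+ 4 by apply: exprn_ge0; lra.
have : ((7 / 6 : R) ^+ 4) ^+ 2 <= expR h ^+ 2.
  by apply: lerXn2r => //; rewrite nnegrE // ltW.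
by rewrite !exprS expr0; lra.
Qed.

Lemma dual_weight_le J J' : 0 <= J ->
  expR (-2 * J) + expR (-2 * J') + expR (-2 * J - 2 * J') = 1 -> expR (-2 * J') <= J.
Proof.
move=> J0; rewrite (_ : -2 * J - 2 * J' = -2 * J + -2 * J'); last by ring.
rewrite expRD => e; have := tanh_le J0; have := expR_gt0 (-2 * J) => y0.
have -> : 1 - expR (-2 * J) = expR (-2 * J') * (1 + expR (-2 * J)) by lra.
by rewrite ler_pM2r // addr_gt0.
Qed.

Section Subcritical.
Variables (Jh Jv : R) (d : measure_display) (Omega : measurableType d) (P : probability Omega R).
Variables (sig1 sig2 : Omega -> Config).
Hypothesis law : ising_pair_law R Jh Jv d Omega P sig1 sig2.

(* [(1 + v, 1 + u)] is the sum of [(2 v, 1 - u)] and [(1 - v, 2 u)], each of which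
   satisfies one of the two equations [M b = b] for the transfer matrix
   [M = [[u, 2 v], [2 u, v]]]; it is contracted exactly when [u + v + 3 u v < 1]. *)
Lemma low_temperature_of_weights : 0 <= Jh -> 0 <= Jv ->
  2 * (expR (-2 * Jh) + expR (-2 * Jv)) < 2 / 3 ->
  {ae P, forall w, unique_inf_cluster (xor_conf (sig1 w) (sig2 w))}.
Proof.
move=> Jh0 Jv0 lt.
pose u : R := 2 * expR (-2 * Jv); pose v : R := 2 * expR (-2 * Jh).
have u0 : 0 < u by rewrite mulr_gt0 ?expR_gt0.
have v0 : 0 < v by rewrite mulr_gt0 ?expR_gt0.
have uv : u + v < 2 / 3 by rewrite /u /v; lra.
pose dl : R := 1 - u - v - 3 * (u * v).
have uv1 : u * v <= 1 by apply: mulr_ile1; lra.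
have uv0 : 0 < u * v by apply: mulr_gt0.
have d0 : 0 < dl.
  (* With s = u + v one has u v <= s^2 / 4, and for s >= 0 the inequality s + 3 s^2 / 4 < 1 means s
     < 2/3. *)
  have sq := sqr_ge0 (u - v); rewrite expr2 in sq.
  have m : 0 <= (u + v) * (2 / 3 - (u + v)) by apply: mulr_ge0; lra.
  rewrite /dl; lra.
have d1 : dl <= 1 by rewrite /dl; lra.
pose beta (e : Site) : R := if e.2 != 0 then 1 + u else 1 + v.
have wtE e : 2 * contour_weight Jh Jv (e.2 != 0) = if e.2 != 0 then v else u :> R.
  by rewrite /contour_weight /tcoupling; case: ifP.
(* The transfer matrix lowers both entries of [beta] by exactly [dl], which is at least
   [dl / 2 * beta] since [beta <= 2]. *)
apply: (low_temperature Jh0 Jv0 law (beta := beta) (lambda := 1 - dl / 2) (B := 4)).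
- lra.
- lra.
- by move=> e; rewrite /beta; case: ifP => _; lra.
- by move=> e; rewrite wtE /beta; case: ifP => _; lra.
move=> e ed; rewrite (eq_bigr (fun e' : Site => (if e'.2 != 0 then v else u) * beta e'));
  last first.
  by move=> e' _; rewrite wtE.
have rowh : u * (1 + v) + 2 * (v * (1 + u)) = 1 + v - dl by rewrite /dl; ring.
have rowv : 2 * (u * (1 + v)) + v * (1 + u) = 1 + u - dl by rewrite /dl; ring.
have mh : 0 <= dl * (1 - v) by apply: mulr_ge0; lra.
have mv : 0 <= dl * (1 - u) by apply: mulr_ge0; lra.
move: ed; rewrite /axis_dirs !inE /beta => /or4P[] /eqP ->; rewrite !big_cons big_nil /=; lra.
Qed.

End Subcritical.

End Couplings.

Theorem theorem1p11 (R : realType) (Jh Jv h0 : R) :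
  0 <= Jh -> 0 <= Jv -> 0 < h0 ->
  expR h0 / (expR h0 + expR (- h0)) = p_c R ->
  1 < expR (-2 * Jh) + expR (-2 * Jv) + expR (-2 * Jh - 2 * Jv) ->
  2 * (Jh + Jv) < h0 ->
  (forall (d : measure_display) (Omega : measurableType d)
          (P : probability Omega R) (sig1 sig2 : Omega -> Config),
     @ising_pair_law R Jh Jv d Omega P sig1 sig2 ->
     {ae P, forall w : Omega,
        no_inf_cluster_of_sign (xor_conf (sig1 w) (sig2 w)) true /\
        no_inf_cluster_of_sign (xor_conf (sig1 w) (sig2 w)) false /\
        unique_inf_contour (xor_conf (sig1 w) (sig2 w))}) /\
  (forall Jh' Jv' : R, 0 < Jh' -> 0 < Jv' ->
     expR (-2 * Jh) + expR (-2 * Jv') + expR (-2 * Jh - 2 * Jv') = 1 ->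
     expR (-2 * Jh') + expR (-2 * Jv) + expR (-2 * Jh' - 2 * Jv) = 1 ->
     expR (-2 * Jh') + expR (-2 * Jv') + expR (-2 * Jh' - 2 * Jv') < 1 /\
     (forall (d : measure_display) (Omega : measurableType d)
             (P : probability Omega R) (sig1 sig2 : Omega -> Config),
        @ising_pair_law R Jh' Jv' d Omega P sig1 sig2 ->
        {ae P, forall w : Omega,
           unique_inf_cluster (xor_conf (sig1 w) (sig2 w))})).

Proof.
move=> Jh0 Jv0 h00 hpc high lt.
have p x := expR_gt0 (x : R).
split=> [d Omega P sig1 sig2 law|Jh' Jv' Jh0' Jv0' e1 e2].
  apply: (high_temperature Jh0 Jv0 law).
  by rewrite -hpc; apply: gibbs_prob_lt.
have h23 : h0 < 2 / 3 by apply: critical_field_lt; rewrite hpc; apply: p_c_bound.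
have xv := dual_weight_le Jh0 e1.
have xh : expR (-2 * Jh') <= Jv.
  apply: dual_weight_le Jv0 _; rewrite -[RHS]e2; congr (_ + expR _); last by ring.
  by rewrite addrC.
split; last first.
  move=> d Omega P sig1 sig2 law.
  (* The sum of the two weights is at most [2 * (Jh + Jv)], hence below [h0] and 2/3. *)
  by apply: (low_temperature_of_weights law); [exact: ltW | exact: ltW | lra].
have sp (a b : R) : expR (-2 * a - 2 * b) = expR (-2 * a) * expR (-2 * b).
  by rewrite -expRD; congr expR; ring.
move: high e1 e2; rewrite !sp.
have := p (-2 * Jh); have := p (-2 * Jv); have := p (-2 * Jh'); have := p (-2 * Jv').
set a := expR (-2 * Jh); set b := expR (-2 * Jv); set a' := expR (-2 * Jh'); set b' := expR (-2 * Jv').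
move=> b0' a0' b0 a0 high e1 e2.
(* The relation x + y + x y = 1 is (1 + x) (1 + y) = 2. The two dual relations make the four factors
   multiply to 4, and the high-temperature pair takes more than 2 of it. *)
have k1 : (1 + a) * (1 + b') = 2 by lra.
have k2 : (1 + a') * (1 + b) = 2 by lra.
have k3 : 2 < (1 + a) * (1 + b) by lra.
have k4 : (1 + a') * (1 + b') * ((1 + a) * (1 + b)) = 4 by rewrite mulrACA [X in _ * X]mulrC; nra.
have q0 : 0 < (1 + a') * (1 + b') by apply: mulr_gt0; lra.
suff : (1 + a') * (1 + b') < 2 by lra.
by rewrite ltNge; apply/negP => ge2; nra.
Qed.
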